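(* Let $d\geq 3$ and let $P$ be a simplicial regular polytope in $\mathbb{R}^d$ having its vertices on $S^{d-1}$. Let $f_0(P)$ be the number of vertices of $P$, and let $\varphi_P$ be the acute angle such that the edge length of $P$ is $2\sin\varphi_P$. Then there exist $\varepsilon_P>0$ and $c_P>0$ (depending only on $P$) such that the following holds. If $\varepsilon\in[0,\varepsilon_P)$, $k\geq f_0(P)$, and $x_1,\ldots,x_k\in S^{d-1}$ are centers of non-overlapping spherical balls of radius at least $\varphi_P-\varepsilon$, then $k=f_0(P)$, and there exists $\Phi\in O(d)$ such that for any $x_i$ one finds a vertex $v$ of $P$ satisfying $\delta(x_i,\Phi v)\leq c_P\,\varepsilon$.
   Context: $S^{d-1}$ is the Euclidean unit sphere of $\mathbb{R}^d$ centered at the origin. For $u,v\in S^{d-1}$, $\delta(u,v)\in[0,\pi]$ is the spherical (geodesic) distance, i.e. the angle between $u$ and $v$ as vectors of $\mathbb{R}^d$. The spherical ball with center $p\in S^{d-1}$ and radius $\varphi\in(0,\pi/2)$ is $B(p,\varphi)=\{x\in S^{d-1}:\delta(x,p)\le\varphi\}$; balls are non-overlapping if their interiors are pairwise disjoint. $O(d)$ is the orthogonal group. The simplicial regular polytopes in $\mathbb{R}^d$, $d\ge 3$, are: the regular simplex ($f_0=d+1$, $\varphi_P=\frac12\arccos\frac{-1}{d}$) and the regular crosspolytope ($f_0=2d$, $\varphi_P=\frac{\pi}{4}$) in all dimensions, the regular icosahedron in $\mathbb{R}^3$ ($f_0=12$, $\varphi_P=\frac12\arccos\frac1{\sqrt5}$),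 and the $600$-cell (Schl\''afli symbol $(3,3,5)$) in $\mathbb{R}^4$ ($f_0=120$, $\varphi_P=\frac{\pi}{10}$). *)

(* Defs.v *)
From HB Require Import structures.
From mathcomp Require Import all_boot all_order all_algebra finmap.
From mathcomp Require Import all_classical all_reals all_analysis.

Set Implicit Arguments.
Unset Strict Implicit.
Unset Printing Implicit Defensive.

Import Order.TTheory GRing.Theory Num.Theory numFieldNormedType.Exports.

Local Open Scope classical_set_scope.
Local Open Scope ring_scope.

(* Points of R^d are column vectors 'cV[R]_d.  The norm that the library puts
   on matrices is the sup norm (it induces the usual topology), hence the
   explicit Euclidean structure. *)
Definition dot (R : realType) (d : nat) (u v : 'cV[R]_d) : R :=
  \sum_(i < d) u i 0 * v i 0.

Definition enorm (R : realType) (d : nat) (u : 'cV[R]_d) : R :=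
  Num.sqrt (dot u u).

Definition unit_sphere (R : realType) (d : nat) : set 'cV[R]_d :=
  [set u | enorm u = 1].

Definition orthogonal_mx (R : realType) (d : nat) (A : 'M[R]_d) : Prop :=
  A^T *m A = 1%:M.

Definition sdist (R : realType) (d : nat) (u v : 'cV[R]_d) : R :=
  acos (dot u v).

Definition sball (R : realType) (d : nat) (p : 'cV[R]_d) (r : R) :
    set 'cV[R]_d :=
  [set x | unit_sphere x /\ sdist x p <= r].

(* The interior is relative to the sphere: a spherical ball has empty interior
   in R^d. *)
Definition sball_interior (R : realType) (d : nat) (p : 'cV[R]_d) (r : R) :
    set 'cV[R]_d :=
  @interior (subspace (@unit_sphere R d)) (sball p r).

Definition conv (R : realType) (d n : nat) (v : 'I_n -> 'cV[R]_d) :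
    set 'cV[R]_d :=
  [set x | exists c : 'I_n -> R,
    [/\ forall i, 0 <= c i, \sum_(i < n) c i = 1 &
        x = \sum_(i < n) c i *: v i]].

Definition segment (R : realType) (d : nat) (u v : 'cV[R]_d) :
    set 'cV[R]_d :=
  [set x | exists2 t : R, 0 <= t <= 1 & x = (1 - t) *: u + t *: v].

Definition affinely_independent (R : realType) (d n : nat)
    (v : 'I_n -> 'cV[R]_d) : Prop :=
  forall c : 'I_n -> R,
    \sum_(i < n) c i = 0 -> \sum_(i < n) c i *: v i = 0 -> forall i, c i = 0.

Definition simplex (R : realType) (d : nat) (F : set 'cV[R]_d) : Prop :=
  exists n (v : 'I_n -> 'cV[R]_d), affinely_independent v /\ F = conv v.

(* A polytope in R^d is full-dimensional, i.e. has nonempty interior. *)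
Definition polytope (R : realType) (d : nat) (P : set 'cV[R]_d) : Prop :=
  (exists n (v : 'I_n -> 'cV[R]_d), P = conv v) /\ P° !=set0.

(* Nonempty proper faces: intersections of P with a supporting hyperplane
   {x | dot a x = b}.  The degenerate case a = 0 only yields set0 and P, which
   are both excluded. *)
Definition face (R : realType) (d : nat) (P F : set 'cV[R]_d) : Prop :=
  [/\ F !=set0, F <> P &
      exists (a : 'cV[R]_d) (b : R),
        (forall x, P x -> dot a x <= b) /\ F = [set x | P x /\ dot a x = b]].

Definition facet (R : realType) (d : nat) (P F : set 'cV[R]_d) : Prop :=
  face P F /\ forall G, face P G -> F `<=` G -> G = F.

Definition vertices (R : realType) (d : nat) (P : set 'cV[R]_d) :
    set 'cV[R]_d :=
  [set v | face P [set v]].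

Definition f0 (R : realType) (d : nat) (P : set 'cV[R]_d) : nat :=
  #|` fset_set (vertices P)|%fset.

Definition edge (R : realType) (d : nat) (P : set 'cV[R]_d)
    (u v : 'cV[R]_d) : Prop :=
  u <> v /\ face P (segment u v).

Definition edge_length (R : realType) (d : nat) (P : set 'cV[R]_d)
    (l : R) : Prop :=
  (exists u v, edge P u v) /\ (forall u v, edge P u v -> enorm (u - v) = l).

Definition simplicial_polytope (R : realType) (d : nat) (P : set 'cV[R]_d) : Prop :=
  forall F, facet P F -> simplex F.

(* A flag is a maximal chain of nonempty proper faces. *)
Definition flag (R : realType) (d : nat) (P : set 'cV[R]_d)
    (C : set (set 'cV[R]_d)) : Prop :=
  let chain D := D `<=` face P /\ total_on D subset in
  chain C /\ forall D, chain D -> C `<=` D -> D = C.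

(* The affine map x |-> A x + b is a Euclidean symmetry of P. *)
Definition symmetry (R : realType) (d : nat) (P : set 'cV[R]_d)
    (A : 'M[R]_d) (b : 'cV[R]_d) : Prop :=
  orthogonal_mx A /\ [set A *m x + b | x in P] = P.

(* Regularity is flag-transitivity of the symmetry group. *)
Definition regular_polytope (R : realType) (d : nat) (P : set 'cV[R]_d) : Prop :=
  forall C D, flag P C -> flag P D ->
    exists (A : 'M[R]_d) (b : 'cV[R]_d),
      symmetry P A b /\ [set [set A *m x + b | x in F] | F in C] = D.

(* Main.v *)
Require Import Defs.
From HB Require Import structures.
From mathcomp Require Import all_boot all_order all_algebra finmap.
From mathcomp Require Import all_classical all_reals all_analysis.
From mathcomp Require Import complex.
From mathcomp Require Import ring lra zify.

(** The facets of P are regular simplices with all inner products of distinct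
vertices equal to s = cos (2 phiP), because the vertices lie on the unit sphere
and the edges have equal length.  Two facets that share a ridge are mirror images
in the hyperplane spanned by the ridge and the origin (fs_crossE), and the facets
that one meets in turning around a face of codimension 2 never rise above the
hyperplane of the first one.  So the dihedral angle at such a face, seen from the
origin, is 2 pi / m with m = 3, 4 or 5 (fs_angle), which leaves s = - 1 / d, s = 0,
s = 1 / sqrt 5 with d = 3, and s = tau / 2 with d = 4, where tau = (1 + sqrt 5) / 2
(facet_system_rigid).  Let N be d + 1, 2 d, 12 and 120 respectively.

Non-overlapping balls of radius at least phiP - eps have centres whose mutual
inner products are at most s + 2 eps (sball_overlap, code_of_balls).  In each of
the four cases the linear programming bound for such codes is tight: there is a
polynomial p, equal to a constant plus a positive definite function on the
sphere, that is nonpositive on [- 1, s] and gives the bound N (lp_cert and the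
lemmas cert_...).  The positive definite functions come from explicit feature
maps: t and t ^ 2 - 1 / d in all dimensions, Chebyshev and Legendre polynomials for
d = 2 and 3, and for d = 4 the characters of SU(2), which are the Chebyshev
polynomials of the second kind.  When N points have inner products at most s + e,
the slack in the bound is O(e); hence each inner product is within O(e) of s or
stays away from s.  A second polynomial, vanishing at the other inner products of
an optimal code, then counts the neighbours: every point has as many as a vertex of
P (lp_stability).

Nearly optimal codes inherit the combinatorics of P: d points that are mutually
adjacent (inner product close to s) form a nearly regular simplex, and every one of
its ridges is shared with a second such simplex.  This property, rigid, is read off
directly from the neighbour count for the simplex, the crosspolytope and the
pentagon; it ascends from the neighbours of a point, projected to the orthogonal
complement of that point, to the code itself (rigid_link), which gives the
icosahedron from the pentagon and the 600-cell from the icosahedron.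

Finally the vertices of a facet of P form a basis, so an orthogonal matrix Phi
carries them to d mutually adjacent points of the code up to O(eps)
(near_congruent), and a walk through the facets of P is copied in the code.  Each
crossing is a reflection, which is determined by the ridge stably under O(eps)
errors (near_mirror), so every point met by the walk in the code is within O(eps) of
the image under Phi of a vertex met in P (walk_near).  An explicit walk in each case
meets N distinct vertices.  So f0 P is at least N, while the linear programming
bound excludes k > N; hence k = f0 P = N, and the walk in the code has met all the
points (near_vertices).  Distances turn into angles by sdist_le_enorm. *)

Import Order.TTheory GRing.Theory Num.Theory numFieldNormedType.Exports.
Local Open Scope classical_set_scope.
Local Open Scope ring_scope.
Set Implicit Arguments.
Unset Strict Implicit.
Unset Printing Implicit Defensive.

Local Notation conv := Defs.conv.

(** * Euclidean geometry of column vectors *)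

Lemma dotC (R : realType) d (u v : 'cV[R]_d) : dot u v = dot v u.
Proof. by apply: eq_bigr => i _; rewrite mulrC. Qed.

Lemma dotDl (R : realType) d (u v w : 'cV[R]_d) :
  dot (u + v) w = dot u w + dot v w.
Proof. by rewrite -big_split; apply: eq_bigr => i _; rewrite mxE mulrDl. Qed.

Lemma dotDr (R : realType) d (u v w : 'cV[R]_d) :
  dot w (u + v) = dot w u + dot w v.
Proof. by rewrite dotC dotDl !(dotC w). Qed.

Lemma dotZl (R : realType) d (c : R) (u v : 'cV[R]_d) :
  dot (c *: u) v = c * dot u v.
Proof. by rewrite mulr_sumr; apply: eq_bigr => i _; rewrite mxE mulrA. Qed.

Lemma dotZr (R : realType) d (c : R) (u v : 'cV[R]_d) :
  dot u (c *: v) = c * dot u v.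
Proof. by rewrite dotC dotZl dotC. Qed.

Lemma dotNl (R : realType) d (u v : 'cV[R]_d) : dot (- u) v = - dot u v.
Proof. by rewrite -scaleN1r dotZl mulN1r. Qed.

Lemma dotNr (R : realType) d (u v : 'cV[R]_d) : dot u (- v) = - dot u v.
Proof. by rewrite dotC dotNl dotC. Qed.

Lemma dotBl (R : realType) d (u v w : 'cV[R]_d) :
  dot (u - v) w = dot u w - dot v w.
Proof. by rewrite dotDl dotNl. Qed.

Lemma dotBr (R : realType) d (u v w : 'cV[R]_d) :
  dot w (u - v) = dot w u - dot w v.
Proof. by rewrite dotDr dotNr. Qed.

Lemma dot0l (R : realType) d (u : 'cV[R]_d) : dot 0 u = 0.
Proof. by rewrite -(scale0r 0) dotZl mul0r. Qed.

Lemma dot0r (R : realType) d (u : 'cV[R]_d) : dot u 0 = 0.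
Proof. by rewrite dotC dot0l. Qed.

Lemma dot_suml (R : realType) d (I : Type) (r : seq I) (Q : pred I)
    (F : I -> 'cV[R]_d) w :
  dot (\sum_(i <- r | Q i) F i) w = \sum_(i <- r | Q i) dot (F i) w.
Proof.
elim/big_rec2: _ => [|i y x _ <-]; first exact: dot0l.
exact: dotDl.
Qed.

Lemma dot_sumr (R : realType) d (I : Type) (r : seq I) (Q : pred I)
    (F : I -> 'cV[R]_d) w :
  dot w (\sum_(i <- r | Q i) F i) = \sum_(i <- r | Q i) dot w (F i).
Proof. by rewrite dotC dot_suml; apply: eq_bigr => i _; rewrite dotC. Qed.

Lemma dotE (R : realType) d (u v : 'cV[R]_d) : dot u v = (u^T *m v) 0 0.
Proof. by rewrite mxE; apply: eq_bigr => i _; rewrite mxE. Qed.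

Lemma dot_ge0 (R : realType) d (u : 'cV[R]_d) : 0 <= dot u u.
Proof. by apply: sumr_ge0 => i _; rewrite -expr2 sqr_ge0. Qed.

Lemma dot_eq0 (R : realType) d (u : 'cV[R]_d) : dot u u = 0 -> u = 0.
Proof.
move=> /eqP; rewrite psumr_eq0; last by move=> i _; rewrite -expr2 sqr_ge0.
move=> /allP h; apply/matrixP => i j; rewrite ord1 mxE.
have := h i (mem_index_enum _); rewrite -expr2 sqrf_eq0 => /eqP; exact.
Qed.

Lemma dot_gt0 (R : realType) d (u : 'cV[R]_d) : u != 0 -> 0 < dot u u.
Proof.
by move=> u0; rewrite lt_def dot_ge0 andbT; apply: contra_neq u0 => /dot_eq0.
Qed.

Lemma dot_orth (R : realType) d (A : 'M[R]_d) u v : orthogonal_mx A ->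
  dot (A *m u) (A *m v) = dot u v.
Proof.
by move=> oA; rewrite !dotE trmx_mul -mulmxA (mulmxA A^T) oA mul1mx.
Qed.

Lemma orthogonal_mx_mul (R : realType) d (A B : 'M[R]_d) :
  orthogonal_mx A -> orthogonal_mx B -> orthogonal_mx (A *m B).
Proof.
move=> oA oB; rewrite /orthogonal_mx trmx_mul -mulmxA (mulmxA A^T) oA mul1mx.
exact: oB.
Qed.

Lemma orthogonal_mx_tr (R : realType) d (A : 'M[R]_d) :
  orthogonal_mx A -> orthogonal_mx A^T.
Proof. by move=> oA; rewrite /orthogonal_mx trmxK; apply: mulmx1C. Qed.

Lemma cauchy_schwarz (R : realType) d (u v : 'cV[R]_d) :
  dot u v ^+ 2 <= dot u u * dot v v.
Proof.
have [->|v0] := eqVneq v 0; first by rewrite !dot0r expr0n mulr0.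
have vv := dot_gt0 v0.
have := dot_ge0 (dot v v *: u - dot u v *: v).
rewrite dotBl !dotBr !dotZl !dotZr (dotC v u).
set p := dot u u; set q := dot v v in vv *; set t := dot u v => h.
have -> : p * q = q^-1 * (q * (q * p)) by field; rewrite gt_eqF.
have -> : t ^+ 2 = q^-1 * (q * t ^+ 2) by field; rewrite gt_eqF.
rewrite ler_pM2l ?invr_gt0 //; nra.
Qed.

Lemma enorm_ge0 (R : realType) d (u : 'cV[R]_d) : 0 <= enorm u.
Proof. exact: sqrtr_ge0. Qed.

Lemma sqr_enorm (R : realType) d (u : 'cV[R]_d) : enorm u ^+ 2 = dot u u.
Proof. by rewrite sqr_sqrtr // dot_ge0. Qed.

Lemma enorm_eq0 (R : realType) d (u : 'cV[R]_d) : enorm u = 0 -> u = 0.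
Proof. by move=> h; apply: dot_eq0; rewrite -sqr_enorm h expr0n. Qed.

Lemma unit_sphereE (R : realType) d (u : 'cV[R]_d) :
  unit_sphere u <-> dot u u = 1.
Proof.
rewrite /unit_sphere /=; split => h; first by rewrite -sqr_enorm h expr1n.
by rewrite /enorm h sqrtr1.
Qed.

Lemma dot_le_enorm (R : realType) d (u v : 'cV[R]_d) :
  `|dot u v| <= enorm u * enorm v.
Proof.
rewrite -(@ler_pXn2r _ 2) ?nnegrE ?mulr_ge0 ?enorm_ge0 //.
by rewrite real_normK ?num_real // exprMn !sqr_enorm cauchy_schwarz.
Qed.

Lemma enormD (R : realType) d (u v : 'cV[R]_d) :
  enorm (u + v) <= enorm u + enorm v.
Proof.
rewrite -(@ler_pXn2r _ 2) ?nnegrE ?addr_ge0 ?enorm_ge0 //.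
rewrite sqr_enorm dotDl !dotDr (dotC v u) sqrrD !sqr_enorm.
have := le_trans (ler_norm _) (dot_le_enorm u v); lra.
Qed.

Lemma enormZ (R : realType) d c (u : 'cV[R]_d) :
  enorm (c *: u) = `|c| * enorm u.
Proof.
by rewrite /enorm dotZl dotZr mulrA -expr2 sqrtrM ?sqr_ge0 // sqrtr_sqr.
Qed.

Lemma enormN (R : realType) d (u : 'cV[R]_d) : enorm (- u) = enorm u.
Proof. by rewrite /enorm dotNl dotNr opprK. Qed.

Lemma enorm0 (R : realType) d : enorm (0 : 'cV[R]_d) = 0.
Proof. by rewrite /enorm dot0l sqrtr0. Qed.

Lemma enorm_sum (R : realType) d (I : finType) (F : I -> 'cV[R]_d) :
  enorm (\sum_i F i) <= \sum_i enorm (F i).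
Proof.
elim/big_rec2: _ => [|i y x _ h]; first by rewrite enorm0.
by apply: le_trans (enormD _ _) _; rewrite lerD2l.
Qed.

Lemma enorm_orth (R : realType) d (A : 'M[R]_d) u : orthogonal_mx A ->
  enorm (A *m u) = enorm u.
Proof. by move=> oA; rewrite /enorm dot_orth. Qed.

Lemma enorm_le1P (R : realType) d (u : 'cV[R]_d) (e : R) : 0 <= e ->
  (enorm u <= e) = (dot u u <= e ^+ 2).
Proof.
by move=> e0; rewrite -(@ler_pXn2r _ 2) ?nnegrE ?enorm_ge0 // sqr_enorm.
Qed.

Lemma le_coord_enorm (R : realType) d (u : 'cV[R]_d) i : `|u i 0| <= enorm u.
Proof.
rewrite -(@ler_pXn2r _ 2) ?nnegrE ?enorm_ge0 // sqr_enorm.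
rewrite real_normK ?num_real // /dot (bigD1 i) //= -expr2 lerDl.
by apply: sumr_ge0 => j _; rewrite -expr2 sqr_ge0.
Qed.

Lemma enorm_le_coord (R : realType) d (u : 'cV[R]_d) e : 0 <= e ->
  (forall i, `|u i 0| <= e) -> enorm u <= d%:R * e.
Proof.
move=> e0 h.
have ule i : dot (u i 0 *: delta_mx i 0) (u i 0 *: delta_mx i 0) <= e ^+ 2.
  rewrite dotZl dotZr /dot (bigD1 i) //= !mxE !eqxx !mulr1.
  rewrite big1 ?addr0 => [|j /negPf ji].
    rewrite mulr1 -expr2 -(@real_normK _ (u i 0)) ?num_real //.
    by rewrite ler_pXn2r ?nnegrE.
  by rewrite !mxE ji mul0r.
have -> : u = \sum_i u i 0 *: delta_mx i 0.
  by rewrite {1}(matrix_sum_delta u); apply: eq_bigr => i _; rewrite big_ord1.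
apply: le_trans (enorm_sum _) _.
rewrite mulr_natl -[X in e *+ X](card_ord d) -sumr_const.
by apply: ler_sum => i _; rewrite enorm_le1P.
Qed.

(** Reflecting in the hyperplane that bisects u and v exchanges them. *)
Lemma orthogonal_transitive (R : realType) d (u v : 'cV[R]_d) :
  dot u u = dot v v -> exists2 H : 'M[R]_d, orthogonal_mx H & H *m u = v.
Proof.
move=> uv; have [->|wn0] := eqVneq u v.
  by exists 1%:M; rewrite ?mul1mx // /orthogonal_mx trmx1 mul1mx.
have := dot_gt0 (_ : u - v != 0); rewrite subr_eq0 => /(_ wn0) w0.
set w := u - v in w0 *; set k := dot w w in w0.
have wwT : w^T *m w = k%:M by rewrite [LHS]mx11_scalar -dotE.
have [c ck] : exists c : R, c * k = 2 by exists (2 / k); rewrite divfK ?gt_eqF.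
pose H := 1%:M - c *: (w *m w^T).
have HT : H^T = H by rewrite /H linearB /= linearZ /= trmx1 trmx_mul trmxK.
exists H.
  rewrite /orthogonal_mx HT /H mulmxBl mul1mx mulmxBr mulmx1.
  rewrite -!scalemxAl -!scalemxAr -!mulmxA (mulmxA w^T) wwT mul_scalar_mx.
  rewrite -scalemxAr !scalerA -[RHS]addr0 -addrA; congr (_ + _).
  rewrite opprB addrA -!scaleNr -!scalerDl.
  by rewrite ck (_ : _ + _ = 0) ?scale0r //; ring.
rewrite /H mulmxBl mul1mx -scalemxAl -mulmxA.
have -> : w^T *m u = (dot w u)%:M by rewrite [LHS]mx11_scalar -dotE.
rewrite mul_mx_scalar scalerA.
have -> : dot w u = k / 2.
  by rewrite /k /w !dotBl !dotBr -uv (dotC v u); field.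
by rewrite mulrA ck divff ?pnatr_eq0 // scale1r subKr.
Qed.

Definition mxbounded (R : realType) m n (A : 'M[R]_(m, n)) (e : R) :=
  forall i j, `|A i j| <= e.

Lemma mxbounded_mul (R : realType) m n p (A : 'M[R]_(m, n)) (B : 'M[R]_(n, p))
    a b :
  mxbounded A a -> mxbounded B b -> mxbounded (A *m B) (n%:R * (a * b)).
Proof.
move=> hA hB i j; rewrite mxE; apply: le_trans (ler_norm_sum _ _ _) _.
rewrite mulr_natl -[X in _ *+ X](card_ord n) -sumr_const.
by apply: ler_sum => k _; rewrite normrM ler_pM.
Qed.

Lemma mxbounded_ex (R : realType) m n (A : 'M[R]_(m, n)) :
  exists2 a, 0 <= a & mxbounded A a.
Proof.
exists (\sum_i \sum_j `|A i j|).
  by apply: sumr_ge0 => i _; apply: sumr_ge0.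
move=> i j; rewrite (bigD1 i) //= (bigD1 j) //= -addrA lerDl.
by apply: addr_ge0; apply: sumr_ge0 => // k _; apply: sumr_ge0.
Qed.

Lemma mxbounded_orth (R : realType) d (A : 'M[R]_d) :
  orthogonal_mx A -> mxbounded A 1.
Proof.
move=> oA i j.
have h : dot (col j A) (col j A) = 1.
  transitivity ((A^T *m A) j j); last by rewrite oA mxE eqxx.
  by rewrite mxE; apply: eq_bigr => k _; rewrite !mxE.
have := le_coord_enorm (col j A) i.
by rewrite mxE /enorm h sqrtr1.
Qed.

(** * Almost orthonormal frames and mirror images *)

(** Rotating the first column onto a coordinate axis almost splits off a
    one-dimensional block; the complementary block is again almost orthogonal,
    with a larger error. *)
Lemma near_orthogonal (R : realType) n : exists2 C : R, 0 <= C &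
  exists2 e0 : R, 0 < e0 & forall (M : 'M[R]_n) e, 0 <= e <= e0 ->
    mxbounded (M^T *m M - 1%:M) e ->
    exists2 Phi : 'M[R]_n, orthogonal_mx Phi & mxbounded (M - Phi) (C * e).
Proof.
elim: n => [|n [C C0 [e0 e00 IH]]].
  exists 0 => //; exists 1 => // M e _ _; exists 1%:M; last by case.
  by rewrite /orthogonal_mx trmx1 mul1mx.
exists (n.+1%:R * (1 * (2 + 3 * C))).
  by rewrite mulr_ge0 ?ler0n // mul1r addr_ge0 // mulr_ge0.
exists (Num.min (1 / 2) (e0 / 3)).
  by rewrite lt_min divr_gt0 //= divr_gt0.
move=> /= M e; rewrite le_min => /and3P[ege0 e12 e03] hE.
pose c : 'cV[R]_(1 + n) := lsubmx (M : 'M[R]_(1 + n)); pose nu := enorm c.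
pose u : 'cV[R]_(1 + n) := col_mx 1%:M 0.
have u1 : dot u u = 1.
  by rewrite dotE tr_col_mx mul_row_col trmx1 mulmx1 mulmx0 addr0 mxE eqxx.
have [H oH Hc] : exists2 H : 'M[R]_(1 + n), orthogonal_mx H & H *m c = nu *: u.
  apply: orthogonal_transitive; rewrite dotZl dotZr -sqr_enorm -/nu expr2.
  by rewrite u1 mulr1.
pose M1 : 'M[R]_(1 + n) := H *m M.
have M1M : M1^T *m M1 = M^T *m M.
  by rewrite /M1 trmx_mul -mulmxA (mulmxA H^T) oH mul1mx.
have M1l : lsubmx M1 = col_mx nu%:M 0.
  by rewrite -mulmx_lsub -/c Hc scale_col_mx scaler0 scale_scalar_mx mulr1.
have ul : ulsubmx M1 = nu%:M
  by rewrite -[RHS](col_mxKu _ (0 : 'cV[R]_n)) -M1l; apply/matrixP => i j; rewrite !mxE.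
have dl : dlsubmx M1 = 0
  by rewrite -[RHS](col_mxKd nu%:M) -M1l; apply/matrixP => i j; rewrite !mxE.
set r := ursubmx M1; set D := drsubmx M1.
have M1E : M1 = block_mx nu%:M r 0 D by rewrite -ul -dl submxK.
have E : M1^T *m M1 - (1%:M : 'M[R]_(1 + n)) = block_mx (nu ^+ 2 - 1)%:M (nu *: r) (nu *: r^T)
    (r^T *m r + (D^T *m D - 1%:M)).
  rewrite M1E tr_block_mx mulmx_block trmx0 tr_scalar_mx !mul0mx.
  rewrite !mulmx0 !addr0 !mul_scalar_mx mul_mx_scalar scale_scalar_mx.
  rewrite (scalar_mx_block 1 n).
  rewrite opp_block_mx add_block_mx !oppr0 !addr0.
  by rewrite -raddfB /= expr2 addrA.
have {hE} : mxbounded (M1^T *m M1 - (1%:M : 'M[R]_(1 + n))) e.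
  by rewrite M1M; exact: hE.
rewrite {}E => hE.
have nu0 : 0 <= nu by exact: enorm_ge0.
have h1 : `|nu ^+ 2 - 1| <= e.
  by have := hE (lshift n 0) (lshift n 0); rewrite block_mxEul mxE eqxx mulr1n.
have h2 j : `|nu * r 0 j| <= e.
  by have := hE (lshift n 0) (rshift 1 j); rewrite block_mxEur mxE.
have h3 i j : `|r 0 i * r 0 j + (D^T *m D - 1%:M) i j| <= e.
  have := hE (rshift 1 i) (rshift 1 j); rewrite block_mxEdr mxE.
  by rewrite [(r^T *m r) i j]mxE big_ord1 [r^T _ _]mxE.
have nu12 : 1 / 2 <= nu.
  move: h1; rewrite ler_norml => /andP[h1 _]; rewrite leNgt; apply/negP.
  by nra.
have nu1 : `|nu - 1| <= e.
  apply: le_trans h1; rewrite (_ : nu ^+ 2 - 1 = (nu - 1) * (nu + 1)); last by ring.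
  by rewrite normrM ler_peMr // ger0_norm; lra.
have hr j : `|r 0 j| <= 2 * e.
  by have := h2 j; rewrite normrM ger0_norm //; have := normr_ge0 (r 0 j); nra.
have [] := IH D (3 * e); first lra.
  move=> i j; have := h3 i j.
  have : `|r 0 i * r 0 j| <= 2 * e.
    rewrite normrM; have := hr i; have := hr j.
    by have := normr_ge0 (r 0 i); have := normr_ge0 (r 0 j); nra.
  by rewrite !ler_norml => /andP[? ?] /andP[? ?]; apply/andP; split; lra.
move=> Phi oPhi hPhi.
pose Psi : 'M[R]_(1 + n) := block_mx 1%:M 0 0 Phi.
have oPsi : orthogonal_mx Psi.
  rewrite /orthogonal_mx tr_block_mx mulmx_block !trmx0 trmx1 !mul0mx !mulmx0.
  by rewrite mulmx1 !addr0 add0r oPhi -scalar_mx_block.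
exists (H^T *m Psi).
  by apply: orthogonal_mx_mul => //; apply: orthogonal_mx_tr.
have -> : M - H^T *m Psi = H^T *m (M1 - Psi).
  by rewrite mulmxBr /M1 mulmxA oH mul1mx.
rewrite -mulrA -mulrA; apply: mxbounded_mul.
  exact/mxbounded_orth/orthogonal_mx_tr.
rewrite M1E /Psi opp_block_mx add_block_mx !oppr0 !addr0 => i j.
have Ce : 0 <= C * e by rewrite mulr_ge0.
case: (split_ordP i) => k ->; case: (@split_ordP 1 n j) => l ->.
- rewrite (block_mxEul (nu%:M - 1%:M) r 0 (D - Phi)) !ord1 !mxE eqxx !mulr1n;
  apply: le_trans nu1 _; lra.
- rewrite (block_mxEur (nu%:M - 1%:M) r 0 (D - Phi)) ord1;
  apply: le_trans (hr l) _; lra.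
- rewrite (block_mxEdl (nu%:M - 1%:M) r 0 (D - Phi)) mxE normr0; lra.
- rewrite (block_mxEdr (nu%:M - 1%:M) r 0 (D - Phi)); apply: le_trans (hPhi k l) _; lra.
Qed.

(** The matrix that maps the basis v to y is almost orthogonal, so
    near_orthogonal applies to it. *)
Lemma near_congruent (R : realType) d (v : 'I_d -> 'cV[R]_d) :
  (\matrix_(i, j) v j i 0) \in unitmx ->
  exists2 C : R, 0 <= C & exists2 e0 : R, 0 < e0 &
    forall (y : 'I_d -> 'cV[R]_d) e, 0 <= e <= e0 ->
    (forall i j, `|dot (y i) (y j) - dot (v i) (v j)| <= e) ->
    exists2 Phi : 'M[R]_d, orthogonal_mx Phi &
      forall i, enorm (y i - Phi *m v i) <= C * e.
Proof.
set V := \matrix_(i, j) _ => Vu.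
have [C C0 [e0 e00 near]] := near_orthogonal R d.
have [a a0 ha] := mxbounded_ex (invmx V).
have [b b0 hb] := mxbounded_ex V.
pose K := d%:R * (d%:R * (a * 1) * a).
have K0 : 0 <= K by rewrite !mulr_ge0.
exists (d%:R * (d%:R * (C * K * b))); first by rewrite !mulr_ge0.
exists (e0 / (K + 1)) => [|y e /andP[ege0 hle] hy].
  by rewrite divr_gt0 // ltr_wpDl.
pose Y : 'M[R]_d := \matrix_(i, j) y j i 0.
have gram (w z : 'I_d -> 'cV[R]_d) i j :
    ((\matrix_(i, j) w j i 0)^T *m (\matrix_(i, j) z j i 0)) i j
      = dot (w i) (z j).
  by rewrite mxE; apply: eq_bigr => k _; rewrite !mxE.
have hG : mxbounded (Y^T *m Y - V^T *m V) e.
  by move=> i j; rewrite [X in `|X|]mxE [X in _ + X]mxE !gram.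
pose M := Y *m invmx V.
have [] := near M (K * e).
- rewrite mulr_ge0 //=; move: hle; rewrite ler_pdivlMr ?ltr_wpDl //.
  by rewrite mulrDr mulr1 mulrC; lra.
- have -> : M^T *m M - 1%:M = (invmx V)^T *m (Y^T *m Y - V^T *m V) *m invmx V.
    rewrite /M mulmxBr mulmxBl trmx_mul !mulmxA; congr (_ - _).
    by rewrite -trmx_mul mulmxV // trmx1 mul1mx mulmxV.
  have -> : K * e = d%:R * (d%:R * (a * e) * a) by rewrite /K; ring.
  apply: mxbounded_mul => //; apply: mxbounded_mul => //.
  by move=> i j; rewrite mxE.
move=> Phi oPhi hPhi; exists Phi => // i.
have hYV : mxbounded (Y - Phi *m V) (d%:R * (C * (K * e) * b)).
  have -> : Y - Phi *m V = (M - Phi) *m V.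
    by rewrite mulmxBl /M -mulmxA mulVmx // mulmx1.
  exact: mxbounded_mul.
rewrite (_ : _ * e = d%:R * (d%:R * (C * (K * e) * b))); last by ring.
apply: enorm_le_coord; first by rewrite !mulr_ge0.
move=> j; have := hYV j i; rewrite [X in `|X| <= _ -> _]mxE [X in _ + X]mxE.
rewrite [X in X - _]mxE => h; rewrite mxE [X in _ + X]mxE.
suff -> : (Phi *m v i) j 0 = (Phi *m V) j i by [].
by rewrite !mxE; apply: eq_bigr => k _; rewrite mxE.
Qed.

Lemma enorm_le_dots (R : realType) d (v : 'I_d -> 'cV[R]_d) :
  (\matrix_(i, j) v j i 0) \in unitmx ->
  exists2 C : R, 0 <= C & forall (x : 'cV[R]_d) e, 0 <= e ->
    (forall i, `|dot x (v i)| <= e) -> enorm x <= C * e.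
Proof.
set V := \matrix_(i, j) _ => Vu.
have [a a0 ha] := mxbounded_ex (invmx V).
exists (d%:R * (d%:R * a)) => [|x e e0 hx]; first by rewrite !mulr_ge0.
have hV : mxbounded (x^T *m V) e.
  move=> i j; rewrite ord1 mxE; have := hx j.
  by congr (`|_| <= _); apply: eq_bigr => k _; rewrite !mxE.
have := mxbounded_mul hV ha; rewrite -mulmxA mulmxV // mulmx1 => h.
rewrite -!mulrA; apply: enorm_le_coord => [|i]; first by rewrite !mulr_ge0.
by have := h 0 i; rewrite mxE (mulrC e).
Qed.

Lemma basis_dot_eq0 (R : realType) d (v : 'I_d -> 'cV[R]_d) (x : 'cV[R]_d) :
  (\matrix_(i, j) v j i 0) \in unitmx -> (forall i, dot x (v i) = 0) -> x = 0.
Proof.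
move=> /enorm_le_dots [C _ /(_ x 0 (lexx _)) h] hx; apply: enorm_eq0.
apply/le_anti; rewrite enorm_ge0 andbT -[leRHS](mulr0 C).
by apply: h => i; rewrite hx normr0.
Qed.

(** A unit vector with prescribed inner products with all but one member v_i
    of a basis has two possible positions, v_i and its mirror image.  If the
    prescription is met up to e and the vector stays away from v_i, it is
    within O(e) of the mirror image: writing it as v' + alpha h + w with
    h = v_i - v' normal to the mirror and w = O(e), the unit length forces
    alpha (alpha - 1) = O(e), and alpha is not near 1. *)
Lemma near_mirror (R : realType) d (v : 'I_d -> 'cV[R]_d) i (v' : 'cV[R]_d)
    (eta : R) :
  (\matrix_(i, j) v j i 0) \in unitmx -> 0 < eta ->
  dot (v i) (v i) = 1 -> dot v' v' = 1 -> v' <> v i ->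
  (forall j, j != i -> dot v' (v j) = dot (v i) (v j)) ->
  exists2 C : R, 0 <= C & exists2 e0 : R, 0 < e0 &
    forall (q : 'cV[R]_d) (y : 'I_d -> 'cV[R]_d) e, 0 <= e <= e0 ->
    dot q q = 1 ->
    (forall j, j != i -> enorm (y j - v j) <= e) ->
    (forall j, j != i -> `|dot q (y j) - dot (v i) (v j)| <= e) ->
    eta <= enorm (q - v i) ->
    enorm (q - v') <= C * e.
Proof.
move=> Vu eta0 vi1 v'1 v'vi hv'.
have [C C0 hC] := enorm_le_dots Vu.
pose h := v i - v'; pose k := 1 - dot v' (v i).
have hh : dot h h = 2 * k.
  by rewrite /h dotBl !dotBr vi1 v'1 (dotC (v i)) /k; ring.
have k0 : 0 < k.
  have : 0 < dot h h.
    by apply: dot_gt0; rewrite subr_eq0; apply/eqP => /esym.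
  by rewrite hh pmulr_rgt0.
have en1 (x : 'cV[R]_d) : dot x x = 1 -> enorm x = 1.
  by rewrite /enorm => ->; rewrite sqrtr1.
have h2 : enorm h <= 2.
  by apply: le_trans (enormD _ _) _; rewrite enormN !en1.
have hvi : dot h (v i) = k by rewrite /h dotBl vi1.
have hvj j : j != i -> dot h (v j) = 0 by move=> ji; rewrite /h dotBl hv' ?subrr.
have v'h : dot v' h = - k by rewrite /h dotBr v'1 /k; ring.
pose K := 2 * C.
have K0 : 0 <= K by rewrite mulr_ge0.
exists (2 * (12 * K / (k * eta)) + K).
  by rewrite addr_ge0 // mulr_ge0 // divr_ge0 ?mulr_ge0 // ltW.
pose m := Num.min 1 (Num.min (eta / 2) (k * eta / 16)).
have m0 : 0 < m by rewrite !lt_min ltr01 !divr_gt0 // mulr_gt0.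
exists (m / (K + 1)) => [|q y e /andP[e0 em] q1 hy hq heta].
  by rewrite divr_gt0 // ltr_wpDl.
pose E := q - v'.
have [al alE] : exists al, al = dot E (v i) / k by exists (dot E (v i) / k).
pose w := E - al *: h.
have wE : enorm w <= K * e.
  rewrite /K -mulrA mulrCA; apply: hC; first by rewrite mulr_ge0.
  move=> j; rewrite dotBl dotZl; have [->|ji] := eqVneq j i.
    by rewrite hvi alE divfK ?gt_eqF // subrr normr0 mulr_ge0.
  rewrite hvj // mulr0 subr0 /E dotBl hv' //.
  rewrite (_ : _ - _ = (dot q (y j) - dot (v i) (v j)) - dot q (y j - v j));
    last by rewrite dotBr; ring.
  have hs := hq j ji.
  apply: le_trans (ler_normB _ _) _; rewrite mulrDl mul1r lerD //.
  apply: le_trans (dot_le_enorm _ _) _; rewrite en1 // mul1r; exact: hy.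
have wm : enorm w <= m.
  apply: le_trans wE _; move: em; rewrite ler_pdivlMr ?ltr_wpDl //; nra.
have [w1 w2 w3] : [/\ enorm w <= 1, enorm w <= eta / 2 & enorm w <= k * eta / 16].
  by move: wm; rewrite !le_min => /and3P.
have w0 := enorm_ge0 w.
have EE : E = al *: h + w by rewrite /w addrC subrK.
have qE : q = v' + E by rewrite /E addrC subrK.
have quad : 2 * k * (al * (al - 1))
    = - (2 * dot v' w + 2 * al * dot h w + dot w w).
  clear alE; clearbody w; clearbody E; clearbody h.
  move: q1; rewrite qE EE !dotDl !dotDr !dotZl !dotZr v'1 v'h hh.
  by rewrite (dotC w v') (dotC w h) (dotC h v') v'h; nra.
have al1 : eta / 4 <= `|al - 1|.
  have : eta <= `|al - 1| * enorm h + enorm w.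
    apply: le_trans heta _; rewrite -enormZ.
    have -> : q - v i = (al - 1) *: h + w.
      by rewrite qE EE scalerBl scale1r {2}/h opprB !addrA; apply/matrixP => ? ?;
         rewrite !mxE; ring.
    exact: enormD.
  have := normr_ge0 (al - 1); have := enorm_ge0 h; nra.
have habs : 2 * k * (`|al| * `|al - 1|) <= 2 * enorm w + 4 * `|al| * enorm w
    + enorm w * enorm w.
  have -> : 2 * k * (`|al| * `|al - 1|) = `|2 * k * (al * (al - 1))|.
    by rewrite !normrM (@ger0_norm _ k) ?ltW // (@ger0_norm _ 2).
  rewrite quad normrN; apply: le_trans (ler_normD _ _) _.
  have h1 := dot_le_enorm v' w; have h3 := dot_le_enorm h w.
  have h4 := dot_le_enorm w w; rewrite en1 // mul1r in h1.
  apply: lerD => //; apply: le_trans (ler_normD _ _) _.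
  rewrite !normrM (@ger0_norm _ 2) //.
  have h5 : `|dot h w| <= 2 * enorm w.
    by apply: le_trans h3 _; rewrite ler_wpM2r.
  have h6 : `|al| * `|dot h w| <= `|al| * (2 * enorm w) by rewrite ler_wpM2l.
  by lra.
have alb : `|al| <= 12 * enorm w / (k * eta).
  rewrite ler_pdivlMr ?mulr_gt0 //.
  have a0 := normr_ge0 al.
  have s1 : 2 * k * `|al| * (eta / 4) <= 2 * k * `|al| * `|al - 1|.
    by rewrite ler_wpM2l // mulr_ge0 // mulr_ge0 // ltW.
  have s2 : `|al| * enorm w <= `|al| * (k * eta / 16) by rewrite ler_wpM2l.
  have s3 : enorm w * enorm w <= enorm w * 1 by rewrite ler_wpM2l.
  by lra.
have -> : q - v' = al *: h + w by rewrite -/E EE.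
apply: le_trans (enormD _ _) _; rewrite enormZ [leRHS]mulrDl lerD //.
have -> : 2 * (12 * K / (k * eta)) * e = (12 * (K * e) / (k * eta)) * 2 by ring.
apply: ler_pM => //; first exact: enorm_ge0.
apply: le_trans alb _; rewrite ler_pM2r ?invr_gt0 ?mulr_gt0 // ler_pM2l //.
Qed.

(** * Facets of simplicial polytopes *)

(** Affine functionals x |-> dot a x - b on a family of points, as linear
    functionals on the points lifted to height one. *)
Definition lift_mx (R : realType) d m (v : 'I_m -> 'cV[R]_d) :
    'M[R]_(m, d + 1) :=
  row_mx (\matrix_(i, j) v i j 0) (const_mx 1).

Definition functional (R : realType) d (a : 'cV[R]_d) (b : R) :
    'cV[R]_(d + 1) :=
  col_mx a (const_mx (- b)).

Lemma lift_mxE (R : realType) d m (v : 'I_m -> 'cV[R]_d) a b i :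
  (lift_mx v *m functional a b) i 0 = dot a (v i) - b.
Proof.
rewrite mul_row_col mxE; congr (_ + _).
  by rewrite mxE /dot; apply: eq_bigr => k _; rewrite mxE mulrC.
by rewrite mxE big_ord1 !mxE mul1r.
Qed.

Lemma functional_eq0 (R : realType) d (a : 'cV[R]_d) b :
  functional a b = 0 -> a = 0.
Proof. by rewrite -col_mx0 => /eq_col_mx []. Qed.

Lemma functional_ex (R : realType) d (w : 'cV[R]_(d + 1)) :
  exists a b, w = functional a b.
Proof.
exists (usubmx w), (- dsubmx w 0 0); rewrite /functional opprK.
rewrite -[LHS]vsubmxK; congr col_mx; apply/matrixP => i j.
by rewrite !ord1 [RHS]mxE.
Qed.

Lemma lift_mx_free (R : realType) d m (v : 'I_m -> 'cV[R]_d) :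
  affinely_independent v -> row_free (lift_mx v).
Proof.
move=> vi; rewrite -kermx_eq0; apply/rowV0P => u /sub_kermxP.
rewrite mul_mx_row -row_mx0 => /eq_row_mx [h1 h2].
apply/matrixP => k i; rewrite ord1 [RHS]mxE; apply: (vi (fun i => u 0 i)).
  move/matrixP/(_ 0 0): h2; rewrite !mxE => h2; apply: etrans h2.
  by apply: eq_bigr => j _; rewrite mxE mulr1.
apply/matrixP => j l; move/matrixP/(_ 0 j): h1; rewrite !ord1 !mxE summxE => {}h1.
apply: etrans h1.
by apply: eq_bigr => r _; rewrite !mxE.
Qed.

Lemma affine_functional (R : realType) d m (v : 'I_m -> 'cV[R]_d)
    (y : 'I_m -> R) :
  affinely_independent v ->
  exists a b, forall i, dot a (v i) - b = y i.
Proof.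
move=> /lift_mx_free /row_freeP [B hB].
have [a [b E]] := functional_ex (B *m \col_i y i).
by exists a, b => i; rewrite -lift_mxE -E mulmxA hB mul1mx mxE.
Qed.

Lemma functional_ker (R : realType) d m (v : 'I_m -> 'cV[R]_d) a b :
  ((functional a b)^T <= kermx (lift_mx v)^T)%MS =
  [forall i, dot a (v i) == b].
Proof.
apply/sub_kermxP/forallP => [|h].
  rewrite -trmx_mul => /(congr1 trmx); rewrite trmxK trmx0 => h i.
  by rewrite -subr_eq0 -lift_mxE h mxE.
rewrite -trmx_mul -[RHS]trmx0; congr trmx; apply/matrixP => i j.
by rewrite ord1 lift_mxE mxE; apply/eqP; rewrite subr_eq0.
Qed.

Lemma functional_scale (R : realType) d (a a' : 'cV[R]_d) b b' :
  ((functional a' b')^T <= (functional a b)^T)%MS ->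
  exists mu, a' = mu *: a /\ b' = mu * b.
Proof.
move=> /sub_rVP [mu]; rewrite -linearZ /= => /(congr1 trmx); rewrite !trmxK.
rewrite scale_col_mx => /eq_col_mx [-> h]; exists mu; split => //.
by move/matrixP/(_ 0 0): h; rewrite !mxE mulrN => /oppr_inj.
Qed.

Lemma rank_functional (R : realType) d (a : 'cV[R]_d) b :
  a != 0 -> \rank (functional a b)^T = 1%N.
Proof.
move=> a0; rewrite rank_rV trmx_eq0; apply/eqP; rewrite eqb1.
by apply: contra_neq a0 => /functional_eq0.
Qed.

Lemma affine_line (R : realType) d (v : 'I_d -> 'cV[R]_d) a b a' b' :
  affinely_independent v -> a != 0 -> (forall i, dot a (v i) = b) ->
  (forall i, dot a' (v i) = b') -> exists mu, a' = mu *: a /\ b' = mu * b.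
Proof.
move=> /lift_mx_free vf a0 h h'; apply: functional_scale.
have hk : ((functional a b)^T <= kermx (lift_mx v)^T)%MS.
  by rewrite functional_ker; apply/forallP => i; rewrite h.
have hk' : ((functional a' b')^T <= kermx (lift_mx v)^T)%MS.
  by rewrite functional_ker; apply/forallP => i; rewrite h'.
apply: submx_trans hk' _; rewrite -(mxrank_leqif_sup hk).
by rewrite rank_functional // mxrank_ker mxrank_tr (eqP vf) addnC addnK.
Qed.

Lemma affine_hyperplane_size (R : realType) d m (v : 'I_m -> 'cV[R]_d) a b :
  affinely_independent v -> a != 0 -> (forall i, dot a (v i) = b) ->
  (forall a' b', (forall i, dot a' (v i) = b') ->
    exists mu, a' = mu *: a /\ b' = mu * b) -> m = d.
Proof.
move=> /lift_mx_free vf a0 h line.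
have hk : ((functional a b)^T <= kermx (lift_mx v)^T)%MS.
  by rewrite functional_ker; apply/forallP => i; rewrite h.
have hk' : (kermx (lift_mx v)^T <= (functional a b)^T)%MS.
  apply/rV_subP => w wk; have [a' [b' wE]] := functional_ex w^T.
  move: wk; rewrite -[w]trmxK wE functional_ker => /forallP h'.
  have [mu [-> ->]] := line a' b' (fun i => eqP (h' i)).
  have -> : functional (mu *: a) (mu * b) = mu *: functional a b.
    rewrite scale_col_mx; congr col_mx; apply/matrixP => i j.
    by rewrite !mxE mulrN.
  by rewrite linearZ /= scalemx_sub.
have := mxrankS hk; have := mxrankS hk'.
rewrite rank_functional // mxrank_ker mxrank_tr (eqP vf).
have := rank_leq_col (lift_mx v); rewrite (eqP vf); lia.
Qed.

Lemma conv_gen (R : realType) d n (g : 'I_n -> 'cV[R]_d) i : conv g (g i).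
Proof.
exists (fun j => (j == i)%:R); split => [j||]; first by case: (j == i).
  by rewrite (bigD1 i) //= eqxx big1 ?addr0 // => j /negPf ->.
rewrite (bigD1 i) //= eqxx scale1r big1 ?addr0 // => j /negPf ->.
by rewrite scale0r.
Qed.

Lemma dot_comb (R : realType) d n (g : 'I_n -> 'cV[R]_d) (c : 'I_n -> R) a b :
  \sum_i c i = 1 ->
  dot a (\sum_i c i *: g i) - b = \sum_i c i * (dot a (g i) - b).
Proof.
move=> c1; rewrite dot_sumr -[in LHS](mulr1 b) -c1 mulr_sumr -sumrB.
by apply: eq_bigr => i _; rewrite dotZr mulrBr (mulrC b).
Qed.

Lemma conv_le (R : realType) d n (g : 'I_n -> 'cV[R]_d) a b x :
  (forall i, dot a (g i) <= b) -> conv g x -> dot a x <= b.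
Proof.
move=> hg [c [c0 c1 ->]]; rewrite -subr_le0 dot_comb // -oppr_ge0 -sumrN.
by apply: sumr_ge0 => i _; rewrite -mulrN mulr_ge0 // oppr_ge0 subr_le0.
Qed.

Lemma comb_contact (R : realType) d n (g : 'I_n -> 'cV[R]_d) c a b :
  (forall i, dot a (g i) <= b) -> (forall i, 0 <= c i) -> \sum_i c i = 1 ->
  dot a (\sum_i c i *: g i) = b -> forall i, c i != 0 -> dot a (g i) = b.
Proof.
move=> hg c0 c1 /eqP; rewrite -subr_eq0 dot_comb // -oppr_eq0 -sumrN.
rewrite psumr_eq0 => [/allP h i ci|i _]; last first.
  by rewrite -mulrN mulr_ge0 // oppr_ge0 subr_le0.
have := h i (mem_index_enum _); rewrite oppr_eq0 mulf_eq0 (negPf ci) /=.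
by rewrite subr_eq0 => /eqP.
Qed.

Lemma interior_full (R : realType) d (P : set 'cV[R]_d) a b :
  P° !=set0 -> (forall x, P x -> dot a x = b) -> a = 0.
Proof.
move=> [x0 /nbhs_ballP [e /= e0 he]] hP.
have [K K0 hK] := mxbounded_ex a.
pose t := e / (K + 1).
have t0 : 0 < t by rewrite divr_gt0 // ltr_wpDl.
have Px : P (x0 + t *: a).
  apply: he; split => // i j; rewrite /ball /= !mxE opprD addrA subrr add0r normrN.
  rewrite normrM (gtr0_norm t0) /t mulrAC ltr_pdivrMr ?ltr_wpDl //.
  by rewrite ltr_pM2l // (le_lt_trans (hK i j)) // ltrDl.
have Px0 : P x0 by apply: he; apply: ballxx.
have := hP _ Px; rewrite dotDr (hP _ Px0) dotZr => /eqP.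
rewrite -subr_eq0 addrAC subrr add0r mulf_eq0 gt_eqF //= => /eqP.
exact: dot_eq0.
Qed.

(** Gift wrapping.  Tilt the supporting hyperplane about its intersection with
    the zero set of the functional l = dot a' - b' until it meets a point at
    which l is positive: lam is the least ratio of the distance to the old
    hyperplane over l among these points. *)
Lemma gift_wrap (R : realType) d n (g : 'I_n -> 'cV[R]_d) a b a' b' :
  (forall i, dot a (g i) <= b) ->
  (forall i, dot a (g i) = b -> dot a' (g i) <= b') ->
  (exists i, b' < dot a' (g i)) ->
  exists2 lam : R, 0 < lam &
    (forall i, dot (a + lam *: a') (g i) <= b + lam * b') /\
    exists2 j, b' < dot a' (g j) & dot (a + lam *: a') (g j) = b + lam * b'.
Proof.
move=> hab hc [i0 hi0].
pose Q i := b' < dot a' (g i).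
pose f i := (b - dot a (g i)) / (dot a' (g i) - b').
case: (@arg_minP _ _ _ i0 Q f hi0) => j Qj hj.
have dj : 0 < dot a' (g j) - b' by rewrite subr_gt0.
have lj : 0 < f j.
  rewrite divr_gt0 // subr_gt0 lt_neqAle hab andbT.
  by apply/eqP => /hc; rewrite leNgt -/(Q j) Qj.
exists (f j) => //; split; last first.
  exists j => //; rewrite dotDl dotZl.
  have -> : dot a (g j) = b - f j * (dot a' (g j) - b').
    by rewrite /f divfK ?gt_eqF // subKr.
  by ring.
move=> i; rewrite dotDl dotZl; have [Qi|nQi] := boolP (Q i).
  have := hj i Qi; rewrite [X in _ <= X]/f.
  by rewrite ler_pdivlMr ?subr_gt0 //; lra.
have := hab i; have : dot a' (g i) <= b' by rewrite leNgt.
by have := lj; nra.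
Qed.

Lemma faceP (R : realType) d n (g : 'I_n -> 'cV[R]_d) a b x :
  (forall i, dot a (g i) <= b) -> conv g x -> dot a x = b ->
  (exists i, dot a (g i) < b) ->
  face (conv g) [set x | conv g x /\ dot a x = b].
Proof.
move=> hab Px xb [i hi]; split; first by exists x.
  move=> E; have : [set x | conv g x /\ dot a x = b] (g i).
    by rewrite E; exact: conv_gen.
  by move=> [_ h]; rewrite h ltxx in hi.
by exists a, b; split => // y; exact: conv_le.
Qed.

Lemma face_functional (R : realType) d n (g : 'I_n -> 'cV[R]_d) F :
  face (conv g) F -> exists a b, [/\ forall i, dot a (g i) <= b,
    F = [set x | conv g x /\ dot a x = b], exists x, F x &
    exists i, dot a (g i) < b].
Proof.
move=> [[x Fx] FP [a [b [hab FE]]]]; exists a, b; split => //.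
- by move=> i; apply/hab/conv_gen.
- by exists x.
- apply: contrapT => h; apply: FP; rewrite FE; apply/seteqP; split => y.
    by case.
  move=> Py; split => //; apply/le_anti; rewrite hab //=.
  case: Py => c [c0 c1 ->]; rewrite -subr_ge0 -opprB oppr_ge0.
  rewrite -opprB oppr_le0 dot_comb //; apply: sumr_ge0 => i _.
  rewrite mulr_ge0 // subr_ge0 leNgt; apply/negP => hi; apply: h.
  by exists i.
Qed.

Lemma face_conv_gens (R : realType) d n (g : 'I_n -> 'cV[R]_d) F G :
  face (conv g) F -> face (conv g) G ->
  (forall i, F (g i) -> G (g i)) -> F `<=` G.
Proof.
move=> /face_functional [a [b [hab FE _ _]]].
move=> /face_functional [a' [b' [_ GE _ _]]] FG x.
rewrite FE => -[Px xb]; rewrite GE; split => //.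
case: Px xb => c [c0 c1 xE] xb; rewrite xE in xb *.
have hc := comb_contact hab c0 c1 xb.
apply/eqP; rewrite -subr_eq0 dot_comb // big1 // => i _.
have [->|ci] := eqVneq (c i) 0; first by rewrite mul0r.
have : G (g i).
  by apply: FG; rewrite FE; split; [exact: conv_gen | exact: hc].
by rewrite GE => -[_ ->]; rewrite subrr mulr0.
Qed.

Lemma facet_exists (R : realType) d n (g : 'I_n -> 'cV[R]_d) :
  (0 < d)%N -> (conv g)° !=set0 -> exists F, facet (conv g) F.
Proof.
move=> d0 Pint.
pose I (F : set 'cV[R]_d) : {set 'I_n} := [set i | `[<F (g i)>]]%SET.
have [F0 fF0] : exists F, face (conv g) F.
  have [x0 Px0] : exists x, conv g x.
    by have [x /interior_subset Px] := Pint; exists x.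
  have n0 : (0 < n)%N.
    case: n g Pint I x0 Px0 => // g _ _ x0 [c [_ /eqP]].
    by rewrite big_ord0 eq_sym oner_eq0.
  pose a : 'cV[R]_d := delta_mx (Ordinal d0) 0.
  have a0 : a != 0.
    apply/eqP => /matrixP /(_ (Ordinal d0) 0); rewrite !mxE !eqxx.
    by move/eqP; rewrite oner_eq0.
  case: (@arg_maxP _ _ _ (Ordinal n0) xpredT (fun i => dot a (g i)) isT) => j _ hj.
  exists [set x | conv g x /\ dot a x = dot a (g j)].
  apply: (@faceP _ _ _ _ _ _ (g j)) => //; first by move=> i; exact: hj.
    exact: conv_gen.
  apply: contrapT => h; move/eqP: a0; apply.
  apply: (interior_full (b := dot a (g j)) Pint) => x [c [c0 c1 ->]].
  apply/eqP; rewrite -subr_eq0 dot_comb // big1 // => i _.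
  have {}hj : dot a (g i) <= dot a (g j) by exact: hj.
  move: hj; rewrite le_eqVlt => /orP[/eqP -> |hi].
    by rewrite subrr mulr0.
  by exfalso; apply: h; exists i.
pose Q m := `[<exists F, face (conv g) F /\ #|I F| = m>].
have exQ : exists m, Q m by exists #|I F0|; apply/asboolP; exists F0.
have Qle m : Q m -> (m <= n)%N.
  by move=> /asboolP[F [_ <-]]; rewrite -[leqRHS]card_ord max_card.
have [m /asboolP[F [fF Fm]] mmax] := ex_maxnP exQ Qle.
exists F; split => // G fG FG; apply/seteqP; split => //.
apply: (face_conv_gens fG fF) => i Gi.
have IFG : I F \subset I G.
  by apply/fintype.subsetP => k; rewrite !finset.in_set => /asboolP h; apply/asboolP; exact: FG.
have IE : I F = I G.
  apply/eqP; rewrite eqEcard IFG Fm; apply: mmax; apply/asboolP.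
  by exists G.
have : i \in I G by rewrite finset.in_set; apply/asboolP.
by rewrite -IE finset.in_set => /asboolP.
Qed.

(** A facet spans a hyperplane: otherwise its supporting hyperplane could be
    tilted about the facet to a proper face that is larger. *)
Lemma facet_line (R : realType) d n (g : 'I_n -> 'cV[R]_d) F a b a' b' :
  (conv g)° !=set0 -> facet (conv g) F ->
  (forall i, dot a (g i) <= b) -> F = [set x | conv g x /\ dot a x = b] ->
  (exists i, dot a (g i) < b) ->
  (forall x, F x -> dot a' x = b') -> exists mu, a' = mu *: a /\ b' = mu * b.
Proof.
move=> Pint [fF Fmax] hab FE [i0 hi0] hF.
have y0 : dot a (g i0) - b != 0 by rewrite subr_eq0 lt_eqF.
pose mu := (dot a' (g i0) - b') / (dot a (g i0) - b).
exists mu.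
have : exists a2 b2, a2 = a' - mu *: a /\ b2 = b' - mu * b by do 2!eexists.
move=> [a2 [b2 [a2E b2E]]].
have hF2 x : F x -> dot a2 x = b2.
  by move=> Fx; rewrite a2E b2E dotBl dotZl hF //; move: Fx; rewrite FE => -[_ ->].
have hi2 : dot a2 (g i0) = b2.
  by apply/eqP; rewrite a2E b2E dotBl dotZl -subr_eq0 /mu; apply/eqP; field.
have [h|h] := pselect (forall i, dot a2 (g i) = b2).
  have a20 : a2 = 0.
    apply: (interior_full (b := b2) Pint) => x [c [c0 c1 ->]].
    apply/eqP; rewrite -subr_eq0 dot_comb // big1 // => i _.
    by rewrite h subrr mulr0.
  have b20 : b2 = 0 by rewrite -hi2 a20 dot0l.
  by split; apply/eqP; rewrite -subr_eq0 -?a2E -?b2E ?a20 ?b20.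
exfalso.
have [j hj] : exists j, dot a2 (g j) <> b2.
  by apply: contrapT => h'; apply: h => i; apply: contrapT => h''; apply: h'; exists i.
have [sg [sg0 hsg]] : exists s : R, s != 0 /\ s * b2 < dot (s *: a2) (g j).
  move/eqP: hj; rewrite neq_lt => /orP[] h1.
    by exists (-1); rewrite oppr_eq0 oner_eq0 dotZl !mulN1r ltrN2.
  by exists 1; rewrite oner_eq0 dotZl !mul1r.
have [||lam lam0 [h1 [k h2 h3]]] := @gift_wrap R d n g a b (sg *: a2) (sg * b2) hab.
- move=> i hi; rewrite dotZl hF2 // FE; split => //; exact: conv_gen.
- by exists j.
move: fF; rewrite FE => -[[x /= xF] _ _].
have fG : face (conv g) [set x | conv g x /\
    dot (a + lam *: (sg *: a2)) x = b + lam * (sg * b2)].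
  apply: (@faceP _ _ _ _ _ _ x) => //; first by case: xF.
    by rewrite dotDl !dotZl hF2 ?FE //; case: xF => _ ->.
  by exists i0; rewrite dotDl !dotZl hi2 ltrD2r.
have : g k \in F.
  rewrite -(Fmax _ fG); first by rewrite inE; split => //; exact: conv_gen.
  move=> z Fz; move: (Fz); rewrite FE => -[Pz zb]; split => //.
  by rewrite dotDl !dotZl zb hF2.
rewrite inE => /hF2 h4; move: h2; rewrite dotZl h4 ltxx //.
Qed.

Lemma small_multiple (R : realType) (I : finType) (y z : I -> R) :
  exists2 dl : R, 0 < dl & forall i, 0 < z i -> dl * y i < z i.
Proof.
suff [dl dl0 h] : exists2 dl : R, 0 < dl &
    forall i, i \in enum I -> 0 < z i -> dl * y i < z i.
  by exists dl => // i; apply: h; rewrite mem_enum.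
elim: (enum I) => [|i s [dl dl0 IH]]; first by exists 1.
have [zi|zi] := boolP (0 < z i); last first.
  exists dl => // j; rewrite in_cons => /orP[/eqP ->|]; last exact: IH.
  by move: zi => /negP.
have y1 : 0 < `|y i| + 1 by rewrite ltr_wpDl.
exists (Num.min dl (z i / (`|y i| + 1))).
  by rewrite lt_min dl0 divr_gt0.
set m := Num.min _ _.
have m0 : 0 < m by rewrite lt_min dl0 divr_gt0.
move=> j; rewrite in_cons => /orP[/eqP -> _|js zj].
  have mz : m * (`|y i| + 1) <= z i by rewrite -ler_pdivlMr // ge_min lexx orbT.
  have := ler_norm (y i); nra.
have mdl : m <= dl by rewrite ge_min lexx.
have := IH j js zj; have [y0|y0] := lerP 0 (y j); first by nra.
by move=> _; apply: lt_trans zj; rewrite pmulr_rlt0.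
Qed.

Definition facet_simplex (R : realType) d (P : set 'cV[R]_d)
    (V : 'I_d -> 'cV[R]_d) : Prop :=
  affinely_independent V /\ facet P (conv V).

Lemma facet_normal_neq0 (R : realType) d n (g : 'I_n -> 'cV[R]_d) a b x :
  (exists i, dot a (g i) < b) -> dot a x = b -> a != 0.
Proof.
move=> [i hi] xb; apply/eqP => a0; move: hi xb; rewrite a0 !dot0l => hi xb.
by rewrite -xb ltxx in hi.
Qed.

(** Affine functionals that vanish on m affinely independent points form a space
    of dimension d + 1 - m, and on a facet this space is a line. *)
Lemma simplex_facetE (R : realType) d n (g : 'I_n -> 'cV[R]_d) F :
  (conv g)° !=set0 -> simplex F -> facet (conv g) F ->
  exists V, F = conv V /\ facet_simplex (conv g) V.
Proof.
move=> Pint [m [v [vi FE]]] fF.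
have [a [b [hab FE' [x Fx] hlt]]] := face_functional fF.1.
have xb : dot a x = b by move: Fx; rewrite FE' => -[].
have a0 := facet_normal_neq0 hlt xb.
have Fv i : F (v i) by rewrite FE; exact: conv_gen.
have vb i : dot a (v i) = b by have := Fv i; rewrite FE' => -[].
have md : m = d.
  apply: (affine_hyperplane_size vi a0 vb) => a' b' h'.
  apply: (facet_line Pint fF hab FE' hlt) => y.
  rewrite FE => -[c [c0 c1 ->]]; apply/eqP.
  by rewrite -subr_eq0 dot_comb // big1 // => i _; rewrite h' subrr mulr0.
subst m; exists v; split => //; split => //; by rewrite -FE.
Qed.

(** Every subset T of the vertices of a simplicial facet spans a face: tilt the
    facet hyperplane slightly by a functional that vanishes on T and is
    negative on the other vertices of the facet. *)
Lemma facet_simplex_subface (R : realType) d n (g : 'I_n -> 'cV[R]_d)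
    (V : 'I_d -> 'cV[R]_d) (T : pred 'I_d) i0 :
  facet_simplex (conv g) V -> T i0 ->
  face (conv g) [set x | exists c : 'I_d -> R, [/\ forall i, 0 <= c i,
    \sum_i c i = 1, (forall i, ~~ T i -> c i = 0) & x = \sum_i c i *: V i]].
Proof.
move=> [Vi [fF _]] Ti0; have [a [b [hab FE _ [k hk]]]] := face_functional fF.
have [a' [b' hab']] := affine_functional (fun i => - (~~ T i)%:R) Vi.
have [dl dl0 hdl] := small_multiple (fun i => dot a' (g i) - b')
  (fun i => b - dot a (g i)).
have FV i : conv V (V i) by exact: conv_gen.
have VP i : conv g (V i) by move: (FV i); rewrite FE => -[].
have Vb i : dot a (V i) = b by move: (FV i); rewrite FE => -[].
have le' x : conv V x -> dot a' x <= b'.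
  apply: conv_le => i; rewrite -subr_le0 hab'.
  by rewrite oppr_le0 ler0n.
have gF i : dot a (g i) = b -> conv V (g i).
  by move=> h; rewrite FE; split => //; exact: conv_gen.
pose A := a + dl *: a'; pose B := b + dl * b'.
have gE i : dot A (g i) = B + (dot a (g i) - b) + dl * (dot a' (g i) - b').
  by rewrite /A /B dotDl dotZl; ring.
have hAB i : dot A (g i) <= B.
  rewrite gE; have := hab i; rewrite le_eqVlt => /orP[/eqP h|h].
    have := le' _ (gF i h); rewrite h; nra.
  by have := hdl i; rewrite subr_gt0 => /(_ h); lra.
have hAB' i : dot A (g i) = B -> dot a (g i) = b /\ dot a' (g i) = b'.
  rewrite gE; have := hab i; rewrite le_eqVlt => /orP[/eqP h|h].
    rewrite h subrr addr0 => /eqP; rewrite -subr_eq0 addrAC subrr add0r.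
    by rewrite mulf_eq0 gt_eqF //= subr_eq0 => /eqP.
  by have := hdl i; rewrite subr_gt0 => /(_ h); lra.
have Vi0 : conv g (V i0) /\ dot A (V i0) = B.
  split; first exact: VP.
  have := hab' i0; rewrite Ti0 /= oppr0 => /eqP; rewrite subr_eq0 => /eqP h.
  by rewrite dotDl dotZl Vb h.
have hlt : exists i, dot A (g i) < B.
  exists k; rewrite lt_neqAle hAB andbT; apply/eqP => /hAB' [h _].
  by rewrite h ltxx in hk.
have := faceP hAB Vi0.1 Vi0.2 hlt; congr face; apply/seteqP; split => x /=.
  move=> [[c [c0 c1 xE]] xB]; rewrite xE in xB.
  have hc := comb_contact hAB c0 c1 xB.
  have xb : dot a x = b.
    apply/eqP; rewrite xE -subr_eq0 dot_comb // big1 // => i _.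
    have [->|/hc /hAB' [-> _]] := eqVneq (c i) 0; first by rewrite mul0r.
    by rewrite subrr mulr0.
  have xb' : dot a' x = b'.
    apply/eqP; rewrite xE -subr_eq0 dot_comb // big1 // => i _.
    have [->|/hc /hAB' [_ ->]] := eqVneq (c i) 0; first by rewrite mul0r.
    by rewrite subrr mulr0.
  have : conv V x by rewrite FE; split => //; exists c.
  move=> [m [m0 m1 xm]]; exists m; split => // i nTi.
  move/eqP: xb'; rewrite -subr_eq0 xm dot_comb // -oppr_eq0 -sumrN.
  rewrite psumr_eq0 => [/allP /(_ i (mem_index_enum _))|j _]; last first.
    by rewrite hab' mulrN opprK mulr_ge0.
  by rewrite /= hab' nTi mulrN opprK mulr1 => /eqP.
move=> [c [c0 c1 cT ->]].
have xF : conv V (\sum_i c i *: V i) by exists c.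
split; first by move: xF; rewrite FE => -[].
apply/eqP; rewrite -subr_eq0 dot_comb // big1 // => i _.
have [Ti|/cT ->] := boolP (T i); last by rewrite mul0r.
have -> : dot A (V i) - B = dot a (V i) - b + dl * (dot a' (V i) - b').
  by rewrite /A /B dotDl dotZl; ring.
by rewrite Vb hab' Ti subrr oppr0 mulr0 addr0 mulr0.
Qed.

Lemma facet_simplex_vertex (R : realType) d n (g : 'I_n -> 'cV[R]_d)
    (V : 'I_d -> 'cV[R]_d) i :
  facet_simplex (conv g) V -> vertices (conv g) (V i).
Proof.
move=> fV; have := facet_simplex_subface fV (eqxx i : pred1 i i).
rewrite /vertices /=; congr face; apply/seteqP; split => x /=.
  move=> [c [_ c1 cT ->]]; move: c1; rewrite (bigD1 i) //= big1 => [|j]; last first.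
    by move=> ji; apply: cT.
  rewrite addr0 => ci.
  by rewrite (bigD1 i) //= ci big1 ?scale1r ?addr0 // => j ji; rewrite cT ?scale0r.
move=> ->; exists (fun j => (j == i)%:R); split => [j||j /negPf /= -> //|].
- by case: (j == i).
- by rewrite (bigD1 i) //= eqxx big1 ?addr0 // => j /negPf ->.
rewrite (bigD1 i) //= eqxx scale1r big1 ?addr0 // => j /negPf ->.
by rewrite scale0r.
Qed.

Lemma affinely_independent_inj (R : realType) d n (V : 'I_n -> 'cV[R]_d) :
  affinely_independent V -> injective V.
Proof.
move=> Vi i j Vij; apply: contrapT => /eqP ij.
have := Vi (fun k => (k == i)%:R - (k == j)%:R).
have s1 k : \sum_(l < n) (l == k)%:R = 1 :> R.
  by rewrite (bigD1 k) //= eqxx big1 ?addr0 // => l /negPf ->.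
have s2 k : \sum_(l < n) (l == k)%:R *: V l = V k.
  rewrite (bigD1 k) //= eqxx scale1r big1 ?addr0 // => l /negPf ->.
  by rewrite scale0r.
rewrite sumrB !s1 subrr => /(_ erefl).
under eq_bigr do rewrite scalerBl.
rewrite sumrB !s2 Vij subrr => /(_ erefl i).
by rewrite eqxx (negPf ij) subr0 => /eqP; rewrite oner_eq0.
Qed.

Lemma facet_simplex_edge (R : realType) d n (g : 'I_n -> 'cV[R]_d)
    (V : 'I_d -> 'cV[R]_d) i j :
  facet_simplex (conv g) V -> i != j -> edge (conv g) (V i) (V j).
Proof.
move=> fV ij; split.
  by move=> /(affinely_independent_inj fV.1) /eqP; rewrite (negPf ij).
have Ti : (pred2 i j) i by rewrite /= eqxx.
have sum2 (W : zmodType) (F : 'I_d -> W) :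
    (forall k, ~~ pred2 i j k -> F k = 0) -> \sum_k F k = F i + F j.
  move=> h; rewrite (bigD1 i) //= (bigD1 j) 1?eq_sym //= addrA big1 ?addr0 //.
  by move=> k /andP[ki kj]; apply: h; rewrite negb_or ki kj.
have := facet_simplex_subface fV Ti.
congr face; apply/seteqP; split => x /=.
  move=> [c [c0 c1 cT ->]].
  rewrite sum2 in c1; last by [].
  exists (c j); first by rewrite c0 -c1 lerDr c0.
  rewrite -c1 addrK sum2 // => k /cT ->; exact: scale0r.
move=> [t /andP[t0 t1] ->].
pose c k : R := (1 - t) * (k == i)%:R + t * (k == j)%:R.
have ci : c i = 1 - t by rewrite /c eqxx (negPf ij) mulr1 mulr0 addr0.
have cj : c j = t by rewrite /c eqxx eq_sym (negPf ij) mulr1 mulr0 add0r.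
have cT k : ~~ pred2 i j k -> c k = 0.
  by rewrite negb_or /c => /andP[/negPf -> /negPf ->]; rewrite !mulr0 addr0.
exists c; split => //.
- by move=> k; rewrite /c addr_ge0 // mulr_ge0 ?ler0n // subr_ge0.
- by rewrite sum2 // ci cj subrK.
by rewrite sum2 => [|k /cT ->]; rewrite ?ci ?cj // scale0r.
Qed.

Lemma vertex_of_conv (R : realType) d (P : set 'cV[R]_d) n
    (U : 'I_n -> 'cV[R]_d) v :
  vertices P v -> (forall r, P (U r)) -> conv U v -> exists r, U r = v.
Proof.
move=> [_ _ [a [b [hab vE]]]] UP [c [c0 c1 cv]].
have [Pv vb] : P v /\ dot a v = b.
  by have : [set v] v by []; rewrite vE.
have [r cr] : exists r, c r != 0.
  apply: contrapT => h; move: c1; rewrite big1 => [|r _].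
    by move/eqP; rewrite eq_sym oner_eq0.
  by apply: contrapT => /eqP cr; apply: h; exists r.
exists r; have hU j : dot a (U j) <= b by apply: hab.
rewrite cv in vb.
have : [set x | P x /\ dot a x = b] (U r).
  by split => //; apply: (comb_contact hU c0 c1 vb).
by rewrite -vE.
Qed.

Lemma conv_comp (R : realType) d n (U : 'I_n -> 'cV[R]_d) (s : 'I_n -> 'I_n) :
  injective s -> conv (U \o s) = conv U.
Proof.
move=> si; have sb : bijective s by exact: injF_bij.
have [s' sK s'K] := sb.
apply/seteqP; split => x [c [c0 c1 ->]].
  exists (c \o s'); split => [i||]; first exact: c0.
    by rewrite (reindex s) /=; [under eq_bigr do rewrite sK|exact: onW_bij].
  rewrite [RHS](reindex s) /=; last exact: onW_bij.
  by apply: eq_bigr => i _; rewrite sK.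
exists (c \o s); split => [i||]; first exact: c0.
  by rewrite -c1 [RHS](reindex s) //; exact: onW_bij.
by rewrite (reindex s) //; exact: onW_bij.
Qed.

Lemma affinely_independent_comp (R : realType) d n (U : 'I_n -> 'cV[R]_d)
    (s : 'I_n -> 'I_n) :
  injective s -> affinely_independent U -> affinely_independent (U \o s).
Proof.
move=> si Ui c c0 cU i; have sb : bijective s by exact: injF_bij.
have [s' sK s'K] := sb.
rewrite -(sK i); apply: (Ui (c \o s')).
  by rewrite (reindex s) /=; [under eq_bigr do rewrite sK|exact: onW_bij].
rewrite (reindex s) /=; last exact: onW_bij.
by under eq_bigr do rewrite sK.
Qed.

Definition replace_at (I : eqType) (T : Type) (V : I -> T) (i : I) (q : T) :
    I -> T :=
  fun j => if j == i then q else V j.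

(** Facets can be crossed: wrap the facet hyperplane around the ridge opposite
    to V i.  The new contact set is again a facet, hence a simplex, and it
    keeps all the vertices of the ridge. *)
Lemma facet_simplex_flip (R : realType) d n (g : 'I_n -> 'cV[R]_d)
    (V : 'I_d -> 'cV[R]_d) i :
  (conv g)° !=set0 -> simplicial_polytope (conv g) ->
  facet_simplex (conv g) V ->
  exists2 q, q <> V i & facet_simplex (conv g) (replace_at V i q).
Proof.
move=> Pint Ps fV; have [Vi [fF _]] := fV.
have [a [b [hab FE _ [k hk]]]] := face_functional fF.
have FV j : conv V (V j) by exact: conv_gen.
have VP j : conv g (V j) by move: (FV j); rewrite FE => -[].
have Vb j : dot a (V j) = b by move: (FV j); rewrite FE => -[].
have [a' [b' hab']] := affine_functional (fun j => - (j == i)%:R) Vi.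
pose mu := (1 - (dot a' (g k) - b')) / (b - dot a (g k)).
(* the functional of the ridge, shifted by the one of the facet so that it is
   positive at a point outside the facet *)
pose a2 := a' - mu *: a; pose b2 := b' - mu * b.
have l2 x : dot a2 x - b2 = (dot a' x - b') + mu * (b - dot a x).
  by rewrite /a2 /b2 dotBl dotZl; ring.
have l2V j : dot a2 (V j) - b2 = - (j == i)%:R.
  by rewrite l2 hab' Vb subrr mulr0 addr0.
have l2k : b2 < dot a2 (g k).
  by rewrite -subr_gt0 l2 /mu divfK ?subr_eq0 ?gt_eqF // addrCA subrr addr0 ltr01.
have [||lam lam0 [hAB [j0 j01 j02]]] := @gift_wrap R d n g a b a2 b2 hab.
- move=> j hj; have : conv V (g j).
    by rewrite FE; split => //; exact: conv_gen.
  by apply: conv_le => m; rewrite -subr_le0 l2V oppr_le0 ler0n.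
- by exists k.
move: hAB j02; set A := a + _; set B := b + _ => hAB j02.
have AV j : dot A (V j) = B - lam * (j == i)%:R.
  rewrite /A dotDl dotZl Vb.
  have -> : dot a2 (V j) = b2 - (j == i)%:R by rewrite -(l2V j) addrC subrK.
  by rewrite /B; ring.
have AVi : dot A (V i) < B by rewrite AV eqxx mulr1 ltrBlDr ltrDl.
have Alt : exists m, dot A (g m) < B.
  apply: contrapT => h; move: AVi; rewrite ltNge => /negP; apply.
  have := @conv_le R d n g (- A) (- B) (V i) _ (VP i).
  rewrite dotNl lerN2; apply => m; rewrite dotNl lerN2 leNgt.
  by apply/negP => hm; apply: h; exists m.
pose G := [set x | conv g x /\ dot A x = B].
have fG : face (conv g) G by apply: (faceP hAB (conv_gen g j0)).
have A0 : A != 0 by exact: facet_normal_neq0 Alt j02.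
pose W := replace_at V i (g j0).
have Wi : affinely_independent W.
  move=> c c0 cW.
  have ci : c i = 0.
    have h : \sum_m c m * (dot a2 (W m) - b2) = 0.
      under eq_bigr do rewrite mulrBr -dotZr mulrC.
      rewrite sumrB -dot_sumr cW dot0r.
      by under eq_bigr do rewrite mulrC; rewrite -mulr_suml c0 mul0r subrr.
    move: h; rewrite (bigD1 i) //= big1 => [|m mi]; last first.
      by rewrite /W /replace_at (negPf mi) l2V (negPf mi) oppr0 mulr0.
    rewrite addr0 /W /replace_at eqxx => /eqP; rewrite mulf_eq0 subr_eq0.
    by rewrite (gt_eqF j01) orbF => /eqP.
  apply: Vi => //; rewrite -[RHS]cW; apply: eq_bigr => m _.
  by rewrite /W /replace_at; case: eqP => // ->; rewrite ci !scale0r.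
have WG m : G (W m).
  rewrite /W /replace_at; case: eqP => [_|/eqP mi].
    by split => //; exact: conv_gen.
  by split => //; rewrite AV (negPf mi) mulr0 subr0.
have facG : facet (conv g) G.
  split => // H fH GH.
  have [a3 [b3 [_ HE [y Hy] hlt3]]] := face_functional fH.
  have yb : dot a3 y = b3 by move: Hy; rewrite HE => -[].
  have a30 := facet_normal_neq0 hlt3 yb.
  have hW3 m : dot a3 (W m) = b3 by have := GH _ (WG m); rewrite HE => -[].
  have [nu [a3E b3E]] := affine_line Wi A0 (fun m => (WG m).2) hW3.
  have nu0 : nu != 0 by apply: contra_neq a30 => nu0; rewrite a3E nu0 scale0r.
  rewrite HE; apply/seteqP; split => x /= [Px]; rewrite a3E b3E dotZl.
    by move=> /(mulfI nu0).
  by move=> ->.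
have [U [GU [Ui facU]]] := simplex_facetE Pint (Ps _ facG) facG.
have UG r : G (U r) by rewrite GU; exact: conv_gen.
have hs m : exists r, m != i -> U r = V m.
  have [->|mi] := eqVneq m i; first by exists i.
  have [||r hr] := vertex_of_conv (facet_simplex_vertex m fV) _ _ (U := U).
  - by move=> r; exact: (UG r).1.
  - by rewrite -GU; have := WG m; rewrite /W /replace_at (negPf mi).
  - by exists r.
have [s hsV] := choice hs.
have [r0 hr0] : exists r0, forall m, m != i -> s m != r0.
  have /subsetPn [r0 _ hr0] : ~~ ([set: 'I_d]%SET \subset s @: [set~ i]%SET).
    apply/negP => /subset_leq_card; rewrite cardsT card_ord.
    move=> /leq_trans/(_ (leq_imset_card _ _)); rewrite cardsC1 card_ord.
    have := ltn_ord i; lia.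
  exists r0 => m mi; apply: contra hr0 => /eqP <-; apply: imset_f.
  by rewrite !finset.inE.
exists (U r0).
  by move=> h; have := (UG r0).2; rewrite h => h'; rewrite h' ltxx in AVi.
pose s' m := if m == i then r0 else s m.
have -> : replace_at V i (U r0) = U \o s'.
  apply/funext => m; rewrite /replace_at /= /s'; case: eqP => // /eqP mi.
  by rewrite hsV.
have s'i : injective s'.
  move=> m1 m2; rewrite /s'.
  case: (eqVneq m1 i) => [->|n1]; case: (eqVneq m2 i) => [->|n2] //.
  - by move/esym/eqP; rewrite (negPf (hr0 _ n2)).
  - by move/eqP; rewrite (negPf (hr0 _ n1)).
  by move=> /(congr1 U); rewrite !hsV // => /(affinely_independent_inj Vi).
split; first exact: affinely_independent_comp.
by rewrite conv_comp // -GU.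
Qed.

(** * Facet systems and their dihedral angles *)

(** What is kept of the boundary of an inscribed simplicial polytope with equal
    edges: FF V says that V lists the vertices of a facet. *)
Record facet_system (R : realType) d (s : R) (FF : ('I_d -> 'cV[R]_d) -> Prop)
    : Prop := FacetSystem {
  fs_unit : forall V i, FF V -> dot (V i) (V i) = 1;
  fs_dot : forall V i j, FF V -> i != j -> dot (V i) (V j) = s;
  fs_cross : forall V i, FF V -> exists2 q, q <> V i & FF (replace_at V i q);
  fs_aff : forall V, FF V -> affinely_independent V;
  fs_supp : forall V, FF V -> exists a b, [/\ a != 0,
    forall i, dot a (V i) = b & forall W i, FF W -> dot a (W i) <= b] }.

Definition mirror (R : realType) d (al : R) (V : 'I_d -> 'cV[R]_d) i :
    'cV[R]_d :=
  al *: (\sum_(j | j != i) V j) - V i.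

Definition flip (R : realType) d (al : R) (V : 'I_d -> 'cV[R]_d) i :=
  replace_at V i (mirror al V i).

(** Twice the cosine of the dihedral angle of the cone over V at its faces of
    codimension two. *)
Definition flip_coef (R : realType) (d : nat) (s : R) : R :=
  2 * s / (1 + (d - 2)%:R * s).

Lemma sum_const_neq (R : realType) d (i : 'I_d) (c : R) :
  \sum_(j < d | j != i) c = (d - 1)%:R * c.
Proof. by rewrite sumr_const cardC1 card_ord mulr_natl subn1. Qed.

Lemma dot_sum_equilateral (R : realType) d (s : R) (V : 'I_d -> 'cV[R]_d) i :
  dot (V i) (V i) = 1 -> (forall j, i != j -> dot (V i) (V j) = s) ->
  dot (\sum_j V j) (V i) = 1 + (d - 1)%:R * s.
Proof.
move=> V1 Vs; rewrite dot_suml (bigD1 i) //= V1 -(sum_const_neq i).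
by congr (_ + _); apply: eq_bigr => j ji; rewrite dotC Vs // eq_sym.
Qed.

Section FacetSystem.
Context {R : realType} {d : nat} {s : R} {FF : ('I_d -> 'cV[R]_d) -> Prop}.
Context (d3 : (3 <= d)%N) (s1 : s < 1) (fs : facet_system s FF).

Let e := 1 + (d - 1)%:R * s.

Lemma fs_replace_dot V i q : FF V -> FF (replace_at V i q) ->
  dot q q = 1 /\ forall j, j != i -> dot q (V j) = s.
Proof.
move=> _ Fq; split; first by have := fs_unit fs i Fq; rewrite /replace_at eqxx.
move=> j ji; have := fs_dot fs Fq (_ : i != j).
by rewrite /replace_at eqxx (negPf ji) => -> //; rewrite eq_sym.
Qed.

Lemma fs_dot_sum V i : FF V -> dot (\sum_j V j) (V i) = e.
Proof.
move=> FV; apply: dot_sum_equilateral; first exact: (fs_unit fs _ FV).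
by move=> k; exact: (fs_dot fs FV).
Qed.

(** The hyperplane of a facet misses the origin: otherwise the facet would have
    its centre there, and the vertex beyond a ridge would be forced to coincide
    with the vertex it replaces. *)
Lemma fs_height_gt0 V : FF V -> 0 < e.
Proof.
move=> FV; pose i := Ordinal (ltnW (ltnW d3)).
pose S := \sum_j V j.
have SV j : dot S (V j) = e := fs_dot_sum j FV.
have SS : dot S S = d%:R * e.
  rewrite {2}/S dot_sumr (eq_bigr (fun=> e)) => [|j _]; last exact: SV.
  by rewrite sumr_const card_ord mulr_natl.
have d0 : 0 < d%:R :> R by rewrite ltr0n; lia.
have e0 : 0 <= e by have := dot_ge0 S; rewrite SS pmulr_rge0.
rewrite lt_neqAle e0 andbT; apply/eqP => e00.
have S0 : S = 0 by apply: dot_eq0; rewrite SS -e00 mulr0.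
have [q qV Fq] := fs_cross fs i FV.
have [q1 qs] := fs_replace_dot FV Fq.
apply: qV; apply/eqP; rewrite -subr_eq0; apply/eqP/dot_eq0.
have : dot q S = 0 by rewrite S0 dot0r.
rewrite /S dot_sumr (bigD1 i) //= (eq_bigr (fun=> s)) // sum_const_neq => h.
rewrite dotBl !dotBr q1 (fs_unit fs i FV) (dotC (V i)).
by move: e00 h; rewrite /e; lra.
Qed.

Lemma fs_basis V : FF V -> (\matrix_(i, j) V j i 0) \in unitmx.
Proof.
move=> FV; rewrite -unitmx_tr -row_free_unit -kermx_eq0.
apply/rowV0P => u /sub_kermxP uM.
have u0 : \sum_j u 0 j *: V j = 0.
  apply/matrixP => i k; rewrite ord1 summxE.
  move/matrixP/(_ 0 i): uM; rewrite !mxE => h; apply: etrans h.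
  by apply: eq_bigr => j _; rewrite !mxE.
apply/matrixP => k i; rewrite ord1 [RHS]mxE.
apply: (fs_aff fs FV (c := fun i => u 0 i)) => //.
have : dot (\sum_j V j) (\sum_j u 0 j *: V j) = 0 by rewrite u0 dot0r.
rewrite dot_sumr.
rewrite (eq_bigr (fun j => u 0 j * e)) => [|j _]; last first.
  by rewrite dotZr fs_dot_sum.
rewrite -mulr_suml => /eqP; rewrite mulf_eq0 (gt_eqF (fs_height_gt0 FV)) orbF.
by move/eqP.
Qed.

Lemma fs_ridge_gt0 V : FF V -> 0 < 1 + (d - 2)%:R * s.
Proof.
move=> /fs_height_gt0; rewrite /e.
have -> : (d - 1)%:R = (d - 2)%:R + 1 :> R by rewrite natr1; congr (_ %:R); lia.
have d0 : 0 <= (d - 2)%:R :> R by exact: ler0n.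
by have [h|h] := lerP 0 s; nra.
Qed.

Let al : R := flip_coef d s.

Lemma fs_al V : FF V -> al * (1 + (d - 2)%:R * s) = 2 * s.
Proof. by move=> FV; rewrite divfK // gt_eqF // (fs_ridge_gt0 FV). Qed.

(** The vertex beyond a ridge has the same inner products with the ridge as the
    vertex it replaces, so it is its mirror image. *)
Lemma fs_crossE V i q : FF V -> FF (replace_at V i q) -> q <> V i ->
  q = mirror al V i.
Proof.
move=> FV Fq qV; have [q1 qs] := fs_replace_dot FV Fq.
pose h := V i - q; pose x := q - mirror al V i.
have Vi1 := fs_unit fs i FV.
have Vij j : j != i -> dot (V i) (V j) = s.
  by move=> ji; apply: (fs_dot fs FV); rewrite eq_sym.
have hi : dot h (V i) != 0.
  have : 0 < dot h h.
    by apply: dot_gt0; rewrite subr_eq0; apply/eqP => /esym.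
  rewrite /h dotBl !dotBr q1 Vi1 (dotC (V i)) => h0.
  by rewrite dotBl Vi1 gt_eqF //; lra.
have hj j : j != i -> dot h (V j) = 0.
  by move=> ji; rewrite dotBl Vij // qs // subrr.
have xj j : j != i -> dot x (V j) = 0.
  move=> ji; rewrite /x /mirror !dotBl dotZl qs // dot_suml (bigD1 j) //=.
  rewrite (fs_unit fs j FV) (eq_bigr (fun=> s)) => [|k /andP[ki kj]]; last first.
    exact: (fs_dot fs FV).
  rewrite Vij // sumr_const.
  have -> : #|[pred k : 'I_d | (k != i) && (k != j)]| = (d - 2)%N.
    have := cardC (pred2 i j); rewrite card2 (eq_sym i) ji card_ord /= add2n => E.
    have -> : #|[pred k : 'I_d | (k != i) && (k != j)]| = #|[predC pred2 i j]|.
      by apply: eq_card => k; rewrite !inE negb_or.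
    by apply/eqP; rewrite -(eqn_add2r 2) subnK ?addn2 ?E //; exact: ltnW.
  by rewrite -mulr_natl; have := fs_al FV; lra.
have xh : dot x h = 0.
  have Sh : dot (\sum_(j | j != i) V j) h = 0.
    by rewrite dot_suml big1 // => j ji; rewrite dotC hj.
  rewrite /x /mirror opprB addrA dotBl dotZl Sh mulr0 subr0 dotDl /h !dotBr.
  by rewrite q1 Vi1 (dotC (V i) q); ring.
pose k := dot x (V i) / dot h (V i).
have xk : x = k *: h.
  apply/eqP; rewrite -subr_eq0; apply/eqP.
  apply: (basis_dot_eq0 (fs_basis FV)) => j; rewrite dotBl dotZl.
  have [->|ji] := eqVneq j i; first by rewrite /k divfK ?subrr.
  by rewrite xj // hj // mulr0 subrr.
have h0 : h != 0 by apply: contra_neq hi => ->; rewrite dot0l.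
move: xh; rewrite xk dotZl => /eqP; rewrite mulf_eq0 (gt_eqF (dot_gt0 h0)) orbF.
move=> /eqP k0; apply/eqP; rewrite -subr_eq0; apply/eqP.
by rewrite -/x xk k0 scale0r.
Qed.

Lemma fs_flip V i : FF V -> FF (flip al V i).
Proof.
by move=> FV; have [q qV Fq] := fs_cross fs i FV; rewrite /flip -(fs_crossE FV Fq).
Qed.

Lemma fs_mirror_sum V i : FF V ->
  dot (\sum_j V j) (mirror al V i) = e * (al * (d - 1)%:R - 1).
Proof.
move=> FV; have SV j := fs_dot_sum j FV.
rewrite /mirror dotBr dotZr dot_sumr SV (eq_bigr (fun=> e)) // sum_const_neq.
by ring.
Qed.

Lemma fs_al_lt2 V : FF V -> al * (d - 1)%:R < 2.
Proof.
move=> FV; have h := fs_ridge_gt0 FV; have ha := fs_al FV.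
rewrite -(ltr_pM2r h) (mulrAC al) ha.
have -> : (d - 1)%:R = (d - 2)%:R + 1 :> R by rewrite natr1; congr (_ %:R); lia.
by have := s1; nra.
Qed.

(** The supporting functional of V is constant on the basis V, as is the inner
    product with the barycentre, so the two are proportional; the vertex beyond
    a ridge shows that the factor is positive. *)
Lemma fs_support V W i : FF V -> FF W -> dot (\sum_j V j) (W i) <= e.
Proof.
move=> FV FW; have [a [b [a0 aV aW]]] := fs_supp fs FV.
have e0 := fs_height_gt0 FV.
have SV j := fs_dot_sum j FV.
have aE : a = (b / e) *: \sum_j V j.
  apply/eqP; rewrite -subr_eq0; apply/eqP.
  apply: (basis_dot_eq0 (fs_basis FV)) => j.
  by rewrite dotBl dotZl SV aV divfK ?subrr // gt_eqF.
have b0 : b != 0 by apply: contra_neq a0 => b0; rewrite aE b0 mul0r scale0r.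
have be : b = b / e * e by rewrite divfK // gt_eqF.
have bpos : 0 < b.
  rewrite lt_neqAle eq_sym b0 leNgt /=; apply/negP => bneg.
  have := aW _ i (fs_flip i FV); rewrite /flip /replace_at eqxx aE dotZl.
  rewrite fs_mirror_sum // {2}be ler_nM2l; last by rewrite pmulr_llt0 ?invr_gt0.
  by have := fs_al_lt2 FV; nra.
have := aW W i FW; rewrite aE dotZl {2}be ler_pM2l //.
by rewrite divr_gt0.
Qed.

(** Crossing the ridges opposite to V i0 and V i1 alternately turns around
    their common face, changing only these two entries.  The heights of the new
    vertices over the initial facet obey a linear recurrence; that none of them
    exceeds the height of the facet leaves three dihedral angles, those for
    which 3, 4 or 5 facets close up around a face of codimension two. *)
Lemma fs_angle V : FF V -> [\/ al = - 1, al = 0 | 0 < al /\ al ^+ 2 + al = 1].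
Proof.
move=> FV; have d2 : (1 < d)%N by exact: ltnW.
pose i0 := Ordinal (ltnW d2); pose i1 := Ordinal d2.
pose S := \sum_j V j; have e0 := fs_height_gt0 FV.
pose n : R := (d - 2)%:R.
have d1E : (d - 1)%:R = n + 1 :> R by rewrite natr1; congr (_ %:R); lia.
pose rot p q := exists2 W, FF W & [/\ dot S (W i0) = e * p, dot S (W i1) = e * q
  & forall j, j != i0 -> j != i1 -> dot S (W j) = e].
have le1 p q : rot p q -> p <= 1 /\ q <= 1.
  move=> [W FW [hp hq _]]; have h0 := fs_support i0 FV FW.
  have h1 := fs_support i1 FV FW; rewrite -/S hp in h0; rewrite -/S hq in h1.
  by split; rewrite -(ler_pM2l e0) mulr1.
have sum2 (i j : 'I_d) (F : 'I_d -> R) : i != j ->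
    (forall k, k != i -> k != j -> F k = e) ->
    \sum_(k | k != i) F k = F j + n * e.
  move=> ij hF; have ji : j != i by rewrite eq_sym.
  have := sum_const_neq i e; rewrite d1E !(bigD1 j ji) /= => E.
  rewrite (eq_bigr (fun=> e)) => [|k /andP[ki kj]]; last by rewrite hF.
  by congr (_ + _); apply: (@addrI _ e); rewrite E mulrDl mul1r addrC.
have cross p q : rot p q -> rot (al * (q + n) - p) q /\ rot p (al * (p + n) - q).
  move=> [W FW [hp hq hj]]; split.
    exists (flip al W i0); first exact: fs_flip.
    rewrite /flip /replace_at /=; split => //; last first.
      by move=> j j0 j1; rewrite (negPf j0) hj.
    rewrite /mirror dotBr dotZr dot_sumr (sum2 i0 i1) //.
    by rewrite hp hq; ring.
  exists (flip al W i1); first exact: fs_flip.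
  rewrite /flip /replace_at /=; split => //; last first.
    by move=> j j0 j1; rewrite (negPf j1) hj.
  rewrite /mirror dotBr dotZr dot_sumr (sum2 i1 i0) // => [|j j1 j0].
    by rewrite hp hq; ring.
  exact: hj.
have SV j : dot S (V j) = e := fs_dot_sum j FV.
have r1 : rot 1 1 by exists V => //; rewrite !SV mulr1.
have [r2 _] := cross _ _ r1.
have [_ r3] := cross _ _ r2.
have [r4 _] := cross _ _ r3.
have [_ r5] := cross _ _ r4.
have [r6 _] := cross _ _ r5.
have [_ y3] := le1 _ _ r3; have [y4 _] := le1 _ _ r4.
have [_ y5] := le1 _ _ r5; have [y6 _] := le1 _ _ r6.
have al2 := fs_al_lt2 FV.
rewrite d1E in al2.
have n1 : 1 <= n by rewrite ler1n; lia.
have al1 : al < 1 by have := n1; have := al2; have [h|h] := lerP al 0; nra.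
clearbody al; clear -y3 y4 y5 y6 al2 al1.
pose c := 2 - al * (n + 1).
have c0 : 0 < c by rewrite subr_gt0.
have z3 : 0 <= c * (1 + al) by move: y3; rewrite /c; lra.
have z4 : 0 <= c * (al * (1 + al)) by move: y4; rewrite /c; lra.
have z5 : 0 <= c * (al * (al ^+ 2 + al - 1)) by move: y5; rewrite /c; lra.
have z6 : 0 <= c * ((al - 1) * (1 + al) * (al ^+ 2 + al - 1)).
  by move: y6; rewrite /c; lra.
rewrite !(pmulr_rge0 _ c0) in z3 z4 z5 z6.
have [->|aln1] := eqVneq al (- 1); first by constructor 1.
have [->|al0] := eqVneq al 0; first by constructor 2.
have p1 : 0 < 1 + al by rewrite lt_neqAle z3 andbT eq_sym addrC addr_eq0.
rewrite pmulr_lge0 // in z4.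
have p0 : 0 < al by rewrite lt_neqAle z4 andbT eq_sym.
constructor 3; split => //; apply/eqP; rewrite -subr_eq0 eq_le.
rewrite pmulr_rge0 // in z5; rewrite z5 andbT.
move: z6; rewrite -mulrA nmulr_rge0 ?subr_lt0 // pmulr_rle0 //.
Qed.

End FacetSystem.

(** * Positive definite functions on spheres *)

Definition linp (C : comNzRingType) (a b : C) : {poly C} := a *: 'X + b%:P.

(** The action of a 2 x 2 matrix (a, b; c, d) on binary forms of degree n in
    the monomial basis, dehomogenized: row j holds the coefficients of
    (a X + b)^j (c X + d)^(n - j). *)
Definition sym_poly (C : comNzRingType) n (a b c d : C) j : {poly C} :=
  (linp a b) ^+ j * (linp c d) ^+ (n - j).

Definition sym_coef (C : comNzRingType) n (a b c d : C) j k : C :=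
  (sym_poly n a b c d j)`_k.

Lemma size_linear (C : comNzRingType) (a b : C) : (size (linp a b) <= 2)%N.
Proof.
rewrite /linp; apply: leq_trans (size_polyD _ _) _; rewrite geq_max.
rewrite (leq_trans (size_scale_leq _ _)) ?size_polyX //.
by rewrite (leq_trans (size_polyC_leq1 _)).
Qed.

Lemma size_mul_linear (C : comNzRingType) (a b : C) (p : {poly C}) n :
  (size p <= n)%N -> (size (linp a b * p)%R <= n.+1)%N.
Proof.
move=> hp; apply: leq_trans (size_polyMleq _ _) _.
by have := size_linear a b; move: hp; case: (size _) => [|[|[|m]]] //=; lia.
Qed.

Lemma size_exp_linear (C : comNzRingType) (a b : C) (p : {poly C}) n m :
  (size p <= n)%N -> (size (linp a b ^+ m * p)%R <= n + m)%N.
Proof.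
move=> hp; elim: m => [|m IH]; first by rewrite expr0 mul1r addn0.
by rewrite exprS -mulrA addnS size_mul_linear.
Qed.

Lemma coef_mul_linear (C : comNzRingType) (a b : C) (p : {poly C}) k :
  ((linp a b) * p)`_k.+1 = a * p`_k + b * p`_k.+1.
Proof. by rewrite /linp mulrDl -scalerAl coefD coefZ coefXM coefCM. Qed.

Lemma coef_mul_linear0 (C : comNzRingType) (a b : C) (p : {poly C}) :
  ((linp a b) * p)`_0 = b * p`_0.
Proof. by rewrite /linp mulrDl -scalerAl coefD coefZ coefXM coefCM mulr0 add0r. Qed.

Definition homog (C : comNzRingType) n (p u v : {poly C}) : {poly C} :=
  \sum_(k < n.+1) p`_k *: (u ^+ k * v ^+ (n - k)).

Lemma homog_mul_linear (C : comNzRingType) n (a b : C) (p u v : {poly C}) :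
  (size p <= n.+1)%N ->
  homog n.+1 ((linp a b) * p) u v = (a *: u + b *: v) * homog n p u v.
Proof.
move=> hp; rewrite /homog [in RHS]mulrDl !mulr_sumr.
rewrite [in LHS]big_ord_recl /= coef_mul_linear0.
under eq_bigr do rewrite /bump /= add1n coef_mul_linear scalerDl.
rewrite big_split /= addrCA; congr (_ + _).
  apply: eq_bigr => k _; rewrite subSS exprS -!scalerAl -!scalerAr scalerA.
  by rewrite mulrA.
rewrite [in RHS]big_ord_recl [in LHS]big_ord_recr /=.
rewrite (nth_default 0 hp) mulr0 scale0r addr0; congr (_ + _).
  by rewrite !subn0 exprS -!scalerAl -!scalerAr scalerA !mulrA (mulrC v).
apply: eq_bigr => k _; rewrite /bump /= add1n -!scalerAl -!scalerAr scalerA.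
congr (_ *: _); rewrite [RHS]mulrCA; congr (_ * _).
by rewrite subSS -exprS; congr (_ ^+ _); have := ltn_ord k; lia.
Qed.

Lemma homog_sym_poly (C : comNzRingType) n (a b c d : C) (u v : {poly C}) j :
  (j <= n)%N ->
  homog n (sym_poly n a b c d j) u v
    = (a *: u + b *: v) ^+ j * (c *: u + d *: v) ^+ (n - j).
Proof.
move=> jn; rewrite /sym_poly -{1}(subnKC jn); set m := (n - j)%N.
have hm : (size (linp c d ^+ m)%R <= m.+1)%N.
  by have := size_exp_linear c d m (_ : (size (1%R : {poly C}) <= 1)%N);
     rewrite mulr1 add1n; apply; rewrite size_poly1.
have hv : homog m ((linp c d) ^+ m) u v = (c *: u + d *: v) ^+ m.
  elim: (m) => [|k IH].
    by rewrite /homog big_ord1 !expr0 coefC eqxx mulr1 scale1r.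
  rewrite !exprS homog_mul_linear ?IH //.
  by have := size_exp_linear c d k (_ : (size (1%R : {poly C}) <= 1)%N);
     rewrite mulr1 add1n; apply; rewrite size_poly1.
elim: (j) => [|k IH]; first by rewrite !expr0 !mul1r.
rewrite addSn !exprS -!mulrA homog_mul_linear ?IH //.
by apply: leq_trans (size_exp_linear _ _ _ hm) _; lia.
Qed.

Lemma sym_coef_mul (C : comNzRingType) n (a b c d a' b' c' d' : C) j l :
  (j <= n)%N ->
  \sum_(k < n.+1) sym_coef n a b c d j k * sym_coef n a' b' c' d' k l
  = sym_coef n (a * a' + b * c') (a * b' + b * d')
             (c * a' + d * c') (c * b' + d * d') j l.
Proof.
move=> jn; have := homog_sym_poly a b c d (linp a' b') (linp c' d') jn.
move=> /(congr1 (fun p : {poly C} => p`_l)); rewrite /homog coef_sum => h.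
rewrite /sym_coef [in RHS]/sym_poly.
under eq_bigr do rewrite -coefZ.
rewrite {}h; congr (_`_l).
have lin x y : x *: (linp a' b') + y *: (linp c' d')
    = linp (x * a' + y * c') (x * b' + y * d').
  rewrite /linp !scalerDr !scalerA !scalerDl polyCD -!mul_polyC !polyCM.
  by rewrite addrACA.
by rewrite !lin.
Qed.

Lemma sym_coef_transpose (C : comNzRingType) n (a b c d : C) j k :
  (j <= n)%N -> (k <= n)%N ->
  'C(n, j)%:R * sym_coef n a b c d j k = 'C(n, k)%:R * sym_coef n a c b d k j.
Proof.
move=> jn kn.
have gen (p q r t : C) i : (i <= n)%N ->
    (((linp r t)%:P + 'X * (linp p q)%:P) ^+ n)`_i
      = 'C(n, i)%:R *: sym_poly n p q r t i :> {poly C}.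
  move=> i_n; rewrite exprDn coef_sum (bigD1 (Ordinal (i_n : (i < n.+1)%N))) //=.
  rewrite big1 ?addr0 => [|l li].
    rewrite coefMn exprMn -!polyC_exp mulrCA coefXnM ltnn subnn -polyCM coefC /=.
    by rewrite /sym_poly mulrC scaler_nat.
  rewrite coefMn exprMn -!polyC_exp mulrCA coefXnM -polyCM coefC.
  case: ltnP => [_|h]; first by rewrite mul0rn.
  have -> : (i - l == 0)%N = false.
    by apply/negbTE; move: li; rewrite -val_eqE /=; lia.
  by rewrite mul0rn.
have E : swapXY ((linp c d)%:P + 'X * (linp a b)%:P)
    = (linp b d)%:P + 'X * (linp a c)%:P.
  apply/polyP => p; apply/polyP => q; rewrite coef_swapXY !coefD !coefXM !coefC.
  by case: p => [|[|p]]; case: q => [|[|q]] /=;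
    rewrite /linp ?(coefD, coefZ, coefX, coefC, coef0) /=; ring.
rewrite /sym_coef -!coefZ -!gen // -E -rmorphXn.
by rewrite [in RHS]coef_swapXY.
Qed.

Definition sym_tr (C : comNzRingType) n (a b c d : C) : C :=
  \sum_(j < n.+1) sym_coef n a b c d j j.

Lemma sym_tr0 (C : comNzRingType) (a b c d : C) : sym_tr 0 a b c d = 1.
Proof.
by rewrite /sym_tr big_ord1 /sym_coef /sym_poly !expr0 mulr1 coefC eqxx.
Qed.

Definition sym_subtr (C : comNzRingType) n (a b c d : C) : C :=
  \sum_(j < n) ((linp a b) ^+ j.+1 * (linp c d) ^+ (n - j.+1))`_j.

Lemma sym_subtrS (C : comNzRingType) n (a b c d : C) :
  sym_subtr n.+1 a b c d = b * sym_tr n a b c d + a * sym_subtr n a b c d.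
Proof.
rewrite /sym_subtr /sym_tr big_ord_recl /= [in RHS]big_ord_recl /=.
rewrite expr1 subSS coef_mul_linear0 /sym_coef {1}/sym_poly expr0 mul1r.
rewrite mulrDr -addrA; congr (_ + _).
rewrite !mulr_sumr -big_split /=; apply: eq_bigr => j _.
rewrite /bump /= add1n subSS exprS -mulrA coef_mul_linear addrC.
by rewrite /sym_poly exprS.
Qed.

Lemma sym_trS (C : comNzRingType) n (a b c d : C) :
  sym_tr n.+1 a b c d
  = d * sym_tr n a b c d + c * sym_subtr n a b c d + a ^+ n.+1.
Proof.
have lead m : ((linp a b) ^+ m)`_m = a ^+ m.
  elim: m => [|m IH]; first by rewrite !expr0 coefC eqxx.
  rewrite exprS coef_mul_linear IH -exprS nth_default ?mulr0 ?addr0 //.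
  by have := size_exp_linear a b m (_ : (size (1%R : {poly C}) <= 1)%N);
     rewrite mulr1 add1n; apply; rewrite size_poly1.
rewrite {1}/sym_tr big_ord_recr /=; congr (_ + _); last first.
  by rewrite /sym_coef /sym_poly subnn expr0 mulr1 lead.
rewrite /sym_tr /sym_subtr !mulr_sumr big_ord_recl /= [in RHS]big_ord_recl /=.
rewrite -addrA; congr (_ + _).
  rewrite /sym_coef /sym_poly !expr0 !mul1r !subn0 exprS.
  by rewrite coef_mul_linear0.
rewrite -big_split /=; apply: eq_bigr => j _.
rewrite /bump /= add1n /sym_coef /sym_poly subSn ?exprS; last exact: ltn_ord.
rewrite -exprS mulrCA coef_mul_linear.
by rewrite addrC.
Qed.

Lemma sym_trSS (C : comNzRingType) n (a b c d : C) :
  sym_tr n.+2 a b c d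
  = (a + d) * sym_tr n.+1 a b c d - (a * d - b * c) * sym_tr n a b c d.
Proof.
rewrite [LHS]sym_trS sym_subtrS; have := sym_trS n a b c d => ->.
by rewrite !exprS; ring.
Qed.

Fixpoint cheb2 (R : pzRingType) (n : nat) (x : R) : R * R :=
  if n is m.+1 then let: (p, q) := cheb2 m x in (q, x * q - p) else (1, x).

(** The Chebyshev polynomial of the second kind U_n, as a function of twice
    the cosine. *)
Definition cheb (R : pzRingType) (n : nat) (x : R) : R := (cheb2 n x).1.

Lemma cheb0 (R : pzRingType) (x : R) : cheb 0 x = 1. Proof. by []. Qed.
Lemma cheb1 (R : pzRingType) (x : R) : cheb 1 x = x. Proof. by []. Qed.

Lemma chebSS (R : pzRingType) n (x : R) :
  cheb n.+2 x = x * cheb n.+1 x - cheb n x.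
Proof. by rewrite /cheb /=; case: (cheb2 n x). Qed.

Lemma sym_tr_cheb (C : comNzRingType) n (a b c d : C) :
  a * d - b * c = 1 -> sym_tr n a b c d = cheb n (a + d).
Proof.
move=> det1; suff [] : sym_tr n a b c d = cheb n (a + d) /\
  sym_tr n.+1 a b c d = cheb n.+1 (a + d) by [].
elim: n => [|n [IH1 IH2]].
  rewrite sym_tr0 sym_trS sym_tr0 /sym_subtr big_ord0; split => //.
  by rewrite cheb1; ring.
split => //; rewrite sym_trSS chebSS det1 mul1r.
by rewrite IH1 IH2.
Qed.

(** Positive definiteness is only required on unit vectors. *)
Definition pdk (R : realType) d (K : 'cV[R]_d -> 'cV[R]_d -> R) : Prop :=
  forall k (x : 'I_k -> 'cV[R]_d) (c : 'I_k -> R),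
    (forall i, dot (x i) (x i) = 1) ->
    0 <= \sum_i \sum_j c i * c j * K (x i) (x j).

Definition posdef (R : realType) d (f : R -> R) : Prop :=
  pdk (fun x y : 'cV[R]_d => f (dot x y)).

Lemma pdk_ext (R : realType) d (K L : 'cV[R]_d -> 'cV[R]_d -> R) :
  (forall x y, dot x x = 1 -> dot y y = 1 -> K x y = L x y) -> pdk L -> pdk K.
Proof.
move=> KL hL k x c x1; under eq_bigr do under eq_bigr do rewrite KL //.
exact: hL.
Qed.

Lemma pdk_feature (R : realType) d (phi : 'cV[R]_d -> R) :
  pdk (fun x y => phi x * phi y).
Proof.
move=> k x c _.
have -> : \sum_i \sum_j c i * c j * (phi (x i) * phi (x j))
    = (\sum_i c i * phi (x i)) ^+ 2.
  rewrite expr2 mulr_suml; apply: eq_bigr => i _; rewrite mulr_sumr.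
  by apply: eq_bigr => j _; ring.
exact: sqr_ge0.
Qed.

Lemma pdkD (R : realType) d (K L : 'cV[R]_d -> 'cV[R]_d -> R) :
  pdk K -> pdk L -> pdk (fun x y => K x y + L x y).
Proof.
move=> hK hL k x c x1.
under eq_bigr do under eq_bigr do rewrite mulrDr.
under eq_bigr do rewrite big_split /=.
by rewrite big_split /= addr_ge0 ?hK ?hL.
Qed.

Lemma pdkZ (R : realType) d (w : R) (K : 'cV[R]_d -> 'cV[R]_d -> R) :
  0 <= w -> pdk K -> pdk (fun x y => w * K x y).
Proof.
move=> w0 hK k x c x1.
under eq_bigr do under eq_bigr do rewrite mulrCA.
under eq_bigr do rewrite -mulr_sumr.
by rewrite -mulr_sumr mulr_ge0 ?hK.
Qed.

Lemma pdk_sum (R : realType) d (I : Type) (r : seq I)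
    (K : I -> 'cV[R]_d -> 'cV[R]_d -> R) :
  (forall i, pdk (K i)) -> pdk (fun x y => \sum_(i <- r) K i x y).
Proof.
move=> hK; elim: r => [|i r IH].
  apply: (pdk_ext (L := fun x y => 0 * (0 * 0))).
    by move=> x y _ _; rewrite big_nil mul0r.
  by apply: pdkZ => //; exact: (pdk_feature (fun=> 0)).
apply: (pdk_ext (L := fun x y => K i x y + \sum_(j <- r) K j x y)).
  by move=> x y _ _; rewrite big_cons.
exact: pdkD.
Qed.

Lemma posdef_id (R : realType) d : posdef d (fun t : R => t).
Proof.
apply: (pdk_ext (L := fun x y => \sum_(i < d) x i 0 * y i 0)) => //.
by apply: pdk_sum => i; exact: (pdk_feature (fun x => x i 0)).
Qed.

Lemma posdef_sqr (R : realType) d : (0 < d)%N ->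
  posdef d (fun t : R => t ^+ 2 - d%:R^-1).
Proof.
move=> d0; have dn : d%:R != 0 :> R by rewrite pnatr_eq0 -lt0n.
pose phi (p : 'I_d * 'I_d) (x : 'cV[R]_d) :=
  x p.1 0 * x p.2 0 - (p.1 == p.2)%:R / d%:R.
apply: (pdk_ext (L := fun x y => \sum_p phi p x * phi p y)); last first.
  by apply: pdk_sum => p; exact: pdk_feature.
move=> x y x1 y1; rewrite -(pair_bigA _ (fun i j => phi (i, j) x * phi (i, j) y)).
have SD i (G : 'I_d -> R) : \sum_j (i == j)%:R * G j = G i.
  rewrite (bigD1 i) //= eqxx mul1r big1 ?addr0 // => j.
  by rewrite eq_sym => /negPf ->; rewrite mul0r.
have S i : \sum_j phi (i, j) x * phi (i, j) y
    = x i 0 * y i 0 * dot x y - (x i 0 * x i 0 + y i 0 * y i 0) / d%:R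
      + d%:R^-1 * d%:R^-1.
  rewrite (eq_bigr (fun j => x i 0 * y i 0 * (x j 0 * y j 0) + (i == j)%:R *
    (- (x i 0 * x j 0 + y i 0 * y j 0) / d%:R + d%:R^-1 * d%:R^-1))).
    by rewrite big_split /= -mulr_sumr SD -/(dot x y); ring.
  by move=> j _; rewrite /phi /=; case: eqP => _ /=; field.
rewrite (eq_bigr _ (fun i _ => S i)) big_split /= sumrB -mulr_suml -mulr_suml.
rewrite big_split /= -!/(dot _ _) x1 y1 sumr_const card_ord -mulr_natl.
by field.
Qed.

Lemma rmorph_cheb (A B : pzRingType) (f : {rmorphism A -> B}) n x :
  cheb n (f x) = f (cheb n x).
Proof.
suff [] : cheb n (f x) = f (cheb n x) /\ cheb n.+1 (f x) = f (cheb n.+1 x) by [].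
elim: n => [|n [IH1 IH2]]; first by rewrite !cheb0 !cheb1 rmorph1.
by split => //; rewrite !chebSS IH1 IH2 rmorphB rmorphM.
Qed.

Lemma rmorph_sym_coef (A B : comNzRingType) (f : {rmorphism A -> B}) n
    (a b c d : A) j k :
  sym_coef n (f a) (f b) (f c) (f d) j k = f (sym_coef n a b c d j k).
Proof.
rewrite /sym_coef -coef_map /sym_poly rmorphM !rmorphXn /= /linp.
by rewrite !rmorphD /= !map_polyZ !map_polyX !map_polyC.
Qed.

(** The unit quaternion with coordinates x is a matrix g_x in SU(2), with
    g_x g_y^* of determinant 1 and trace 2 (x . y).  Hence U_n (x . y) is the
    trace of the product of the actions of g_x and of g_y^* on binary forms of
    degree n, and the latter is the adjoint of the action of g_y for a weighted
    Hermitian form. *)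
Lemma posdef_cheb (R : realType) n : posdef 4 (fun t : R => cheb n (2 * t)).
Proof.
pose ix k (kl : (k < 4)%N) : 'I_4 := Ordinal kl.
pose al (x : 'cV[R]_4) : complex.complex R :=
  complex.Complex (x (ix 0%N isT) 0) (x (ix 1%N isT) 0).
pose be (x : 'cV[R]_4) : complex.complex R :=
  complex.Complex (x (ix 2%N isT) 0) (x (ix 3%N isT) 0).
pose z (p : 'I_n.+1 * 'I_n.+1) (x : 'cV[R]_4) : complex.complex R :=
  sym_coef n (al x) (be x) (- complex.conjc (be x)) (complex.conjc (al x)) p.1 p.2.
pose w (p : 'I_n.+1 * 'I_n.+1) : R := 'C(n, p.1)%:R / 'C(n, p.2)%:R.
apply: (pdk_ext (L := fun x y => \sum_p w p *
  (complex.Re (z p x) * complex.Re (z p y)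
   + complex.Im (z p x) * complex.Im (z p y)))); last first.
  apply: pdk_sum => p; apply: pdkZ; first by rewrite divr_ge0.
  apply: pdkD; first exact: (pdk_feature (fun x => complex.Re (z p x))).
  exact: (pdk_feature (fun x => complex.Im (z p x))).
move=> x y x1 y1.
pose toC : {rmorphism R -> complex.complex R} := complex.real_complex R.
have four (u v : 'cV[R]_4) : dot u v = u (ix 0%N isT) 0 * v (ix 0%N isT) 0 +
    u (ix 1%N isT) 0 * v (ix 1%N isT) 0 + u (ix 2%N isT) 0 * v (ix 2%N isT) 0 +
    u (ix 3%N isT) 0 * v (ix 3%N isT) 0.
  rewrite /dot !big_ord_recr big_ord0 /= add0r.
  by congr (u _ 0 * v _ 0 + u _ 0 * v _ 0 + u _ 0 * v _ 0 + u _ 0 * v _ 0);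
    apply: val_inj.
have key : toC (cheb n (2 * dot x y))
    = \sum_p toC (w p) * (z p x * complex.conjc (z p y)).
  rewrite -rmorph_cheb.
  pose cj : {rmorphism complex.complex R -> complex.complex R} := @complex.conjc R.
  have det1 : (al x * cj (al y) + be x * cj (be y)) *
      (- cj (be x) * - be y + cj (al x) * al y) -
      (al x * - be y + be x * al y) *
      (- cj (be x) * cj (al y) + cj (al x) * cj (be y)) = 1.
    transitivity ((al x * cj (al x) + be x * cj (be x)) *
                  (al y * cj (al y) + be y * cj (be y))); first by ring.
    have nrm u : dot u u = 1 -> al u * cj (al u) + be u * cj (be u) = 1.
      rewrite four => u1; apply/eqP; rewrite complex.eq_complex /= -u1.
      by apply/andP; split; apply/eqP; ring.
    by rewrite !nrm // mulr1.
  have -> : toC (2 * dot x y) = (al x * cj (al y) + be x * cj (be y)) +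
      (- cj (be x) * - be y + cj (al x) * al y).
    apply/eqP; rewrite complex.eq_complex /= four.
    by apply/andP; split; apply/eqP; ring.
  rewrite -(sym_tr_cheb n det1) /sym_tr.
  rewrite -(pair_bigA _ (fun j k => toC (w (j, k)) *
    (z (j, k) x * complex.conjc (z (j, k) y)))) /=.
  apply: eq_bigr => j _; rewrite -sym_coef_mul; last by rewrite -ltnS.
  apply: eq_bigr => k _; rewrite mulrCA; congr (_ * _).
  have jn : (j <= n)%N by rewrite -ltnS.
  have kn : (k <= n)%N by rewrite -ltnS.
  have := sym_coef_transpose (al y) (be y) (- cj (be y)) (cj (al y)) jn kn.
  have C0 : 'C(n, k)%:R != 0 :> complex.complex R.
    by rewrite pnatr_eq0 -lt0n bin_gt0.
  rewrite -/(z (j, k) y) => E.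
  have {}E : sym_coef n (al y) (- cj (be y)) (be y) (cj (al y)) k j
      = toC (w (j, k)) * z (j, k) y.
    apply: (mulfI C0); rewrite -E /w /= rmorphM fmorphV !rmorph_nat.
    by rewrite mulrA mulrCA divff ?mulr1.
  have := congr1 cj E; rewrite -[LHS]rmorph_sym_coef [RHS]rmorphM.
  rewrite (rmorphN cj) ![cj (cj _)]complex.conjcK /cj /= oppr0.
  by move=> h; apply: etrans h _.
have ReM (r : R) (u v : complex.complex R) :
    complex.Re (toC r * (u * complex.conjc v))
    = r * (complex.Re u * complex.Re v + complex.Im u * complex.Im v).
  by case: u v => [a b] [a' b'] /=; ring.
have ReS (F : 'I_n.+1 * 'I_n.+1 -> complex.complex R) :
    complex.Re (\sum_p F p) = \sum_p complex.Re (F p).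
  by apply: (big_morph (@complex.Re R)) => // -[a b] [a' b'].
have := congr1 (@complex.Re R) key; rewrite ReS /= => ->.
by apply: eq_bigr => p _; rewrite ReM.
Qed.

(** Chebyshev polynomial T_3: the features are the real and imaginary parts of
    (x_0 + i x_1)^3. *)
Lemma posdef_cubic2 (R : realType) : posdef 2 (fun t : R => 4 * t ^+ 3 - 3 * t).
Proof.
pose X (x : 'cV[R]_2) := x 0 0; pose Y (x : 'cV[R]_2) := x 1 0.
have two u v : dot u v = X u * X v + Y u * Y v.
  rewrite /dot !big_ord_recr big_ord0 /= add0r.
  by congr (u _ 0 * v _ 0 + u _ 0 * v _ 0); apply: val_inj.
pose f x := X x ^+ 3 - 3 * X x * Y x ^+ 2.
pose g x := 3 * X x ^+ 2 * Y x - Y x ^+ 3.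
apply: (pdk_ext (L := fun x y => f x * f y + g x * g y)); last first.
  by apply: pdkD; exact: pdk_feature.
move=> x y x1 y1.
have -> : 3 * dot x y = 3 * dot x y * (dot x x * dot y y) by rewrite x1 y1 !mulr1.
by rewrite !two /f /g; ring.
Qed.

(** Legendre polynomials P_3 and P_4 (up to scaling): the features are the
    solid spherical harmonics of degree 3 and 4. *)
Lemma posdef_cubic3 (R : realType) : posdef 3 (fun t : R => 5 * t ^+ 3 - 3 * t).
Proof.
pose X (x : 'cV[R]_3) := x 0 0; pose Y (x : 'cV[R]_3) := x 1 0.
pose Z (x : 'cV[R]_3) := x (Ordinal (isT : 2 < 3)%N) 0.
have three u v : dot u v = X u * X v + Y u * Y v + Z u * Z v.
  rewrite /dot !big_ord_recr big_ord0 /= add0r.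
  by congr (u _ 0 * v _ 0 + u _ 0 * v _ 0 + u _ 0 * v _ 0); apply: val_inj.
pose r x := X x ^+ 2 + Y x ^+ 2.
pose f0 x := Z x * (2 * Z x ^+ 2 - 3 * r x).
pose f1 x := X x * (4 * Z x ^+ 2 - r x).
pose f2 x := Y x * (4 * Z x ^+ 2 - r x).
pose f3 x := Z x * (X x ^+ 2 - Y x ^+ 2).
pose f4 x := Z x * (2 * X x * Y x).
pose f5 x := X x ^+ 3 - 3 * X x * Y x ^+ 2.
pose f6 x := 3 * X x ^+ 2 * Y x - Y x ^+ 3.
apply: (pdk_ext (L := fun x y => 1 / 2 * (f0 x * f0 y) +
  (3 / 4 * (f1 x * f1 y) + (3 / 4 * (f2 x * f2 y) +
  (15 / 2 * (f3 x * f3 y) + (15 / 2 * (f4 x * f4 y) +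
  (5 / 4 * (f5 x * f5 y) + 5 / 4 * (f6 x * f6 y)))))))); last first.
  by do 6![apply: pdkD; first by apply: pdkZ; [lra|exact: pdk_feature]];
     apply: pdkZ; [lra|exact: pdk_feature].
move=> x y x1 y1.
have -> : 3 * dot x y = 3 * dot x y * (dot x x * dot y y) by rewrite x1 y1 !mulr1.
by rewrite !three /f0 /f1 /f2 /f3 /f4 /f5 /f6 /r; field.
Qed.

Lemma posdef_quartic3 (R : realType) :
  posdef 3 (fun t : R => 35 * t ^+ 4 - 30 * t ^+ 2 + 3).
Proof.
pose X (x : 'cV[R]_3) := x 0 0; pose Y (x : 'cV[R]_3) := x 1 0.
pose Z (x : 'cV[R]_3) := x (Ordinal (isT : 2 < 3)%N) 0.
have three u v : dot u v = X u * X v + Y u * Y v + Z u * Z v.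
  rewrite /dot !big_ord_recr big_ord0 /= add0r.
  by congr (u _ 0 * v _ 0 + u _ 0 * v _ 0 + u _ 0 * v _ 0); apply: val_inj.
pose r x := X x ^+ 2 + Y x ^+ 2.
pose f0 x := 8 * Z x ^+ 4 - 24 * Z x ^+ 2 * r x + 3 * r x ^+ 2.
pose f1 x := X x * Z x * (4 * Z x ^+ 2 - 3 * r x).
pose f2 x := Y x * Z x * (4 * Z x ^+ 2 - 3 * r x).
pose f3 x := (X x ^+ 2 - Y x ^+ 2) * (6 * Z x ^+ 2 - r x).
pose f4 x := (2 * X x * Y x) * (6 * Z x ^+ 2 - r x).
pose f5 x := Z x * (X x ^+ 3 - 3 * X x * Y x ^+ 2).
pose f6 x := Z x * (3 * X x ^+ 2 * Y x - Y x ^+ 3).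
pose f7 x := X x ^+ 4 - 6 * X x ^+ 2 * Y x ^+ 2 + Y x ^+ 4.
pose f8 x := 4 * X x ^+ 3 * Y x - 4 * X x * Y x ^+ 3.
apply: (pdk_ext (L := fun x y => 1 / 8 * (f0 x * f0 y) +
  (5 * (f1 x * f1 y) + (5 * (f2 x * f2 y) +
  (5 / 2 * (f3 x * f3 y) + (5 / 2 * (f4 x * f4 y) +
  (35 * (f5 x * f5 y) + (35 * (f6 x * f6 y) +
  (35 / 8 * (f7 x * f7 y) + 35 / 8 * (f8 x * f8 y)))))))))); last first.
  by do 8![apply: pdkD; first by apply: pdkZ; [lra|exact: pdk_feature]];
     apply: pdkZ; [lra|exact: pdk_feature].
move=> x y x1 y1.
have -> : 30 * dot x y ^+ 2 = 30 * dot x y ^+ 2 * (dot x x * dot y y).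
  by rewrite x1 y1 !mulr1.
have -> : (3 : R) = 3 * (dot x x * dot y y) ^+ 2 by rewrite x1 y1 !mulr1 expr1n mulr1.
by rewrite !three /f0 /f1 /f2 /f3 /f4 /f5 /f6 /f7 /f8 /r; field.
Qed.

(** * The linear programming bound and its stability *)

Lemma poly_lipschitz (R : realType) (p : {poly R}) : exists2 L : R, 0 <= L &
  forall u v, `|u| <= 1 -> `|v| <= 1 -> `|p.[u] - p.[v]| <= L * `|u - v|.
Proof.
elim/poly_ind: p => [|p c [L L0 IH]].
  by exists 0 => // u v _ _; rewrite !horner0 subrr normr0 mul0r.
exists (L + (`|p.[0]| + L)) => [|u v u1 v1]; first by rewrite !addr_ge0.
rewrite !hornerMXaddC.
have -> : p.[u] * u + c - (p.[v] * v + c)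
    = u * (p.[u] - p.[v]) + p.[v] * (u - v) by ring.
apply: le_trans (ler_normD _ _) _; rewrite !normrM mulrDl lerD //.
  by apply: le_trans (IH u v u1 v1); rewrite ler_piMl.
rewrite ler_wpM2r //; have := IH v 0 v1; rewrite normr0 ler01 subr0 => /(_ isT) h.
rewrite -[p.[v]](subrK p.[0]) addrC; apply: le_trans (ler_normD _ _) _.
by rewrite lerD2l (le_trans h) // ler_piMr.
Qed.

Lemma poly_bounded (R : realType) (p : {poly R}) : exists2 B : R, 0 <= B &
  forall u, `|u| <= 1 -> `|p.[u]| <= B.
Proof.
have [L L0 hL] := poly_lipschitz p.
exists (`|p.[0]| + L) => [|u u1]; first by rewrite addr_ge0.
have := hL u 0 u1; rewrite normr0 ler01 subr0 => /(_ isT) h.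
rewrite -[p.[u]](subrK p.[0]) addrC; apply: le_trans (ler_normD _ _) _.
by rewrite lerD2l (le_trans h) // ler_piMr.
Qed.

Lemma posdef_ge0_1 (R : realType) d (K : R -> R) (x : 'cV[R]_d) :
  posdef d K -> dot x x = 1 -> 0 <= K 1.
Proof.
move=> hK x1; have := hK 1%N (fun=> x) (fun=> 1) (fun=> x1).
by rewrite !big_ord1 x1 !mul1r.
Qed.

Lemma posdef_row (R : realType) d (K : R -> R) k (x : 'I_k -> 'cV[R]_d) i :
  posdef d K -> (forall i, dot (x i) (x i) = 1) ->
  (\sum_j K (dot (x i) (x j))) ^+ 2 <= K 1 * \sum_i \sum_j K (dot (x i) (x j)).
Proof.
move=> hK x1; set S := (X in _ <= _ * X); set sg := (X in X ^+ 2).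
have K1 := posdef_ge0_1 hK (x1 i).
have quad la : 0 <= S + 2 * la * sg + la ^+ 2 * K 1.
  have := hK k x (fun j => 1 + la * (j == i)%:R) x1.
  have delta (G : 'I_k -> R) : \sum_j (j == i)%:R * G j = G i.
    rewrite (bigD1 i) //= eqxx mul1r big1 ?addr0 // => j.
    by move=> /negPf ->; rewrite mul0r.
  rewrite (eq_bigr (fun p => \sum_q K (dot (x p) (x q)) +
    la * K (dot (x p) (x i)) + (p == i)%:R * (la * \sum_q K (dot (x p) (x q)) +
    la ^+ 2 * K (dot (x p) (x i))))); last first.
    move=> p _; rewrite (eq_bigr (fun q => K (dot (x p) (x q)) +
      (p == i)%:R * la * K (dot (x p) (x q)) + (q == i)%:R *
      (la * K (dot (x p) (x q)) + (p == i)%:R * la ^+ 2 * K (dot (x p) (x q))))).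
      by rewrite !big_split /= delta -mulr_sumr; ring.
    by move=> q _; ring.
  rewrite !big_split /= delta -mulr_sumr x1.
  have -> : \sum_p K (dot (x p) (x i)) = sg.
    by apply: eq_bigr => p _; rewrite dotC.
  by rewrite -/S -/sg; lra.
have [K10|K10] := eqVneq (K 1) 0.
  rewrite K10 mul0r; have [->|sg0] := eqVneq sg 0; first by rewrite expr0n.
  have := quad (- (S + 1) / (2 * sg)); rewrite K10 mulr0 addr0.
  have -> : S + 2 * (- (S + 1) / (2 * sg)) * sg = - 1 by field.
  by rewrite oppr_ge0 ler10.
have K1p : 0 < K 1 by rewrite lt_neqAle eq_sym K10.
have := quad (- sg / K 1).
have -> : S + 2 * (- sg / K 1) * sg + (- sg / K 1) ^+ 2 * K 1
    = (K 1 * S - sg ^+ 2) / K 1 by field.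
by rewrite pmulr_lge0 ?invr_gt0 // subr_ge0.
Qed.

(** A tight linear programming certificate for spherical codes: N points with
    inner products at most s are optimal in dimension d, and each of them has A
    others at inner product s.  The auxiliary function is (t - s) F(t); the
    second polynomial g vanishes at the other inner products of an optimal
    code, which is what the bound g^2 <= M F records. *)
Record lp_cert (R : realType) (d N A : nat) (s : R) m (K : 'I_m -> R -> R)
    (F g : {poly R}) (f0 g0 M : R) (fc gc : 'I_m -> R) : Prop := LpCert {
  lp_s : - 1 <= s < 1;
  lp_posdef : forall n, posdef d (K n);
  lp_fc : forall n, 0 <= fc n;
  lp_gc : forall n, gc n != 0 -> 0 < fc n;
  lp_f0 : 0 < f0;
  lp_fE : forall t, (t - s) * F.[t] = f0 + \sum_n fc n * K n t;
  lp_gE : forall t, g.[t] = g0 + \sum_n gc n * K n t;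
  lp_F : forall t, - 1 <= t <= 1 -> 0 <= F.[t];
  lp_Fs : 0 < F.[s];
  lp_M : 0 <= M;
  lp_gF : forall t, - 1 <= t <= 1 -> g.[t] ^+ 2 <= M * F.[t];
  lp_gs : 0 < g.[s];
  lp_N : (1 - s) * F.[1] = N%:R * f0;
  lp_A : g.[1] + A%:R * g.[s] = N%:R * g0 }.

Definition adjacent (R : realType) d (s eta : R) k (x : 'I_k -> 'cV[R]_d) :
    rel 'I_k :=
  fun i j => (i != j) && (`|dot (x i) (x j) - s| < eta).

Definition spherical_code (R : realType) d (s : R) k (x : 'I_k -> 'cV[R]_d) :=
  (forall i, dot (x i) (x i) = 1) /\
  (forall i j, i != j -> dot (x i) (x j) <= s).

Lemma unit_dot_le1 (R : realType) d (u v : 'cV[R]_d) :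
  dot u u = 1 -> dot v v = 1 -> - 1 <= dot u v <= 1.
Proof.
move=> u1 v1; rewrite -ler_norml -(@ler_pXn2r _ 2) ?nnegrE //.
by rewrite real_normK ?num_real // expr1n (le_trans (cauchy_schwarz _ _)) // u1 v1 mul1r.
Qed.

(** Stability of the linear programming bound.  The slack in the bound is
    O(eps), so every single term of it is at least - O(eps): near s, where the
    auxiliary function has a simple zero, this forces the inner products to be
    within O(eps) of s, and elsewhere it makes g small; and the row sums of the
    kernels in g are O(sqrt eps), so that the value of the row sums of g counts
    the neighbours. *)
Theorem lp_stability (R : realType) d N A (s : R) m K F g f0 g0 M fc gc :
  @lp_cert R d N A s m K F g f0 g0 M fc gc ->
  exists eta C e0 : R, [/\ 0 < eta < 1 - s, 0 <= C, 0 < e0 &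
    forall e k (x : 'I_k -> 'cV[R]_d), 0 <= e < e0 -> (N <= k)%N ->
    spherical_code (s + e) x ->
    [/\ k = N, forall i j, adjacent s eta x i j -> `|dot (x i) (x j) - s| <= C * e &
        forall i, #|adjacent s eta x i| = A]].
Proof.
move=> lp; have /andP[sm1 s1] := lp_s lp.
have sn : `|s| <= 1 by rewrite ler_norml sm1 ltW.
have [LF LF0 hLF] := poly_lipschitz F; have [Lg Lg0 hLg] := poly_lipschitz g.
have [B B0 hB] := poly_bounded F.
have Fs := lp_Fs lp; have gs := lp_gs lp; have f00 := lp_f0 lp; have M0 := lp_M lp.
pose ka := F.[s] / 2; have ka0 : 0 < ka by rewrite divr_gt0.
have [eta [eta0 eta1 etaF]] :
    exists eta : R, [/\ 0 < eta, eta < 1 - s & eta <= ka / (LF + 1)].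
  exists (Num.min (ka / (LF + 1)) ((1 - s) / 2)); split.
  - by rewrite lt_min; apply/andP; split; rewrite divr_gt0 ?subr_gt0 ?ltr_wpDl.
  - by rewrite gt_min; apply/orP; right; rewrite ltr_pdivrMr // mulr_natr mulr2n; lra.
  - by rewrite ge_min lexx.
pose D := N%:R ^+ 2 * B; have D0 : 0 <= D by rewrite mulr_ge0 // sqr_ge0.
pose C := 1 + D / ka; have C1 : 1 <= C by rewrite lerDl divr_ge0 // ltW.
have C0 : 0 <= C by apply: le_trans C1.
pose th := g.[s] / (4 * (N%:R + 1)).
have th0 : 0 < th by rewrite divr_gt0 // mulr_gt0 // ltr_wpDl.
pose th' := g.[s] / (4 * (m%:R + 1)).
have th'0 : 0 < th' by rewrite divr_gt0 // mulr_gt0 // ltr_wpDl.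
have [dl dl0 hdl] := small_multiple (fun n => gc n ^+ 2 * `|K n 1| * D / fc n)
  (fun n : 'I_m => th' ^+ 2).
pose e0 := Num.min (Num.min (f0 / ((N%:R + 1) * (B + 1))) (th / (Lg * C + 1)))
  (Num.min (th ^+ 2 / (M * D / eta + 1)) (Num.min eta dl)).
exists eta, C, e0; split => //; first by rewrite eta0.
  have p1 : 0 < Lg * C + 1 by rewrite ltr_wpDl // mulr_ge0.
  have p2 : 0 < M * D / eta + 1.
    by rewrite ltr_wpDl // divr_ge0 ?mulr_ge0 // ltW.
  have p3 : 0 < (N%:R + 1) * (B + 1) by rewrite mulr_gt0 // ltr_wpDl.
  by rewrite !lt_min eta0 dl0 !divr_gt0 ?exprn_gt0.
move=> e k x /andP[ege0]; rewrite !lt_min.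
move=> /andP[/andP[e1 e2] /andP[e3 /andP[e4 e5]]] Nk [x1 xs].
pose t i j := dot (x i) (x j).
have t11 i j : - 1 <= t i j <= 1 by apply: unit_dot_le1.
have tn i j : `|t i j| <= 1 by rewrite ler_norml.
pose f u := (u - s) * F.[u].
pose S n := \sum_i \sum_j K n (t i j).
have S0 n : 0 <= S n.
  have := lp_posdef lp n (fun=> 1) x1; rewrite /S.
  by under eq_bigr do under eq_bigr do rewrite !mul1r.
have fB i j : i != j -> f (t i j) <= B * e.
  move=> ij; have := xs i j ij; rewrite -/(t i j) => hs.
  have F0 := lp_F lp (t11 i j); have FB := hB _ (tn i j).
  rewrite ger0_norm // in FB; rewrite /f.
  have [h|h] := lerP (t i j) s; first by have := mulr_ge0 B0 ege0; nra.
  have : (t i j - s) * F.[t i j] <= e * B by apply: ler_pM => //; lra.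
  by rewrite mulrC (mulrC e).
have f1 : f 1 = N%:R * f0 by exact: (lp_N lp).
have fsum : \sum_i \sum_j f (t i j) = k%:R ^+ 2 * f0 + \sum_n fc n * S n.
  rewrite (eq_bigr (fun i => k%:R * f0 + \sum_n fc n * \sum_j K n (t i j))).
    rewrite big_split /= sumr_const card_ord -mulr_natl exchange_big /=.
    congr (_ + _); first by ring.
    by apply: eq_bigr => n _; rewrite /S mulr_sumr.
  move=> i _; under eq_bigr do rewrite /f (lp_fE lp).
  rewrite big_split /= sumr_const card_ord -(mulr_natl f0) exchange_big /=.
  by congr (_ + _); apply: eq_bigr => n _; rewrite mulr_sumr.
pose G p := f (t p.1 p.2).
have psum : \sum_(p | p.1 != p.2) G p = k%:R * f0 * (k%:R - N%:R) + \sum_n fc n * S n.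
  have := fsum; rewrite (pair_bigA _ (fun i j => f (t i j))) /=.
  rewrite (bigID (fun p : 'I_k * 'I_k => p.1 == p.2)) /=.
  have -> : \sum_(p : 'I_k * 'I_k | p.1 == p.2) f (t p.1 p.2) = k%:R * (N%:R * f0).
    rewrite -(pair_big_dep xpredT (fun i j => i == j) (fun i j => f (t i j))) /=.
    rewrite (eq_bigr (fun=> f 1)) => [|i _].
      by rewrite sumr_const card_ord f1 [RHS]mulr_natl.
    by rewrite (big_pred1 i) => [|j]; [rewrite /t x1 | exact: eq_sym].
  by rewrite /G => h; apply: (@addrI _ (k%:R * (N%:R * f0))); rewrite h; ring.
have GB p : p.1 != p.2 -> G p <= B * e by exact: fB.
have fS n : 0 <= fc n * S n by rewrite mulr_ge0 // (lp_fc lp).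
have fSsum : 0 <= \sum_n fc n * S n by exact: sumr_ge0.
have Be0 : 0 <= B * e by rewrite mulr_ge0.
have cardle (Q : pred ('I_k * 'I_k)) : \sum_(p | Q p) B * e <= k%:R ^+ 2 * (B * e).
  rewrite sumr_const -(mulr_natl (B * e)) ler_wpM2r // -natrX ler_nat.
  by apply: leq_trans (max_card _) _; rewrite card_prod card_ord -mulnn.
have kN : k = N.
  apply/eqP; rewrite eqn_leq Nk andbT leqNgt; apply/negP => Nk'.
  have k0 : 0 < k%:R :> R by rewrite ltr0n; apply: leq_trans Nk'.
  have h : k%:R * f0 * (k%:R - N%:R) <= k%:R ^+ 2 * (B * e).
    apply: le_trans (cardle (fun p => p.1 != p.2)).
    apply: (le_trans (y := \sum_(p | p.1 != p.2) G p)).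
      by rewrite psum lerDl.
    by apply: ler_sum => p; exact: GB.
  have {}h : f0 * (k%:R - N%:R) <= k%:R * (B * e).
    by rewrite -(ler_pM2l k0); move: h; rewrite expr2; lra.
  have kN1 : N%:R + 1 <= k%:R :> R by rewrite natr1 ler_nat.
  have N0 : 0 <= N%:R :> R by [].
  have hk : k%:R <= (N%:R + 1) * (k%:R - N%:R) :> R by nra.
  move: e1; rewrite ltr_pdivlMr ?mulr_gt0 ?ltr_wpDl // => e1.
  have h2 : f0 * k%:R <= k%:R * (B * e) * (N%:R + 1).
    apply: le_trans (_ : f0 * ((N%:R + 1) * (k%:R - N%:R)) <= _).
      by rewrite ler_pM2l.
    by rewrite mulrCA mulrC ler_wpM2r // addr_ge0.
  have {}h2 : f0 <= (B * e) * (N%:R + 1).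
    by rewrite -(ler_pM2l k0); move: h2; lra.
  have : 0 <= e * (N%:R + 1) by rewrite mulr_ge0 // addr_ge0.
  by move: e1; lra.
subst k.
have low i j : i != j -> - (D * e) <= f (t i j).
  move=> ij; have h : 0 <= \sum_(p | p.1 != p.2) G p.
    by rewrite psum subrr mulr0 add0r.
  rewrite (bigD1 (i, j)) //= in h.
  have h2 : \sum_(p | (p.1 != p.2) && (p != (i, j))) G p <= D * e.
    rewrite /D -mulrA;
      apply: le_trans (cardle (fun p => (p.1 != p.2) && (p != (i, j)))).
    by apply: ler_sum => p /andP[hp _]; exact: GB.
  by move: h; rewrite {1}/G /=; lra.
have SD n : fc n * S n <= D * e.
  apply: (le_trans (y := \sum_(p | p.1 != p.2) G p)).
    rewrite psum subrr mulr0 add0r (bigD1 n) //= lerDl.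
    by apply: sumr_ge0.
  rewrite /D -mulrA; apply: le_trans (cardle (fun p => p.1 != p.2)).
  by apply: ler_sum => p; exact: GB.
have adjC i j : adjacent s eta x i j -> `|t i j - s| <= C * e.
  move=> /andP[ij hij]; rewrite -/(t i j) in hij.
  have := xs i j ij; rewrite -/(t i j) => hs.
  have Fk : ka <= F.[t i j].
    have h := hLF (t i j) s (tn i j) sn.
    have h2 : LF * `|t i j - s| <= ka.
      have h3 : `|t i j - s| <= ka / (LF + 1).
        by apply: le_trans (ltW hij) _.
      have h4 : 0 <= `|t i j - s| by [].
      by move: h3; rewrite ler_pdivlMr ?ltr_wpDl //; lra.
    have := ler_norm (F.[s] - F.[t i j]); rewrite distrC.
    have FE : F.[s] = 2 * ka by rewrite /ka; field.
    by lra.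
  have [h|h] := lerP s (t i j).
    by apply: le_trans (_ : e <= _); [lra | rewrite ler_peMl].
  have h1 := low i j ij; rewrite /f in h1.
  have h2 : (s - t i j) * ka <= (s - t i j) * F.[t i j].
    by rewrite ler_wpM2l // subr_ge0 ltW.
  have h3 : s - t i j <= D / ka * e.
    by rewrite mulrAC ler_pdivlMr //; lra.
  by rewrite /C mulrDl mul1r; lra.
split => // i.
(* the row sums of the kernels that occur in g are small *)
pose rho n := gc n * \sum_j K n (t i j).
have rhoth n : `|rho n| <= th'.
  have [g00|gn0] := eqVneq (gc n) 0.
    by rewrite /rho g00 mul0r normr0 ltW.
  have fcn := lp_gc lp gn0.
  rewrite -(@ler_pXn2r _ 2) ?nnegrE //; last exact: ltW.
  rewrite real_normK ?num_real // /rho exprMn.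
  have hrow := posdef_row i (lp_posdef lp n) x1.
  apply: le_trans (_ : gc n ^+ 2 * (K n 1 * S n) <= _).
    by rewrite ler_wpM2l // sqr_ge0.
  have K1 := posdef_ge0_1 (lp_posdef lp n) (x1 i).
  have Sn : S n <= D * e / fc n by rewrite ler_pdivlMr // mulrC.
  apply: le_trans (_ : gc n ^+ 2 * (K n 1 * (D * e / fc n)) <= _).
    by rewrite ler_wpM2l ?sqr_ge0 // ler_wpM2l.
  have := hdl n; rewrite exprn_gt0 // ger0_norm // => /(_ isT) h.
  apply: le_trans (ltW h).
  have -> : gc n ^+ 2 * (K n 1 * (D * e / fc n))
    = e * (gc n ^+ 2 * K n 1 * D / fc n) by field; rewrite gt_eqF.
  rewrite ler_wpM2r //; last by exact: ltW.
  have fc0 := ltW fcn.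
  by apply: divr_ge0 => //; apply: mulr_ge0 => //; apply: mulr_ge0 => //; exact: sqr_ge0.
have gsum : \sum_(j | j != i) g.[t i j] = A%:R * g.[s] + \sum_n rho n.
  have : \sum_j g.[t i j] = N%:R * g0 + \sum_n rho n.
    under eq_bigr do rewrite (lp_gE lp).
    rewrite big_split /= sumr_const card_ord -(mulr_natl g0) exchange_big /=.
    by congr (_ + _); apply: eq_bigr => n _; rewrite /rho mulr_sumr.
  rewrite (bigD1 i) //= {1}/t x1 -(lp_A lp) => h.
  by apply: (@addrI _ g.[1]); rewrite h; ring.
have near j : j != i ->
    `|g.[t i j] - (adjacent s eta x i j)%:R * g.[s]| <= th.
  move=> ji; have ij : i != j by rewrite eq_sym.
  have [aij|naij] := boolP (adjacent s eta x i j).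
    rewrite mul1r; apply: le_trans (hLg _ _ (tn i j) sn) _.
    apply: le_trans (_ : Lg * (C * e) <= _).
      by rewrite ler_wpM2l // adjC.
    move: e2; rewrite ltr_pdivlMr ?ltr_wpDl ?mulr_ge0 // => e2.
    by move: e2; rewrite mulrDr mulr1; lra.
  rewrite mul0r subr0 -(@ler_pXn2r _ 2) ?nnegrE //; last exact: ltW.
  rewrite real_normK ?num_real //.
  apply: le_trans (lp_gF lp (t11 i j)) _.
  have hs := xs i j ij; rewrite -/(t i j) in hs.
  have h : eta <= s - t i j.
    move: naij; rewrite /adjacent ij /= -/(t i j) -leNgt.
    by rewrite ler_normr => /orP[] h; lra.
  have h1 := low i j ij; rewrite /f in h1.
  have F0 := lp_F lp (t11 i j).
  have h2 : F.[t i j] <= D * e / eta.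
    by rewrite ler_pdivlMr //; nra.
  apply: le_trans (_ : M * (D * e / eta) <= _); first by rewrite ler_wpM2l.
  move: e3; rewrite ltr_pdivlMr; last by rewrite ltr_wpDl // divr_ge0 ?mulr_ge0 // ltW.
  have -> : M * (D * e / eta) = e * (M * D / eta) by ring.
  by rewrite mulrDr mulr1; lra.
set a := #|_|.
have ai : adjacent s eta x i i = false by rewrite /adjacent eqxx.
have asum : \sum_(j | j != i) (adjacent s eta x i j)%:R = a%:R :> R.
  rewrite /a -sum1_card natr_sum big_mkcond [RHS]big_mkcond /=.
  apply: eq_bigr => j _; rewrite unfold_in.
  have [->|ji] := eqVneq j i; first by [].
  by rewrite /adjacent eq_sym ji /=; case: (_ < _).
have diff : `|(a%:R - A%:R) * g.[s]| < g.[s].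
  have -> : (a%:R - A%:R) * g.[s] = \sum_n rho n -
      \sum_(j | j != i) (g.[t i j] - (adjacent s eta x i j)%:R * g.[s]).
    by rewrite sumrB gsum -mulr_suml asum; ring.
  apply: le_lt_trans (ler_normB _ _) _.
  have h1 : `|\sum_n rho n| <= m%:R * th'.
    apply: le_trans (ler_norm_sum _ _ _) _.
    rewrite mulr_natl -[X in _ *+ X](card_ord m) -sumr_const.
    by apply: ler_sum => n _.
  have h2 : `|\sum_(j | j != i) (g.[t i j] - (adjacent s eta x i j)%:R * g.[s])|
      <= N%:R * th.
    apply: le_trans (ler_norm_sum _ _ _) _.
    apply: (le_trans (y := \sum_(j < N | j != i) th)).
      by apply: ler_sum => j; exact: near.
    rewrite sumr_const mulr_natl ler_pMn2l // (leq_trans (max_card _)) //.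
    by rewrite card_ord.
  have h3 : m%:R * th' <= g.[s] / 4.
    rewrite /th' mulrA ler_pdivrMr ?mulr_gt0 ?ltr_wpDl //.
    by have : 0 <= m%:R :> R by []; nra.
  have h4 : N%:R * th <= g.[s] / 4.
    rewrite /th mulrA ler_pdivrMr ?mulr_gt0 ?ltr_wpDl //.
    by have : 0 <= N%:R :> R by []; nra.
  by lra.
move: diff; rewrite normrM (gtr0_norm gs) -[X in _ < X](mul1r g.[s]) ltr_pM2r //.
move=> diff; apply/eqP; rewrite eqn_leq; apply/andP; split; rewrite leqNgt;
  apply/negP => h; move: diff; rewrite ltNge => /negP; apply.
- rewrite ger0_norm ?subr_ge0 ?ler_nat 1?ltnW // lerBrDr addrC natr1 ler_nat //.
- rewrite distrC ger0_norm ?subr_ge0 ?ler_nat 1?ltnW // lerBrDr addrC natr1 ler_nat //.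
Qed.

(** * Tight certificates *)

(** Coefficients of the Chebyshev polynomials of degree 1 to 17 in the auxiliary
    polynomial of the 600-cell. *)
Definition cert_600cell_f (R : realType) (tau : R) : seq R :=
  [:: 1720 + 2510 * tau; 2346 + 3438 * tau; 2725 + 4220 * tau;
  2998 + 4274 * tau; 2620 + 4180 * tau; 2356 + 3358 * tau;
  1660 + 2520 * tau; 1108 + 1524 * tau; 550 + 770 * tau; 238 + 264 * tau;
  20 + 10 * tau; 0; 0; 26 + 78 * tau; 105 + 40 * tau; - 10 + 80 * tau; 80].

Definition cert_600cell_g (R : realType) (tau : R) : seq R :=
  [:: 5 + 7 * tau; 6 + 8 * tau; 6 + 7 * tau; 5 + 5 * tau; 3 + 3 * tau;
  2 + tau; 1].

Lemma cert_600cell_expansion (R : realType) (tau y : R) : tau ^+ 2 = tau + 1 ->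
  (y - tau) * ((y + 2) * ((y + tau) * (y + 1) * (y + (tau - 1)) * y *
      (y - (tau - 1)) * (y - 1)) ^+ 2 *
    ((4 - y ^+ 2) * (170 - 80 * y) + (45 - 30 * tau) * y + (73 * tau - 74)))
  = 870 + 1260 * tau + \sum_(n <- iota 0 17) nth 0 (cert_600cell_f tau) n * cheb n.+1 y.
Proof.
move=> t2.
have c2 : cheb 2 y = y ^+ 2 - 1 by rewrite chebSS cheb1 cheb0; ring.
have c3 : cheb 3 y = y ^+ 3 - 2 * y by rewrite chebSS c2 cheb1; ring.
have c4 : cheb 4 y = y ^+ 4 - 3 * y ^+ 2 + 1 by rewrite chebSS c3 c2; ring.
have c5 : cheb 5 y = y ^+ 5 - 4 * y ^+ 3 + 3 * y by rewrite chebSS c4 c3; ring.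
have c6 : cheb 6 y = y ^+ 6 - 5 * y ^+ 4 + 6 * y ^+ 2 - 1 by rewrite chebSS c5 c4; ring.
have c7 : cheb 7 y = y ^+ 7 - 6 * y ^+ 5 + 10 * y ^+ 3 - 4 * y
  by rewrite chebSS c6 c5; ring.
have c8 : cheb 8 y = y ^+ 8 - 7 * y ^+ 6 + 15 * y ^+ 4 - 10 * y ^+ 2 + 1
  by rewrite chebSS c7 c6; ring.
have c9 : cheb 9 y = y ^+ 9 - 8 * y ^+ 7 + 21 * y ^+ 5 - 20 * y ^+ 3 + 5 * y
  by rewrite chebSS c8 c7; ring.
have c10 : cheb 10 y = y ^+ 10 - 9 * y ^+ 8 + 28 * y ^+ 6 - 35 * y ^+ 4
    + 15 * y ^+ 2 - 1
  by rewrite chebSS c9 c8; ring.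
have c11 : cheb 11 y = y ^+ 11 - 10 * y ^+ 9 + 36 * y ^+ 7 - 56 * y ^+ 5
    + 35 * y ^+ 3 - 6 * y
  by rewrite chebSS c10 c9; ring.
have c12 : cheb 12 y = y ^+ 12 - 11 * y ^+ 10 + 45 * y ^+ 8 - 84 * y ^+ 6
    + 70 * y ^+ 4 - 21 * y ^+ 2 + 1
  by rewrite chebSS c11 c10; ring.
have c13 : cheb 13 y = y ^+ 13 - 12 * y ^+ 11 + 55 * y ^+ 9 - 120 * y ^+ 7
    + 126 * y ^+ 5 - 56 * y ^+ 3 + 7 * y
  by rewrite chebSS c12 c11; ring.
have c14 : cheb 14 y = y ^+ 14 - 13 * y ^+ 12 + 66 * y ^+ 10 - 165 * y ^+ 8
    + 210 * y ^+ 6 - 126 * y ^+ 4 + 28 * y ^+ 2 - 1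
  by rewrite chebSS c13 c12; ring.
have c15 : cheb 15 y = y ^+ 15 - 14 * y ^+ 13 + 78 * y ^+ 11 - 220 * y ^+ 9
    + 330 * y ^+ 7 - 252 * y ^+ 5 + 84 * y ^+ 3 - 8 * y
  by rewrite chebSS c14 c13; ring.
have c16 : cheb 16 y = y ^+ 16 - 15 * y ^+ 14 + 91 * y ^+ 12 - 286 * y ^+ 10
    + 495 * y ^+ 8 - 462 * y ^+ 6 + 210 * y ^+ 4 - 36 * y ^+ 2 + 1
  by rewrite chebSS c15 c14; ring.
have c17 : cheb 17 y = y ^+ 17 - 16 * y ^+ 15 + 105 * y ^+ 13 - 364 * y ^+ 11
    + 715 * y ^+ 9 - 792 * y ^+ 7 + 462 * y ^+ 5 - 120 * y ^+ 3 + 9 * y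
  by rewrite chebSS c16 c15; ring.
rewrite !big_cons big_nil /= cheb1 c2 c3 c4 c5 c6 c7 c8 c9 c10 c11 c12 c13 c14 c15 c16 c17.
have -> : (y - tau) * ((y + 2) * ((y + tau) * (y + 1) * (y + (tau - 1)) * y *
      (y - (tau - 1)) * (y - 1)) ^+ 2 *
    ((4 - y ^+ 2) * (170 - 80 * y) + (45 - 30 * tau) * y + (73 * tau - 74)))
  = (y + 2) * (y + tau) * (y ^+ 2 - 1) ^+ 2 * y ^+ 2 * (y ^+ 2 - tau ^+ 2) *
    (y ^+ 2 - (tau ^+ 2 - 2 * tau + 1)) ^+ 2 *
    ((4 - y ^+ 2) * (170 - 80 * y) + (45 - 30 * tau) * y + (73 * tau - 74)).
  by ring.
rewrite t2.
ring: t2.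
Qed.

Lemma cert_600cell_expansion_g (R : realType) (tau y : R) : tau ^+ 2 = tau + 1 ->
  (y + 2) * ((y + tau) * (y + 1) * (y + (tau - 1)) * y *
      (y - (tau - 1)) * (y - 1))
  = 3 + 4 * tau + \sum_(n <- iota 0 7) nth 0 (cert_600cell_g tau) n * cheb n.+1 y.
Proof.
move=> t2.
have c2 : cheb 2 y = y ^+ 2 - 1 by rewrite chebSS cheb1 cheb0; ring.
have c3 : cheb 3 y = y ^+ 3 - 2 * y by rewrite chebSS c2 cheb1; ring.
have c4 : cheb 4 y = y ^+ 4 - 3 * y ^+ 2 + 1 by rewrite chebSS c3 c2; ring.
have c5 : cheb 5 y = y ^+ 5 - 4 * y ^+ 3 + 3 * y by rewrite chebSS c4 c3; ring.
have c6 : cheb 6 y = y ^+ 6 - 5 * y ^+ 4 + 6 * y ^+ 2 - 1 by rewrite chebSS c5 c4; ring.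
have c7 : cheb 7 y = y ^+ 7 - 6 * y ^+ 5 + 10 * y ^+ 3 - 4 * y
  by rewrite chebSS c6 c5; ring.
rewrite !big_cons big_nil /= cheb1 c2 c3 c4 c5 c6 c7.
ring: t2.
Qed.

Lemma golden_bounds (R : realType) (tau : R) :
  0 < tau -> tau ^+ 2 = tau + 1 -> 1618 / 1000 < tau < 1619 / 1000.
Proof.
move=> t0 t2; apply/andP; split; rewrite ltNge; apply/negP => h.
  have : tau * tau <= tau * (1618 / 1000) by rewrite ler_pM2l.
  by rewrite -expr2; lra.
have : tau * (1619 / 1000) <= tau * tau by rewrite ler_pM2l.
by rewrite -expr2; lra.
Qed.

Lemma cert_simplex (R : realType) d : (0 < d)%N ->
  exists m K F g f0 g0 M fc gc,
    @lp_cert R d d.+1 d (- d%:R^-1) m K F g f0 g0 M fc gc.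
Proof.
move=> d0; have dp : 0 < d%:R :> R by rewrite ltr0n.
have dn := lt0r_neq0 dp; have di : 0 < d%:R^-1 :> R by rewrite invr_gt0.
have d1 : d%:R^-1 <= 1 :> R by rewrite invf_le1 // ler1n.
exists 1%N, (fun=> id), 1, 1, (d%:R^-1), 1, 1, (fun=> 1), (fun=> 0).
split.
- by apply/andP; split; lra.
- by move=> _; exact: posdef_id.
- by move=> n.
- by move=> n; rewrite eqxx.
- by [].
- by move=> t; rewrite hornerE big_ord1; lra.
- by move=> t; rewrite hornerE big_ord1 mul0r addr0.
- by move=> t _; rewrite hornerE.
- by rewrite hornerE.
- by [].
- by move=> t _; rewrite hornerE expr1n mulr1.
- by rewrite hornerE.
- by rewrite hornerE -natr1; field.
- by rewrite !hornerE -natr1; ring.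
Qed.

Lemma cert_crosspolytope (R : realType) d : (0 < d)%N ->
  exists m K F g f0 g0 M fc gc,
    @lp_cert R d d.*2 (d.*2 - 2) 0 m K F g f0 g0 M fc gc.
Proof.
move=> d0; have dp : 0 < d%:R :> R by rewrite ltr0n.
have dn := lt0r_neq0 dp; have di : 0 < d%:R^-1 :> R by rewrite invr_gt0.
exists 2%N, (fun n : 'I_2 => nth (fun=> 0) [:: fun t => t; fun t => t ^+ 2 - d%:R^-1] n).
exists ('X + 1%:P), ('X + 1%:P), (d%:R^-1), 1, 2.
exists (fun=> 1), (fun n : 'I_2 => nth 0 [:: 1; 0] n).
have E t : ('X + 1%:P).[t] = t + 1 :> R by rewrite !hornerE.
split.
- by apply/andP; split; lra.
- by move=> [[|[|//]] hn] /=; [exact: posdef_id | exact: posdef_sqr].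
- by move=> n.
- by move=> [[|[|//]] hn] /=; rewrite ?eqxx // => _; lra.
- by [].
- by move=> t; rewrite E !big_ord_recr big_ord0 /=; lra.
- by move=> t; rewrite E !big_ord_recr big_ord0 /=; lra.
- by move=> t /andP[h _]; rewrite E; lra.
- by rewrite E add0r.
- by [].
- move=> t /andP[h h']; rewrite E expr2; apply: ler_wpM2r; lra.
- by rewrite E add0r.
- by rewrite E -mul2n natrM; field.
- rewrite !E add0r mulr1 natrB; last by rewrite -mul2n; lia.
  by rewrite -mul2n natrM; ring.
Qed.

(** The pentagon: s = (tau - 1) / 2 is the cosine of 72 degrees, and - tau / 2,
    the cosine of 144 degrees, is the other inner product. *)
Lemma cert_pentagon (R : realType) (tau : R) :
  0 < tau -> tau ^+ 2 = tau + 1 ->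
  exists m K F g f0 g0 M fc gc,
    @lp_cert R 2 5 2 ((tau - 1) / 2) m K F g f0 g0 M fc gc.
Proof.
move=> t0 t2; have /andP[lo hi] := golden_bounds t0 t2.
exists 3%N, (fun n : 'I_3 => nth (fun=> 0) [:: fun t => t; fun t => t ^+ 2 - 2^-1;
  fun t => 4 * t ^+ 3 - 3 * t] n).
exists (('X + (tau / 2)%:P) ^+ 2), ('X + (tau / 2)%:P), ((tau + 2) / 8), (tau / 2), 1.
exists (fun n : 'I_3 => nth 0 [:: (tau + 2) / 4; (tau + 1) / 2; 1 / 4] n).
exists (fun n : 'I_3 => nth 0 [:: 1; 0; 0] n).
have FE t : (('X + (tau / 2)%:P) ^+ 2).[t] = (t + tau / 2) ^+ 2 by rewrite !hornerE.
have gE t : ('X + (tau / 2)%:P).[t] = t + tau / 2 by rewrite !hornerE.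
split.
- by apply/andP; split; lra.
- by move=> [[|[|[|//]]] hn] /=; [exact: posdef_id | exact: (posdef_sqr (d := 2)) |
    exact: posdef_cubic2].
- by move=> [[|[|[|//]]] hn] /=; lra.
- by move=> [[|[|[|//]]] hn] /=; rewrite ?eqxx // => _; lra.
- by lra.
- by move=> t; rewrite FE !big_ord_recr big_ord0 /=; field: t2.
- by move=> t; rewrite gE !big_ord_recr big_ord0 /=; field.
- by move=> t _; rewrite FE sqr_ge0.
- by rewrite FE exprn_gt0 //; lra.
- by [].
- by move=> t _; rewrite gE FE mul1r.
- by rewrite gE; lra.
- by rewrite FE; field: t2.
- by rewrite !gE; field: t2.
Qed.

(** The icosahedron: s = 1 / sqrt 5, and the other inner products are - s and
    - 1.  The kernels are scaled Legendre polynomials. *)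
Lemma cert_icosahedron (R : realType) (tau : R) :
  0 < tau -> tau ^+ 2 = tau + 1 ->
  exists m K F g f0 g0 M fc gc,
    @lp_cert R 3 12 5 ((2 * tau - 1) / 5) m K F g f0 g0 M fc gc.
Proof.
move=> t0 t2; have /andP[lo hi] := golden_bounds t0 t2.
pose r := (2 * tau - 1) / 5.
have r2 : r ^+ 2 = 1 / 5 by rewrite /r; field: t2.
have r0 : 0 < r by rewrite /r; lra.
have r1 : r < 1 by rewrite /r; lra.
rewrite -/r; clearbody r; clear tau t0 t2 lo hi.
exists 4%N, (fun n : 'I_4 => nth (fun=> 0) [:: fun t => t; fun t => t ^+ 2 - 3^-1;
  fun t => 5 * t ^+ 3 - 3 * t; fun t => 35 * t ^+ 4 - 30 * t ^+ 2 + 3] n).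
exists (('X + 1%:P) * ('X + r%:P) ^+ 2), (('X + 1%:P) * ('X + r%:P)).
exists (2 / 15 * (1 + r)), (1 / 3 + r), 2.
exists (fun n : 'I_4 => nth 0 [:: 2 / 5 * (1 + r); r + 23 / 35; (1 + r) / 5; 1 / 35] n).
exists (fun n : 'I_4 => nth 0 [:: 1 + r; 1; 0; 0] n).
have FE t : (('X + 1%:P) * ('X + r%:P) ^+ 2).[t] = (t + 1) * (t + r) ^+ 2.
  by rewrite !hornerE.
have gE t : (('X + 1%:P) * ('X + r%:P)).[t] = (t + 1) * (t + r).
  by rewrite !hornerE.
split.
- by apply/andP; split; lra.
- by move=> [[|[|[|[|//]]]] hn] /=; [exact: posdef_id | exact: (posdef_sqr (d := 3)) |
    exact: posdef_cubic3 | exact: posdef_quartic3].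
- by move=> [[|[|[|[|//]]]] hn] /=; lra.
- by move=> [[|[|[|[|//]]]] hn] /=; rewrite ?eqxx // => _; lra.
- by lra.
- move=> t; rewrite FE.
  have -> : (t - r) * ((t + 1) * (t + r) ^+ 2) = (t + 1) * (t + r) * (t ^+ 2 - r ^+ 2).
    by ring.
  by rewrite r2 !big_ord_recr big_ord0 /=; field.
- by move=> t; rewrite gE !big_ord_recr big_ord0 /=; field.
- by move=> t /andP[h _]; rewrite FE mulr_ge0 ?sqr_ge0 //; lra.
- by rewrite FE mulr_gt0 ?exprn_gt0 //; lra.
- by [].
- move=> t /andP[h h']; rewrite gE FE.
  have -> : ((t + 1) * (t + r)) ^+ 2 = (t + 1) * ((t + 1) * (t + r) ^+ 2) by ring.
  apply: ler_wpM2r; last by lra.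
  by apply: mulr_ge0; [lra | exact: sqr_ge0].
- by rewrite gE mulr_gt0 //; lra.
- rewrite FE; transitivity (2 * (1 + r) * (1 - r ^+ 2)); first by ring.
  by rewrite r2; field.
- rewrite !gE; transitivity (2 + 12 * r + 10 * r ^+ 2); first by ring.
  by rewrite r2; field.
Qed.

(** The cubic factor is written as its chord over the interval [- 2, 2] of the
    variable x = 2 t plus a nonnegative remainder. *)
Lemma cert_600cell_positive (R : realType) (tau : R) (t : R) :
  1618 / 1000 < tau < 1619 / 1000 -> - 1 <= t <= 1 ->
  2 <= (4 - (2 * t) ^+ 2) * (170 - 80 * (2 * t)) + (45 - 30 * tau) * (2 * t) +
    (73 * tau - 74).
Proof.
move=> /andP[lo hi] /andP[l u].
have : 0 <= (4 - (2 * t) ^+ 2) * (170 - 80 * (2 * t)).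
  rewrite mulr_ge0 //; last by lra.
  rewrite (_ : 4 - (2 * t) ^+ 2 = 4 * ((1 - t) * (1 + t))); last by ring.
  by rewrite mulr_ge0 // mulr_ge0; lra.
by nra.
Qed.

(** The 600-cell, with s = cos 36 degrees.  In terms of x = 2 t, the auxiliary
    polynomial has the eight inner products of the 600-cell as roots, double in
    the interior, and a cubic factor chosen so that its expansion in Chebyshev
    polynomials has nonnegative coefficients and no term of degree 12, the
    lowest degree of a spherical harmonic invariant under the symmetry group of
    the 600-cell. *)
Lemma cert_600cell (R : realType) (tau : R) :
  0 < tau -> tau ^+ 2 = tau + 1 ->
  exists m K F g f0 g0 M fc gc,
    @lp_cert R 4 120 12 (tau / 2) m K F g f0 g0 M fc gc.
Proof.
move=> t0 t2; have tb := golden_bounds t0 t2.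
have [s1 s2 s3] : [/\ - 1 <= tau / 2 < 1, - 1 <= tau / 2 <= 1 & 0 < 2 * (tau / 2) + 2].
  by move/andP: tb => [lo hi]; split; try (apply/andP; split); lra.
have x2 (t : R) : - 1 <= t <= 1 -> 0 <= 2 * t + 2 <= 4.
  by move=> /andP[l u]; apply/andP; split; lra.
have hpos (t : R) := cert_600cell_positive tb (t := t).
have f00 : 0 < 870 + 1260 * tau by clear -t0; lra.
have two42 (a : R) : 2 <= a -> 0 <= a /\ 0 < a /\ 4 <= 2 * a.
  by clear; move=> a2; split; [|split]; lra.
have fc0 : all (fun c => 0 <= c) (cert_600cell_f tau).
  have t1 : 1 < tau by move/andP: tb => [lo hi]; lra.
  by clear -t1; rewrite /=; do ![apply/andP; split]; lra.
have fc7 : all (fun c => 0 < c) (take 7 (cert_600cell_f tau)).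
  by clear -t0; rewrite /=; do ![apply/andP; split]; lra.
have q0 : 0 < (tau + tau) * (tau + 1) * (tau + (tau - 1)) * tau *
    (tau - (tau - 1)) * (tau - 1).
  by move/andP: tb => [lo hi]; rewrite !mulr_gt0 //; clear -t0 lo; lra.
have sumE m (c : seq R) t : \sum_(n < m) nth 0 c n * cheb n.+1 (2 * t)
    = \sum_(n <- iota 0 m) nth 0 c n * cheb n.+1 (2 * t) :> R.
  by rewrite -(big_mkord xpredT (fun n => nth 0 c n * cheb n.+1 (2 * t))) /index_iota subn0.
have sum7 (y : R) : \sum_(n <- iota 0 17) nth 0 (cert_600cell_g tau) n * cheb n.+1 y
    = \sum_(n <- iota 0 7) nth 0 (cert_600cell_g tau) n * cheb n.+1 y.
  rewrite (_ : iota 0 17 = iota 0 7 ++ iota 7 10) // big_cat /=.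
  have ge7 n : n \in iota 7 10 -> (7 <= n)%N by rewrite mem_iota => /andP[].
  rewrite [X in _ + X]big1_seq ?addr0 // => n /andP[_ /ge7 n7].
  by rewrite nth_default ?mul0r.
pose x : {poly R} := 2 *: 'X.
pose q : {poly R} := (x + tau%:P) * (x + 1%:P) * (x + (tau - 1)%:P) * x *
  (x - (tau - 1)%:P) * (x - 1%:P).
pose h : {poly R} := (4%:P - x ^+ 2) * (170%:P - 80 *: x) +
  (45 - 30 * tau) *: x + (73 * tau - 74)%:P.
pose q' (t : R) := (2 * t + tau) * (2 * t + 1) * (2 * t + (tau - 1)) * (2 * t) *
  (2 * t - (tau - 1)) * (2 * t - 1).
pose h' (t : R) := (4 - (2 * t) ^+ 2) * (170 - 80 * (2 * t)) +
  (45 - 30 * tau) * (2 * t) + (73 * tau - 74).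
have qE t : q.[t] = q' t by rewrite /q /x !hornerE /q' /=; ring.
have hE t : h.[t] = h' t by rewrite /h /x !hornerE /h' /=; ring.
have [F FE] : exists F : {poly R}, forall t, F.[t]
    = 2 * ((2 * t + 2) * q' t ^+ 2 * h' t).
  exists (2 *: ((x + 2%:P) * q ^+ 2 * h)) => t.
  by rewrite -qE -hE hornerZ !hornerM /x !hornerE.
have [g gE] : exists g : {poly R}, forall t, g.[t] = (2 * t + 2) * q' t.
  by exists ((x + 2%:P) * q) => t; rewrite -qE hornerM /x !hornerE.
clear qE hE; clear x q h.
have tt : 2 * (tau / 2) = tau by field.
have q's : 0 < q' (tau / 2) by rewrite /q' tt.
exists 17%N, (fun n : 'I_17 => fun t => cheb n.+1 (2 * t)), F, g.
exists (870 + 1260 * tau), (3 + 4 * tau), 1.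
exists (fun n => nth 0 (cert_600cell_f tau) n), (fun n => nth 0 (cert_600cell_g tau) n).
have fE t : (2 * t - tau) * ((2 * t + 2) * q' t ^+ 2 * h' t) = _ :=
  cert_600cell_expansion (2 * t) t2.
have gE' t : (2 * t + 2) * q' t = _ := cert_600cell_expansion_g (2 * t) t2.
have half (t a : R) : (t - tau / 2) * (2 * a) = (2 * t - tau) * a.
  by clear; field.
split.
- by [].
- by move=> n; exact: posdef_cheb.
- by move=> n; apply: (all_nthP 0 fc0); exact: ltn_ord.
- move=> n; case: (ltnP n 7) => n7; last by rewrite nth_default ?eqxx.
  by move=> _; have := all_nthP 0 fc7 n n7; rewrite nth_take.
- by [].
- by move=> t; rewrite FE half fE sumE.
- by move=> t; rewrite gE gE' sumE sum7.
- move=> t ht; have [h1 _] := two42 _ (hpos t ht); have /andP[h2 _] := x2 t ht.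
  rewrite FE; apply: mulr_ge0 => //; apply: mulr_ge0 => //; apply: mulr_ge0 => //.
  exact: sqr_ge0.
- have [_ [h1 _]] := two42 _ (hpos _ s2).
  rewrite FE; apply: mulr_gt0 => //; apply: mulr_gt0 => //; apply: mulr_gt0 => //.
  exact: exprn_gt0.
- by [].
- move=> t ht; have [_ [_ h1]] := two42 _ (hpos t ht); have /andP[h2 h3] := x2 t ht.
  rewrite gE FE mul1r.
  have sq (a b : R) : (a * b) ^+ 2 = a * b ^+ 2 * a by clear; ring.
  rewrite sq [leRHS]mulrCA; apply: ler_wpM2l; last exact: le_trans h3 h1.
  by apply: mulr_ge0 => //; exact: sqr_ge0.
- by rewrite gE mulr_gt0.
- rewrite FE /q' /h' mulr1; clear -t2.
  transitivity ((2 - tau) * ((2 + 2) * (2 + tau) ^+ 2 * 9 * (1 + tau) ^+ 2 * 4 *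
    (3 - tau) ^+ 2 * (16 + 13 * tau))); first by field.
  by ring: t2.
- by rewrite !gE /q' mulr1 tt; clear -t2; ring: t2.
Qed.

(** * Rigidity of almost optimal codes *)

(** The conclusion of lp_stability. *)
Definition code_stable (R : realType) (d N A : nat) (s : R) : Prop :=
  exists eta C e0 : R, [/\ 0 < eta < 1 - s, 0 <= C, 0 < e0 &
    forall e k (x : 'I_k -> 'cV[R]_d), 0 <= e < e0 -> (N <= k)%N ->
    spherical_code (s + e) x ->
    [/\ k = N, forall i j, adjacent s eta x i j -> `|dot (x i) (x j) - s| <= C * e &
        forall i, #|adjacent s eta x i| = A]].

Definition clique (I J : eqType) (adj : rel I) (t : J -> I) : Prop :=
  forall i j, i != j -> adj (t i) (t j).

(** Besides the bound N, what is used of an almost optimal code is that its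
    neighbours at distance about arccos s form the facets of a polytope:
    there is a simplex of d mutual neighbours, and each such simplex can be
    crossed through each of its ridges. *)
Definition rigid (R : realType) (d N : nat) (s : R) : Prop :=
  exists eta C e0 : R, [/\ 0 < eta < 1 - s, 0 <= C, 0 < e0 &
    forall e k (x : 'I_k -> 'cV[R]_d), 0 <= e < e0 -> (N <= k)%N ->
    spherical_code (s + e) x ->
    [/\ k = N,
        forall i j, adjacent s eta x i j -> `|dot (x i) (x j) - s| <= C * e,
        exists t : 'I_d -> 'I_k, clique (adjacent s eta x) t &
        forall t : 'I_d -> 'I_k, clique (adjacent s eta x) t ->
          forall i, exists2 q, q != t i &
            clique (adjacent s eta x) (replace_at t i q)]].

Lemma adjacent_sym (R : realType) d (s eta : R) k (x : 'I_k -> 'cV[R]_d) i j :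
  adjacent s eta x i j = adjacent s eta x j i.
Proof. by rewrite /adjacent eq_sym dotC. Qed.

Lemma rigid_of_stable (R : realType) d N A (s : R) :
  code_stable d N A s ->
  (forall adj : rel 'I_N, irreflexive adj -> symmetric adj ->
    (forall i, #|adj i| = A) ->
    (exists t : 'I_d -> 'I_N, clique adj t) /\
    forall t : 'I_d -> 'I_N, clique adj t ->
      forall i, exists2 q, q != t i & clique adj (replace_at t i q)) ->
  rigid d N s.
Proof.
move=> [eta [C [e0 [eta0 C0 e00 H]]]] comb; exists eta, C, e0; split => // e k x.
move=> he Nk hx; have [kN h1 h2] := H e k x he Nk hx; subst k.
have [|||h3 h4] := comb (adjacent s eta x); last by split.
- by move=> i; rewrite /adjacent eqxx.
- by move=> i j; exact: adjacent_sym.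
- exact: h2.
Qed.

Lemma clique_inj (I J : eqType) (adj : rel I) (t : J -> I) :
  irreflexive adj -> clique adj t -> injective t.
Proof.
move=> irr h i j tij; apply/eqP; apply: contraT => /h.
by rewrite tij irr.
Qed.

Lemma replace_at_clique (I J : eqType) (adj : rel I) (t : J -> I) i q :
  symmetric adj -> clique adj t -> (forall j, j != i -> adj q (t j)) ->
  clique adj (replace_at t i q).
Proof.
move=> sym h hq j1 j2 j12; rewrite /replace_at.
case: (eqVneq j1 i) => [E1|n1]; case: (eqVneq j2 i) => [E2|n2].
- by rewrite E1 E2 eqxx in j12.
- exact: hq.
- by rewrite sym; exact: hq.
- exact: h.
Qed.

Lemma rigid_simplex (R : realType) d : (0 < d)%N ->
  code_stable d d.+1 d (- d%:R^-1 : R) -> rigid d d.+1 (- d%:R^-1 : R).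
Proof.
move=> d0 /rigid_of_stable; apply => adj irr sym deg.
have all_adj i j : i != j -> adj i j.
  have /subset_cardP E : #|adj i| = #|predC1 i| by rewrite deg cardC1 card_ord.
  have sub : adj i \subset predC1 i.
    by apply/fintype.subsetP => k; rewrite !inE unfold_in; apply: contraTneq => ->; rewrite irr.
  by move=> ij; have := E sub j; rewrite !inE eq_sym ij unfold_in.
split.
  exists (widen_ord (leqnSn d)) => i j ij; apply: all_adj.
  by apply: contra ij => /eqP /(congr1 val) /= h; apply/eqP/val_inj.
move=> t ht i; have ti := clique_inj irr ht.
have [q hq] : exists q, forall j, t j != q.
  have /fintype.subsetPn [q _ hq] : ~~ ([set: 'I_d.+1]%SET \subset [set t j | j : 'I_d]%SET).
    apply/negP => /subset_leq_card; rewrite cardsT card_ord.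
    by move=> /leq_trans/(_ (leq_imset_card _ _)); rewrite cardT size_enum_ord ltnn.
  by exists q => j; apply: contra hq => /eqP <-; exact: imset_f.
exists q; first by rewrite eq_sym.
by apply: replace_at_clique => // j _; apply: all_adj; rewrite eq_sym.
Qed.

(** Every point has exactly one other point that is not its neighbour, which
    replaces it when a simplex is crossed. *)
Lemma rigid_crosspolytope (R : realType) d : (0 < d)%N ->
  code_stable d d.*2 (d.*2 - 2) (0 : R) -> rigid d d.*2 (0 : R).
Proof.
move=> d0 /rigid_of_stable; apply => adj irr sym deg.
have nadj i : #|[pred j | ~~ adj i j]| = 2%N.
  have := cardC (adj i); rewrite deg card_ord => h.
  have -> : #|[pred j | ~~ adj i j]| = #|[predC adj i]| by apply: eq_card.
  by move: h; set c := #|_|; clearbody c; rewrite -mul2n; lia.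
have anti i : exists2 j, j != i & forall k, ~~ adj i k -> k != i -> k = j.
  have hi : i \in [pred j | ~~ adj i j] by rewrite inE irr.
  have := nadj i; rewrite (cardD1 i) hi add1n => -[] h.
  have [j hj] := fintype.card1P (introT eqP h).
  exists j; first by have := hj j; rewrite !inE eqxx => /andP[].
  move=> k nk ki; have := hj k; rewrite !inE ki nk /=.
  by move=> /esym /eqP.
have anti_nadj i j : j != i -> (forall k, ~~ adj i k -> k != i -> k = j) -> ~~ adj i j.
  move=> ji h; apply/negP => aij; have := nadj i.
  have -> : #|[pred j | ~~ adj i j]| = #|pred1 i|.
    apply: eq_card => k; rewrite !inE; apply/idP/eqP => [nk|->]; last by rewrite irr.
    apply/eqP; apply: contraT => ki; have kj := h k nk ki.
    by rewrite kj aij in nk.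
  by rewrite card1.
have d20 : (0 < d.*2)%N by rewrite double_gt0.
split.
  have main m : (m <= d)%N -> exists t : 'I_m -> 'I_d.*2, clique adj t.
    elim: m => [|m IH] md; first by exists (fun=> Ordinal d20) => -[].
    have [t ht] := IH (ltnW md).
    have [v hv] : exists v, forall j, adj v (t j).
      pose bad := (\bigcup_(j < m) [set v | ~~ adj (t j) v])%SET.
      have badle : (#|bad| <= m.*2)%N.
        apply: leq_trans (_ : \sum_(j < m) 2 <= _)%N.
          apply: leq_trans (_ : \sum_(j < m) #|[set v | ~~ adj (t j) v]%SET| <= _)%N.
            by rewrite /bad; elim/big_rec2: _ => [|j y X _ h];
               [rewrite cards0 | rewrite (leq_trans (leq_card_setU _ _)) // leq_add2l].
          by apply: leq_sum => j _; rewrite cardsE nadj.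
        by rewrite sum_nat_const card_ord muln2.
      have /fintype.subsetPn [v _ hv] : ~~ ([set: 'I_d.*2]%SET \subset bad).
        apply/negP => /subset_leq_card; rewrite cardsT card_ord.
        by move=> /leq_trans/(_ badle); rewrite leq_double leqNgt md.
      exists v => j; rewrite sym; apply: contraT => h.
      by move/negP: hv; case; apply/bigcupP; exists j => //; rewrite finset.inE.
    exists (fun i => if unlift ord0 i is Some j then t j else v) => i j ij.
    case: (unliftP ord0 i) => [i'|] Ei; case: (unliftP ord0 j) => [j'|] Ej.
    - by apply: ht; apply: contra ij => /eqP E; rewrite Ei Ej E.
    - by rewrite sym.
    - exact: hv.
    - by rewrite Ei Ej eqxx in ij.
  exact: main.
move=> t ht i; have [q qi hq] := anti (t i); exists q => //.
apply: replace_at_clique => // j ji; rewrite sym; apply: contraT => nj.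
have nqi : ~~ adj (t i) q by exact: anti_nadj.
have [q' q'q hq'] := anti q.
have jq : t j != q.
  by apply: contraNneq nqi => <-; apply: ht; rewrite eq_sym.
have E1 : t i = q' by apply: hq'; rewrite 1?sym // eq_sym.
have E2 : t j = q' by apply: hq'; rewrite 1?sym.
by have := ht j i ji; rewrite E1 E2 irr.
Qed.

Lemma rigid_pentagon (R : realType) (s : R) : code_stable 2 5 2 s -> rigid 2 5 s.
Proof.
move=> /rigid_of_stable; apply => adj irr sym deg.
have I2 (i j : 'I_2) : j != i -> forall l, l != i -> l = j.
  by move: i j => [[|[|//]] ?] [[|[|//]] ?] //= _ [[|[|//]] ?] // _; apply: val_inj.
split.
  have /card_gt0P [j hj] : (0 < #|adj ord0|)%N by rewrite deg.
  exists (fun i : 'I_2 => if i == ord0 then ord0 else j) => i1 i2 i12.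
  case: (eqVneq i1 ord0) => [E1|n1]; case: (eqVneq i2 ord0) => [E2|n2] //.
  - by rewrite E1 E2 eqxx in i12.
  - by rewrite sym.
  - by rewrite (I2 _ _ n1 _ n2) eqxx in i12.
move=> t ht i; pose j : 'I_2 := if i == ord0 then ord_max else ord0.
have ji : j != i by rewrite /j; case: (eqVneq i ord0) => [->|] //; rewrite eq_sym.
have aji : adj (t j) (t i) by apply: ht.
have /card_gt0P [q] : (0 < #|[predD1 adj (t j) & t i]|)%N.
  by have := deg (t j); rewrite (cardD1 (t i)) [_ \in _]aji add1n => -[->].
rewrite !inE => /andP[qi aq]; exists q => //.
apply: replace_at_clique => // l li; rewrite (I2 _ _ ji _ li) sym; exact: aq.
Qed.

(** The cosine of the angle at a vertex of a spherical triangle, as a function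
    of the cosines p, p' of the adjacent sides and t of the opposite one, near
    the equilateral triangle with p = p' = t = s, whose angle has cosine
    s / (1 + s). *)
Lemma link_estimate (R : realType) (s rho : R) : 0 <= s < 1 -> 0 < rho <= 1 ->
  exists2 dl : R, 0 < dl & forall p p' t, `|p - s| <= dl -> `|p' - s| <= dl ->
  let w := Num.sqrt (1 - p ^+ 2) * Num.sqrt (1 - p' ^+ 2) in
  let v := (t - p * p') / w in
  [/\ p ^+ 2 < 1, t <= s + dl -> v <= s / (1 + s) + rho,
      `|t - s| <= dl -> `|v - s / (1 + s)| <= rho &
      `|v - s / (1 + s)| <= dl -> `|t - s| <= rho].
Proof.
move=> /andP[s0 s1] /andP[r0 r1]; pose W := 1 - s ^+ 2.
have W0 : 0 < W by rewrite subr_gt0 expr_lt1.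
have W1 : W <= 1 by rewrite gerBl sqr_ge0.
have rW : 0 < rho * W by rewrite mulr_gt0.
have rW1 : rho * W <= W by rewrite ler_piMl // ltW.
have rWr : rho * W <= rho by rewrite ler_piMr // ltW.
set s' := s / (1 + s).
have s'W : s' * W = s - s ^+ 2.
  by rewrite /s' /W; field; rewrite gt_eqF // ltr_pwDl.
have s'0 : 0 <= s' by rewrite divr_ge0 // addr_ge0.
have s'1 : s' <= 1 by rewrite ler_pdivrMr ?mul1r ?lerDr // ltr_pwDl.
pose dl := rho * W / 20; exists dl; first by rewrite divr_gt0.
have dlE : 20 * dl = rho * W by rewrite /dl mulrC divfK.
have dl0 : 0 < dl by rewrite divr_gt0.
have WE : W = 1 - s ^+ 2 by [].
move=> p p' t; clearbody dl W s'; clear -dlE dl0 rW rW1 rWr W0 W1 WE s'W s'0 s'1 s0 s1 r0 r1.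
move=> hp hp' w v.
have small z : `|z| <= dl -> [/\ - dl <= z, z <= dl, - dl <= s * z & s * z <= dl].
  rewrite ler_norml => /andP[h1 h2].
  have : s * dl <= 1 * dl by rewrite ler_wpM2r // ltW.
  have : s * - dl <= s * z by rewrite ler_wpM2l.
  have : s * z <= s * dl by rewrite ler_wpM2l.
  by rewrite mulrN mul1r; split; lra.
have small2 z z' : `|z| <= dl -> `|z'| <= dl -> - dl <= z * z' <= dl.
  move=> h h'; rewrite -ler_norml normrM.
  apply: le_trans (_ : 1 * `|z'| <= _); last by rewrite mul1r.
  by rewrite ler_wpM2r //; apply: le_trans h _; lra.
have prod u u' : `|u - s| <= dl -> `|u' - s| <= dl ->
    s ^+ 2 - 3 * dl <= u * u' <= s ^+ 2 + 3 * dl.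
  move=> h h'; have [_ _ h1 h2] := small _ h; have [_ _ h3 h4] := small _ h'.
  have /andP[h5 h6] := small2 _ _ h h'.
  rewrite (_ : u * u' = s ^+ 2 + s * (u - s) + s * (u' - s) + (u - s) * (u' - s)).
    by apply/andP; split; lra.
  by ring.
have /andP[q1 q2] := prod _ _ hp hp; have /andP[q1' q2'] := prod _ _ hp' hp'.
rewrite -!expr2 in q1 q2 q1' q2'.
have /andP[n1 n2] := prod _ _ hp hp'.
have W3 : 0 <= W - 3 * dl by lra.
have sq_le a b : 0 <= a -> 0 <= b -> a ^+ 2 <= b -> a <= Num.sqrt b.
  by move=> a0 b0 ab; rewrite -(ler_pXn2r (ltn0Sn 1)) ?nnegrE ?sqrtr_ge0 // sqr_sqrtr.
pose a := Num.sqrt (1 - p ^+ 2); pose a' := Num.sqrt (1 - p' ^+ 2).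
have a0 : 0 <= a by exact: sqrtr_ge0.
have a'0 : 0 <= a' by exact: sqrtr_ge0.
have aa : a ^+ 2 = 1 - p ^+ 2 by rewrite sqr_sqrtr //; lra.
have aa' : a' ^+ 2 = 1 - p' ^+ 2 by rewrite sqr_sqrtr //; lra.
have w0 : 0 <= w by rewrite mulr_ge0.
have ww : w ^+ 2 = (1 - p ^+ 2) * (1 - p' ^+ 2) by rewrite -aa -aa' -exprMn.
have wl : W - 3 * dl <= w.
  rewrite -(ler_pXn2r (ltn0Sn 1)) ?nnegrE // ww expr2.
  by apply: ler_pM => //; lra.
have wu : w <= W + 3 * dl.
  rewrite -(ler_pXn2r (ltn0Sn 1)) ?nnegrE //; last by lra.
  rewrite ww expr2.
  by apply: ler_pM; lra.
have wp : 0 < w by lra.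
have NE : t - p * p' = w * v by rewrite /v [RHS]mulrC divfK // gt_eqF.
clearbody w v; clear a a' a0 a'0 aa aa' ww sq_le.
have boundw c : -1 <= c <= 2 -> `|c * w - c * W| <= 6 * dl.
  move=> /andP[c1 c2]; rewrite -mulrBr normrM.
  have h1 : `|c| <= 2 by rewrite ler_norml; lra.
  have h2 : `|w - W| <= 3 * dl by rewrite ler_norml; lra.
  rewrite (_ : 6 * dl = 2 * (3 * dl)); last by ring.
  by apply: ler_pM.
have upper : t <= s + dl -> v <= s' + rho.
  move=> ht; rewrite -(ler_pM2l wp) -NE.
  have : -1 <= s' + rho <= 2 by apply/andP; split; lra.
  move=> /boundw; rewrite ler_norml => /andP[h _].
  by rewrite mulrC; lra.
split => //; first by lra.
- rewrite ler_norml => /andP[h1 h2].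
  have h3 : v <= s' + rho by apply: upper; lra.
  have h4 : s' - rho <= v.
    rewrite -(ler_pM2l wp) -NE.
    have : -1 <= s' - rho <= 2 by apply/andP; split; lra.
    move=> /boundw; rewrite ler_norml => /andP[_ h].
    by rewrite mulrC; lra.
  by rewrite ler_norml; lra.
- move=> hv.
  have h1 : `|w * (v - s')| <= 2 * dl.
    by rewrite normrM (ger0_norm w0); apply: ler_pM => //; lra.
  have : -1 <= s' <= 2 by apply/andP; split; lra.
  move=> /boundw; move: h1; rewrite !ler_norml => /andP[h1 h2] /andP[h3 h4].
  have E : t = p * p' + w * (v - s') + s' * w by rewrite mulrBr -NE; ring.
  have rr : rho * W = rho - rho * s ^+ 2 by rewrite WE; ring.
  have : 20 * dl <= rho by lra.
  by move=> ?; rewrite E; apply/andP; split; lra.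
Qed.

Lemma dot_col_mx (R : realType) d (a a' : 'cV[R]_1) (b b' : 'cV[R]_d) :
  dot (col_mx a b) (col_mx a' b') = a 0 0 * a' 0 0 + dot b b'.
Proof.
rewrite !dotE tr_col_mx mul_row_col mxE; congr (_ + _).
by rewrite mxE big_ord1 mxE.
Qed.

(** Coordinates in which the unit vector u is the first axis: the splitting of
    a vector into its component along u and the orthogonal rest. *)
Lemma split_along (R : realType) d (u : 'cV[R]_d.+1) : dot u u = 1 ->
  exists z : 'cV[R]_d.+1 -> 'cV[R]_d,
    forall v v', dot (z v) (z v') = dot v v' - dot v u * dot v' u.
Proof.
move=> u1; pose e : 'cV[R]_(1 + d) := col_mx 1%:M 0.
have e1 : dot e e = 1 by rewrite dot_col_mx dot0l !mxE mulr1 addr0.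
have [H oH Hu] : exists2 H : 'M[R]_(1 + d), orthogonal_mx H & H *m u = e.
  by apply: orthogonal_transitive; rewrite u1 e1.
exists (fun v => dsubmx (H *m v : 'cV[R]_(1 + d))) => v v'.
have split2 (a : 'cV[R]_(1 + d)) : (usubmx a) 0 0 = dot a e.
  by rewrite -[in RHS](vsubmxK a) dot_col_mx dot0r [1%:M _ _]mxE eqxx mulr1 addr0.
have comp a : (usubmx (H *m a : 'cV[R]_(1 + d))) 0 0 = dot a u.
  by rewrite split2 -Hu dot_orth.
have := dot_orth v v' oH.
rewrite -[X in dot X _](vsubmxK (H *m v : 'cV[R]_(1 + d))).
rewrite -[X in dot _ X](vsubmxK (H *m v' : 'cV[R]_(1 + d))).
by rewrite dot_col_mx !comp => <-; rewrite addrC addKr.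
Qed.

(** Projected to the sphere orthogonal to a point u of the code, its A neighbours
    form a code of A points with inner products at most about s / (1 + s), which
    is rigid.  A clique through u is u together with a clique of the link, and
    is crossed by crossing the latter. *)
Theorem rigid_link (R : realType) d N A (s : R) : 0 <= s < 1 -> (0 < d)%N ->
  (0 < N)%N -> code_stable d.+1 N A s -> rigid d A (s / (1 + s)) ->
  rigid d.+1 N s.
Proof.
move=> s01 d0 N0 [eta [C [e0 [/andP[eta0 eta1] C0 e00 stab]]]].
move=> [eta' [C' [e0' [/andP[eta'0 eta'1] C'0 e0'0 link]]]].
have /andP[s0 s1] := s01.
have min1 (r : R) : 0 < r -> 0 < Num.min 1 r <= 1.
  by move=> r0; rewrite lt_min ltr01 r0 ge_min lexx.
have [d3 d30 est3] := link_estimate s01 (min1 _ (divr_gt0 eta0 (ltr0n R 2))).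
have [d2 d20 est2] := link_estimate s01 (min1 _ (divr_gt0 eta'0 (ltr0n R 2))).
pose e' := Num.min (e0' / 2) (d3 / (C' + 1)).
have e'0 : 0 < e' by rewrite lt_min !divr_gt0 ?ltr_wpDl.
have e'lt : e' < e0'.
  by rewrite gt_min; apply/orP; left; rewrite ltr_pdivrMr // ltr_pMr // ltr1n.
have C'e' : C' * e' <= d3.
  have : e' <= d3 / (C' + 1) by rewrite ge_min lexx orbT.
  by rewrite ler_pdivlMr ?ltr_wpDl //; lra.
have [d1 d10 est1] := link_estimate s01 (min1 _ e'0).
clearbody e'.
have [dl [dl0 dl1 dl2 dl3]] : exists dl : R, [/\ 0 < dl, dl <= d1, dl <= d2 & dl <= d3].
  exists (Num.min d1 (Num.min d2 d3)); split.
  - by rewrite !lt_min d10 d20.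
  - by rewrite ge_min lexx.
  - by rewrite ge_min; apply/orP; right; rewrite ge_min lexx.
  - by rewrite ge_min; apply/orP; right; rewrite ge_min lexx orbT.
exists eta, C, (Num.min e0 (dl / (C + 1))); split => //; first by rewrite eta0.
  by rewrite lt_min e00 divr_gt0 // ltr_wpDl.
move=> e k x; rewrite lt_min => /and3P[ege0 ee0 edl] Nk hx.
have Ce : C * e <= dl.
  by move: edl; rewrite ltr_pdivlMr ?ltr_wpDl //; lra.
have ele : e <= dl.
  move: edl; rewrite ltr_pdivlMr ?ltr_wpDl // => h.
  by have := mulr_ge0 ege0 C0; lra.
have [|kN adjC deg] := stab e k x _ Nk hx; first by rewrite ege0.
have [x1 xs] := hx.
pose adj := adjacent s eta x.
have adj_dl i j : adj i j -> `|dot (x j) (x i) - s| <= dl.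
  by move=> /adjC h; rewrite dotC; apply: le_trans h Ce.
(* nu lists the neighbours of x i, and y their directions as seen from x i *)
have linkP i : exists nu : 'I_A -> 'I_k, exists y : 'I_A -> 'cV[R]_d,
    [/\ injective nu, forall j, adj i (nu j), forall j, adj i j -> exists l, nu l = j,
        spherical_code (s / (1 + s) + e') y &
        forall a b, a != b ->
          (adj (nu a) (nu b) -> adjacent (s / (1 + s)) eta' y a b) /\
          (`|dot (y a) (y b) - s / (1 + s)| <= d3 -> adj (nu a) (nu b))].
  pose nu (j : 'I_A) : 'I_k := enum_val (cast_ord (esym (deg i)) j).
  have nui : injective nu by move=> a b /enum_val_inj /cast_ord_inj.
  have nuP j : adj i (nu j) by have := enum_valP (cast_ord (esym (deg i)) j).
  have nus j : adj i j -> exists l, nu l = j.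
    move=> ij; have jin : j \in adjacent s eta x i by [].
    exists (cast_ord (deg i) (enum_rank_in jin j)).
    by rewrite /nu cast_ordK enum_rankK_in.
  have [z zE] := split_along (x1 i).
  pose p a := dot (x (nu a)) (x i).
  have pdl a : `|p a - s| <= dl by exact: adj_dl.
  pose r a := Num.sqrt (1 - p a ^+ 2).
  have p1 a : p a ^+ 2 < 1.
    by have [] := est1 (p a) (p a) s (le_trans (pdl a) dl1) (le_trans (pdl a) dl1).
  have r0 a : 0 < r a by rewrite sqrtr_gt0 subr_gt0.
  pose y a := (r a)^-1 *: z (x (nu a)).
  have yE a b : dot (y a) (y b)
      = (dot (x (nu a)) (x (nu b)) - p a * p b) / (r a * r b).
    rewrite dotZl dotZr zE /p; field.
    by rewrite !gt_eqF.
  exists nu, y; split => //.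
    split=> [a|a b ab].
      rewrite yE x1 -!expr2 sqr_sqrtr ?subr_ge0 ?ltW // divff //.
      by rewrite gt_eqF // subr_gt0.
    have nuab : nu a != nu b by apply: contra ab => /eqP /nui ->.
    have [_ + _ _] := est1 (p a) (p b) (dot (x (nu a)) (x (nu b)))
      (le_trans (pdl a) dl1) (le_trans (pdl b) dl1).
    move=> h; rewrite yE; apply: le_trans (h _) _.
      by apply: le_trans (xs _ _ nuab) _; rewrite lerD2l (le_trans ele).
    by rewrite lerD2l ge_min lexx orbT.
  move=> a b ab; split.
    move=> h; have hd := adj_dl _ _ h.
    have [_ _ + _] := est2 (p b) (p a) (dot (x (nu b)) (x (nu a)))
      (le_trans (pdl b) dl2) (le_trans (pdl a) dl2).
    move=> /(_ (le_trans hd dl2)) h'; rewrite /adjacent ab dotC yE /=.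
    apply: le_lt_trans h' _; rewrite gt_min; apply/orP; right.
    by rewrite ltr_pdivrMr // ltr_pMr // ltr1n.
  rewrite yE => h.
  have [_ _ _ +] := est3 (p a) (p b) (dot (x (nu a)) (x (nu b)))
      (le_trans (pdl a) dl3) (le_trans (pdl b) dl3).
  move=> /(_ h) h'; rewrite /adj /adjacent; apply/andP; split.
    by apply: contra ab => /eqP /nui ->.
  apply: le_lt_trans h' _; rewrite gt_min; apply/orP; right.
  by rewrite ltr_pdivrMr // ltr_pMr // ltr1n.
have irr : irreflexive adj by move=> i; rewrite /adj /adjacent eqxx.
have sym : symmetric adj by move=> i j; exact: adjacent_sym.
have he' : 0 <= e' < e0' by rewrite ltW.
split => //.
  have i0 : 'I_k by apply: (Ordinal (leq_trans N0 Nk)).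
  have [nu [y [nui nuP nus ycode yadj]]] := linkP i0.
  have [_ adjC' [t ht] _] := link e' A y he' (leqnn A) ycode.
  exists (fun j => if unlift ord0 j is Some l then nu (t l) else i0) => a b ab.
  case: (unliftP ord0 a) => [a'|] Ea; case: (unliftP ord0 b) => [b'|] Eb.
  - have ab' : a' != b' by apply: contra ab => /eqP E; rewrite Ea Eb E.
    have h := ht _ _ ab'; have /andP[tab _] := h.
    apply: (yadj _ _ tab).2; exact: le_trans (adjC' _ _ h) C'e'.
  - by rewrite -/adj sym; exact: nuP.
  - exact: nuP.
  - by rewrite Ea Eb eqxx in ab.
move=> t ht i.
have [j ji] : exists j : 'I_d.+1, j != i.
  case: (unliftP ord0 i) => [i'|] Ei; first by exists ord0; rewrite Ei neq_lift.
  by exists (lift ord0 (Ordinal d0)); rewrite Ei eq_sym neq_lift.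
have [nu [y [nui nuP nus ycode yadj]]] := linkP (t j).
have [_ adjC' _ ext] := link e' A y he' (leqnn A) ycode.
have hl l : exists m, nu m = t (lift j l).
  by apply: nus; apply: ht; exact: neq_lift.
have [t' t'E] := choice hl.
have ht' : clique (adjacent (s / (1 + s)) eta' y) t'.
  move=> a b ab.
  have ab' : lift j a != lift j b by apply: contra ab => /eqP /lift_inj ->.
  have tab : t' a != t' b.
    apply: contra ab' => /eqP E; apply/eqP/(clique_inj irr ht).
    by rewrite -!t'E E.
  by apply: (yadj _ _ tab).1; rewrite !t'E; exact: ht.
have [l0 il0] : exists l0, i = lift j l0.
  by case: (unliftP j i) ji => [l0 ->|->]; [exists l0 | rewrite eqxx].
have [q ql0 hq] := ext t' ht' l0.
exists (nu q); first by rewrite il0 -t'E; apply: contra ql0 => /eqP /nui ->.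
apply: replace_at_clique => // b bi.
case: (unliftP j b) => [b'|] Eb; last by rewrite Eb -/adj sym; exact: nuP.
have b'l0 : b' != l0 by apply: contra bi => /eqP E; rewrite Eb il0 E.
have h : adjacent (s / (1 + s)) eta' y q (t' b').
  have := hq l0 b'; rewrite /replace_at eqxx (negPf b'l0); apply.
  by rewrite eq_sym.
have /andP[qb _] := h.
rewrite Eb -t'E; apply: (yadj _ _ qb).2; exact: le_trans (adjC' _ _ h) C'e'.
Qed.

(** * Walks through the facets *)

Fixpoint visited (R : realType) d (al : R) (V : 'I_d -> 'cV[R]_d)
    (l : seq 'I_d) : seq 'cV[R]_d :=
  codom V ++ (if l is i :: l' then visited al (flip al V i) l' else [::]).

Lemma mem_visited (R : realType) d (al : R) (V : 'I_d -> 'cV[R]_d) l j :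
  V j \in visited al V l.
Proof. by case: l => [|i l] /=; rewrite mem_cat codom_f. Qed.

Lemma visited_vertex (R : realType) d (s : R) FF (d3 : (3 <= d)%N) (s1 : s < 1)
    (fs : facet_system s FF) (V : 'I_d -> 'cV[R]_d) l w :
  FF V -> w \in visited (flip_coef d s) V l -> exists W i, FF W /\ W i = w.
Proof.
elim: l V => [|i l IH] V FV /=; rewrite mem_cat => /orP[/codomP [j ->]|] //.
- by exists V, j.
- by exists V, j.
by apply: IH; exact: fs_flip.
Qed.

(** A walk in the facets of the polytope is followed by a walk in the simplices
    of an almost optimal code, each step multiplying the error by a constant. *)
Lemma walk_near (R : realType) d (s : R) FF (d3 : (3 <= d)%N) (s1 : s < 1)
    (fs : facet_system s FF) eta (Ca : R) (l : seq 'I_d) (V : 'I_d -> 'cV[R]_d)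
    (c : R) :
  FF V -> 0 <= Ca -> 0 <= c -> exists C e1 : R, [/\ 0 <= C, 0 < e1 &
    forall e k (x : 'I_k -> 'cV[R]_d) (t : 'I_d -> 'I_k) (Phi : 'M[R]_d),
      0 <= e < e1 -> spherical_code (s + e) x ->
      (forall i j, adjacent s eta x i j -> `|dot (x i) (x j) - s| <= Ca * e) ->
      (forall t : 'I_d -> 'I_k, clique (adjacent s eta x) t ->
        forall i, exists2 q, q != t i &
          clique (adjacent s eta x) (replace_at t i q)) ->
      orthogonal_mx Phi -> clique (adjacent s eta x) t ->
      (forall j, enorm (x (t j) - Phi *m V j) <= c * e) ->
      forall w, w \in visited (flip_coef d s) V l ->
        exists i, enorm (x i - Phi *m w) <= C * e].
Proof.
move=> FV Ca0 c0; elim: l V c c0 FV => [|i l IH] V c c0 FV.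
  exists c, 1; split => // e k x t Phi _ _ _ _ _ _ hx w /=.
  by rewrite cats0 => /codomP [j ->]; exists (t j).
pose al := flip_coef d s; pose v' := mirror al V i.
have Ff : FF (flip al V i) by exact: fs_flip.
have [v'1 v's] := fs_replace_dot fs FV Ff.
have Vi1 := fs_unit fs i FV.
have v'Vi : v' <> V i.
  by have [q qV Fq] := fs_cross fs i FV; rewrite /v' -(fs_crossE d3 s1 fs FV Fq qV).
have hv' j : j != i -> dot v' (V j) = dot (V i) (V j).
  by move=> ji; rewrite v's // (fs_dot fs FV) // eq_sym.
have [h h0 hE] : exists2 h, 0 < h & 2 * h = Num.sqrt (1 - s).
  exists (Num.sqrt (1 - s) / 2); last by field.
  by rewrite divr_gt0 // sqrtr_gt0 subr_gt0.
have [Cm Cm0 [em em0 near]] :=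
  near_mirror (fs_basis d3 s1 fs FV) h0 Vi1 v'1 v'Vi hv'.
pose K := c + Ca; have K0 : 0 <= K by rewrite addr_ge0.
have c'0 : 0 <= c + Cm * K by rewrite addr_ge0 // mulr_ge0.
have [C [e1 [C0 e10 H]]] := IH (flip al V i) (c + Cm * K) c'0 Ff.
exists (c + C), (Num.min e1 (Num.min (em / (K + 1)) (Num.min ((1 - s) / 2) (h / (c + 1))))).
split; first by rewrite addr_ge0.
  by rewrite !lt_min e10 !divr_gt0 ?subr_gt0 ?ltr_wpDl.
move=> e k x t Phi; rewrite !lt_min => /andP[ege0 /andP[ee1 /and3P[eem es eh]]].
move=> hx hadj hext oPhi ht hxt w /=; rewrite mem_cat => /orP[/codomP [j ->]|wv].
  by exists (t j); rewrite mulrDl ler_wpDr // mulr_ge0.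
have [q qti hq] := hext t ht i.
have PhiT : Phi^T *m Phi = 1%:M by [].
have oPhiT := orthogonal_mx_tr oPhi.
have back y v : enorm (Phi^T *m y - v) = enorm (y - Phi *m v).
  by rewrite -(enorm_orth (y - Phi *m v) oPhiT) mulmxBr mulmxA PhiT mul1mx.
have [x1 xs] := hx.
have Keem : 0 <= K * e <= em.
  by rewrite mulr_ge0 //=; move: eem; rewrite ltr_pdivlMr ?ltr_wpDl //; lra.
have cK : c * e <= K * e by rewrite ler_wpM2r // lerDl.
have CaK : Ca * e <= K * e by rewrite ler_wpM2r // lerDr.
have qnear : enorm (x q - Phi *m v') <= Cm * (K * e).
  rewrite -back; apply: (near _ (fun j => Phi^T *m x (t j)) _ Keem).
  - by rewrite dot_orth // x1.
  - by move=> j ji; rewrite back; exact: le_trans (hxt j) cK.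
  - move=> j ji; rewrite dot_orth // (fs_dot fs FV) 1?eq_sym //.
    apply: le_trans CaK; apply: hadj.
    by have := hq i j; rewrite /replace_at eqxx (negPf ji); apply; rewrite eq_sym.
  - rewrite back; have := hxt i => hti.
    have ehc : c * e <= h by move: eh; rewrite ltr_pdivlMr ?ltr_wpDl //; lra.
    have far : 2 * h <= enorm (x q - x (t i)).
      rewrite hE -(ler_pXn2r (ltn0Sn 1)) ?nnegrE ?sqrtr_ge0 ?enorm_ge0 //.
      rewrite sqr_sqrtr ?subr_ge0 1?ltW // sqr_enorm dotBl !dotBr !x1 (dotC (x (t i))).
      by have := xs q (t i) qti; move: es; rewrite ltr_pdivlMr //; lra.
    have := enormD (x q - Phi *m V i) (Phi *m V i - x (t i)).
    rewrite addrA subrK -[enorm (Phi *m V i - _)]enormN opprB; lra.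
have [||i0 hi0] := H e k x (replace_at t i q) Phi _ hx hadj hext oPhi hq _ w wv.
- by rewrite ege0.
- move=> j; rewrite /replace_at /flip /replace_at; case: eqP => _.
    apply: le_trans qnear _; rewrite mulrA ler_wpM2r // lerDr //.
  by apply: le_trans (hxt j) _; rewrite ler_wpM2r // lerDl mulr_ge0.
by exists i0; apply: le_trans hi0 _; rewrite ler_wpM2r // lerDr.
Qed.

Lemma separated (R : realType) d (S : seq 'cV[R]_d) : exists2 sep : R, 0 < sep &
  forall w w', w \in S -> w' \in S -> w != w' -> sep < enorm (w - w').
Proof.
have [sep sep0 h] := small_multiple (fun=> 1)
  (fun p : 'I_(size S) * 'I_(size S) => enorm (nth 0 S p.1 - nth 0 S p.2)).
exists sep => // w w' wS w'S ww'.
have i : (index w S < size S)%N by rewrite index_mem.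
have i' : (index w' S < size S)%N by rewrite index_mem.
have := h (Ordinal i, Ordinal i'); rewrite mulr1 /= !nth_index //; apply.
rewrite lt_neqAle enorm_ge0 andbT; apply: contra ww' => /eqP /esym /enorm_eq0 /eqP.
by rewrite subr_eq0.
Qed.

(** Distinct vertices of a walk are followed by distinct points of the code,
    because these vertices are separated; so if the walk visits N of them, every
    point of the code follows one. *)
Theorem near_vertices (R : realType) d N (s : R) FF (d3 : (3 <= d)%N) (s1 : s < 1)
    (fs : facet_system s FF) (l : seq 'I_d) (V : 'I_d -> 'cV[R]_d)
    (S : seq 'cV[R]_d) :
  rigid d N s -> FF V -> {subset S <= visited (flip_coef d s) V l} ->
  uniq S -> (N <= size S)%N ->
  exists C e1 : R, [/\ 0 <= C, 0 < e1 &
    forall e k (x : 'I_k -> 'cV[R]_d), 0 <= e < e1 -> (N <= k)%N ->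
      spherical_code (s + e) x ->
      k = N /\ exists2 Phi : 'M[R]_d, orthogonal_mx Phi &
        forall i, exists2 w, w \in S & enorm (x i - Phi *m w) <= C * e].
Proof.
move=> [eta [Ca [e0 [_ Ca0 e00 rig]]]] FV Svis Suniq NS.
have [C1 C10 [e2 e20 near]] := near_congruent (fs_basis d3 s1 fs FV).
have [C [e1 [C0 e10 H]]] :=
  walk_near d3 s1 fs eta l FV Ca0 (mulr_ge0 C10 Ca0).
have [sep sep0 hsep] := separated S.
exists C, (Num.min (Num.min e0 e1) (Num.min (e2 / (Ca + 1)) (sep / (2 * C + 1)))).
split => //; first by rewrite !lt_min e00 e10 !divr_gt0 ?ltr_wpDl ?mulr_ge0.
move=> e k x; rewrite !lt_min => /andP[ege0 /andP[/andP[ee0 ee1] /andP[ee2 es]]] Nk hx.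
have [|kN adjC [t ht] ext] := rig e k x _ Nk hx; first by rewrite ege0.
split => //.
have [x1 _] := hx.
have [||Phi oPhi hPhi] := near (fun j => x (t j)) (Ca * e).
- by rewrite mulr_ge0 //=; move: ee2; rewrite ltr_pdivlMr ?ltr_wpDl //; lra.
- move=> i j; have [->|ij] := eqVneq i j.
    by rewrite x1 (fs_unit fs _ FV) subrr normr0 mulr_ge0.
  by rewrite (fs_dot fs FV ij); apply: adjC; exact: ht.
exists Phi => //.
have vis w : w \in S -> exists i, enorm (x i - Phi *m w) <= C * e.
  move=> /Svis; apply: (H e k x t Phi _ hx adjC ext oPhi ht); first by rewrite ege0.
  by move=> j; rewrite -mulrA.
have hv (j : 'I_(size S)) : exists i, enorm (x i - Phi *m nth 0 S j) <= C * e.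
  by apply: vis; exact: mem_nth.
have [f hf] := choice hv.
have fi : injective f.
  move=> j j' jj'; apply/val_inj/eqP; rewrite -(nth_uniq 0 (ltn_ord j) (ltn_ord j') Suniq).
  apply: contraT => /(hsep _ _ (mem_nth _ (ltn_ord j)) (mem_nth _ (ltn_ord j'))).
  rewrite ltNge => /negP; case.
  rewrite -(enorm_orth _ oPhi) mulmxBr.
  have := hf j'; rewrite -jj' => h'; have h := hf j.
  have := enormD (Phi *m nth 0 S j - x (f j)) (x (f j) - Phi *m nth 0 S j').
  rewrite addrA subrK -[enorm (Phi *m _ - x _)]enormN opprB.
  by move: es; rewrite ltr_pdivlMr ?ltr_wpDl ?mulr_ge0 //; lra.
move=> i; have : i \in codom f.
  by apply: inj_card_onto; rewrite ?card_ord // kN.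
move=> /codomP [j ->]; exists (nth 0 S j) => //; exact: mem_nth.
Qed.

Lemma walk_simplex (R : realType) d (s : R) FF (d3 : (3 <= d)%N) (s1 : s < 1)
    (fs : facet_system s FF) (V : 'I_d -> 'cV[R]_d) : FF V ->
  exists l S, [/\ {subset S <= visited (flip_coef d s) V l}, uniq S &
    (d.+1 <= size S)%N].
Proof.
move=> FV; pose i := Ordinal (ltnW (ltnW d3)).
have Vinj := affinely_independent_inj (fs_aff fs FV).
exists [:: i], (mirror (flip_coef d s) V i :: codom V); split.
- move=> w; rewrite in_cons => /orP[/eqP ->|wV] /=.
    rewrite mem_cat; apply/orP; right; rewrite cats0; apply/codomP; exists i.
    by rewrite /flip /replace_at eqxx.
  by rewrite mem_cat wV.
- rewrite /= map_inj_uniq ?enum_uniq // andbT; apply/codomP => -[j E].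
  have [q qV Fq] := fs_cross fs i FV.
  have qE := fs_crossE d3 s1 fs FV Fq qV.
  have [q1 qs] := fs_replace_dot fs FV Fq.
  have [ji|ji] := eqVneq j i; first by apply: qV; rewrite qE E ji.
  by have := qs j ji; rewrite qE E (fs_unit fs _ FV) => h; rewrite h ltxx in s1.
- by rewrite (_ : size _ = (size (codom V)).+1) // size_codom card_ord.
Qed.

Lemma visited_opposite (R : realType) d (V : 'I_d -> 'cV[R]_d) l j :
  j \in l -> - V j \in visited 0 V l.
Proof.
elim: l V => // i l IH V; rewrite in_cons /= mem_cat.
have E : flip 0 V i = replace_at V i (- V i).
  by rewrite /flip /mirror scale0r sub0r.
case: (eqVneq j i) => [-> _|ji /= jl]; apply/orP; right.
  by have := mem_visited 0 (flip 0 V i) l i; rewrite {1}E /replace_at eqxx.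
by have := IH (flip 0 V i) jl; rewrite {1}E /replace_at (negPf ji).
Qed.

Lemma walk_crosspolytope (R : realType) d FF
    (fs : facet_system (0 : R) FF) (V : 'I_d -> 'cV[R]_d) : FF V ->
  exists l S, [/\ {subset S <= visited 0 V l}, uniq S & (d.*2 <= size S)%N].
Proof.
move=> FV; have Vinj := affinely_independent_inj (fs_aff fs FV).
exists (enum 'I_d), (codom V ++ [seq - w | w <- codom V]); split.
- move=> w; rewrite mem_cat => /orP[/codomP [j ->]|/mapP [_ /codomP [j ->] ->]].
    exact: mem_visited.
  by apply: visited_opposite; rewrite mem_enum.
- have uV : uniq (codom V) by rewrite map_inj_uniq ?enum_uniq.
  rewrite cat_uniq uV (map_inj_uniq oppr_inj) uV andbT /=.
  apply/hasPn => _ /mapP [_ /codomP [j ->] ->]; apply/codomP => -[m E].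
  have := congr1 (dot (V j)) E; rewrite dotNr (fs_unit fs _ FV).
  have [->|jm] := eqVneq j m; first by rewrite (fs_unit fs _ FV); lra.
  by rewrite (fs_dot fs FV jm); lra.
- have sV : size (codom V) = d by rewrite size_codom card_ord.
  move: (codom V) sV => c sc.
  by rewrite size_cat size_map sc addnn.
Qed.

(** Arithmetic in Z[tau], x + y tau being represented by (x, y), so that the
    vertices met by an explicit walk can be listed by computation. *)
Definition zval (R : pzRingType) (tau : R) (z : int * int) : R :=
  z.1%:~R + z.2%:~R * tau.

Definition zadd (z w : int * int) : int * int :=
  (intZmod.addz z.1 w.1, intZmod.addz z.2 w.2).

Definition zopp (z : int * int) : int * int :=
  (intZmod.oppz z.1, intZmod.oppz z.2).

(** Multiplication by tau - 1, which is flip_coef for the icosahedron and the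
    600-cell. *)
Definition zflip (z : int * int) : int * int :=
  (intZmod.addz z.2 (intZmod.oppz z.1), z.1).

Lemma zvalD (R : pzRingType) (tau : R) z w :
  zval tau (zadd z w) = zval tau z + zval tau w.
Proof. by rewrite /zval /= !(intrD _ (_ : int)) mulrDl addrACA. Qed.

Lemma zvalN (R : pzRingType) (tau : R) z : zval tau (zopp z) = - zval tau z.
Proof. by rewrite /zval /= !(intrN _ (_ : int)) mulNr opprD. Qed.

Lemma zval_flip (R : comPzRingType) (tau : R) z : tau ^+ 2 = tau + 1 ->
  zval tau (zflip z) = (tau - 1) * zval tau z.
Proof.
case: z => a b t2; rewrite /zval /=.
have -> : (intZmod.addz b (intZmod.oppz a))%:~R = b%:~R - a%:~R :> R.
  exact: (intrB R b a).
have -> : (tau - 1) * (a%:~R + b%:~R * tau)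
    = a%:~R * tau - a%:~R + b%:~R * tau ^+ 2 - b%:~R * tau by ring.
by rewrite t2; ring.
Qed.

(** The 5-adic valuations of the two sides have different parities. *)
Lemma five_sqr (a b : nat) : (a ^ 2 = 5 * b ^ 2)%N -> b = 0%N.
Proof.
case: b => // b h; have a0 : (0 < a)%N by move: h; case: a.
have := congr1 (logn 5) h.
rewrite lognM // !lognX (_ : logn 5 5 = 1%N) //; lia.
Qed.

(** The norm x^2 + x y - y^2 of x + y tau vanishes, and four times this norm is
    (2 x + y)^2 - 5 y^2. *)
Lemma zval_eq0 (R : realType) (tau : R) z : tau ^+ 2 = tau + 1 ->
  zval tau z = 0 -> z = (0, 0).
Proof.
case: z => x y t2; rewrite /zval /= => h.
have norm : (2 * x + y) ^+ 2 = 5 * y ^+ 2 :> int.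
  apply: (@intr_inj R); rewrite !(rmorphXn, rmorphM, rmorphD) /=.
  have -> : x%:~R = - (y%:~R * tau) by apply/eqP; rewrite -addr_eq0 h.
  have -> : (2%:~R * - (y%:~R * tau) + y%:~R) ^+ 2
    = 4 * y%:~R ^+ 2 * tau ^+ 2 - 4 * y%:~R ^+ 2 * tau + y%:~R ^+ 2 :> R by ring.
  by rewrite t2; ring.
have y0 : y = 0.
  apply/eqP; rewrite -absz_eq0; apply/eqP; apply: (@five_sqr (absz (2 * x + y)%R)).
  by rewrite -!abszX norm abszM abszX.
move: h; rewrite y0 mul0r addr0 => /eqP; rewrite intr_eq0 => /eqP ->.
by [].
Qed.

Lemma zval_inj (R : realType) (tau : R) : tau ^+ 2 = tau + 1 ->
  injective (zval tau).
Proof.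
move=> t2 z w zw; have : zval tau (zadd z (zopp w)) = 0.
  by rewrite zvalD zvalN zw subrr.
move=> /(zval_eq0 t2); case: z w {zw} => [a b] [c e] /= [h1 h2].
by congr pair; apply/eqP; rewrite -subr_eq0; apply/eqP.
Qed.

Definition zsum (z : seq (int * int)) : int * int := foldr zadd (0, 0) z.

Definition zentry (st : seq (seq (int * int))) j m : int * int :=
  nth (0, 0) (nth [::] st j) m.

Definition zstep d (st : seq (seq (int * int))) i : seq (seq (int * int)) :=
  mkseq (fun j => if j == i then mkseq (fun m => zadd
      (zflip (zsum [seq zentry st j' m | j' <- iota 0 d & j' != i]))
      (zopp (zentry st i m))) d
    else nth [::] st j) d.

Fixpoint zvisited d (st : seq (seq (int * int))) (l : seq nat) :
    seq (seq (int * int)) :=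
  st ++ (if l is i :: l' then zvisited d (zstep d st i) l' else [::]).

Definition zstart d : seq (seq (int * int)) :=
  mkseq (fun j => mkseq (fun m => (Posz (j == m), 0)) d) d.

Definition zvec (R : realType) d (tau : R) (V : 'I_d -> 'cV[R]_d)
    (c : seq (int * int)) : 'cV[R]_d :=
  \sum_(m < d) zval tau (nth (0, 0) c m) *: V m.

Definition zcoords (R : realType) d (tau : R) (V W : 'I_d -> 'cV[R]_d) st :=
  [/\ size st = d, all (fun c => size c == d) st &
      forall j : 'I_d, W j = zvec tau V (nth [::] st j)].

Lemma zval_sum (R : realType) (tau : R) I (r : seq I) (F : I -> int * int) :
  zval tau (zsum [seq F i | i <- r]) = \sum_(i <- r) zval tau (F i).
Proof.
elim: r => [|i r IH]; first by rewrite big_nil /zval mul0r addr0.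
by rewrite big_cons /= zvalD IH.
Qed.

Lemma zcoords_start (R : realType) d (tau : R) (V : 'I_d -> 'cV[R]_d) :
  zcoords tau V V (zstart d).
Proof.
split; first by rewrite size_mkseq.
  by apply/allP => c /mapP [j _ ->]; rewrite size_mkseq.
move=> j; rewrite /zvec (bigD1 j) //= big1 => [|m mj].
  by rewrite !nth_mkseq // eqxx /zval /= mul0r !addr0 scale1r.
rewrite !nth_mkseq //= (_ : (nat_of_ord j == m) = false).
  by rewrite /zval /= mul0r addr0 scale0r.
by apply/negbTE; rewrite eq_sym.
Qed.

Lemma zcoords_step (R : realType) d (tau : R) (V W : 'I_d -> 'cV[R]_d) st
    (i : 'I_d) : tau ^+ 2 = tau + 1 -> zcoords tau V W st ->
  zcoords tau V (flip (tau - 1) W i) (zstep d st i).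
Proof.
move=> t2 [sst ast hW]; split; first by rewrite size_mkseq.
  apply/allP => c /mapP [j]; rewrite mem_iota add0n => /andP[_ jd] ->.
  case: (j == nat_of_ord i); first by rewrite size_mkseq.
  by apply: (allP ast); rewrite mem_nth // sst.
move=> j; rewrite /flip /replace_at nth_mkseq //.
have -> : (nat_of_ord j == i) = (j == i) by [].
case: (eqVneq j i) => [_|_]; last exact: hW.
rewrite /mirror; transitivity (\sum_(m < d) ((tau - 1) * (\sum_(k < d | k != i)
    zval tau (zentry st k m)) - zval tau (zentry st i m)) *: V m).
  under [RHS]eq_bigr do rewrite scalerBl -scalerA.
  rewrite sumrB -scaler_sumr {1}hW; congr (_ *: _ - _).
  under [RHS]eq_bigr do rewrite scaler_suml.
  by rewrite exchange_big /=; apply: eq_bigr => k _; rewrite hW.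
apply: eq_bigr => m _; congr (_ *: _); rewrite nth_mkseq // zvalD zvalN.
rewrite zval_flip // zval_sum; congr (_ * _ - _).
rewrite big_filter -(big_mkord (fun k => k != i :> nat)
  (fun k => zval tau (zentry st k m))) /index_iota subn0.
by [].
Qed.

Lemma zvisitedP (R : realType) d (tau : R) (V : 'I_d -> 'cV[R]_d)
    (l : seq 'I_d) W st : tau ^+ 2 = tau + 1 -> zcoords tau V W st ->
  visited (tau - 1) W l = [seq zvec tau V c | c <- zvisited d st (map val l)] /\
  all (fun c => size c == d) (zvisited d st (map val l)).
Proof.
move=> t2; elim: l W st => [|i l IH] W st hW.
  have [sst ast hst] := hW; rewrite /= !cats0; split => //.
  apply: (@eq_from_nth _ 0); first by rewrite size_codom card_ord size_map sst.
  move=> j; rewrite size_codom card_ord => jd.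
  rewrite (nth_map [::]) ?sst // -(hst (Ordinal jd)).
  by rewrite (nth_codom 0 _ (cast_ord (esym (card_ord d)) (Ordinal jd))) enum_val_ord;
    congr (W _); apply: val_inj.
have [sst ast hst] := hW.
have [IH1 IH2] := IH _ _ (zcoords_step i t2 hW).
rewrite /= IH1 all_cat ast IH2; split => //; rewrite map_cat; congr (_ ++ _).
apply: (@eq_from_nth _ 0); first by rewrite size_codom card_ord size_map sst.
move=> j; rewrite size_codom card_ord => jd.
rewrite (nth_map [::]) ?sst // -(hst (Ordinal jd)).
by rewrite (nth_codom 0 _ (cast_ord (esym (card_ord d)) (Ordinal jd))) enum_val_ord;
  congr (W _); apply: val_inj.
Qed.

Lemma zvec_inj (R : realType) d (tau : R) (V : 'I_d -> 'cV[R]_d) c c' :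
  tau ^+ 2 = tau + 1 -> (\matrix_(i, j) V j i 0) \in unitmx ->
  size c = d -> size c' = d -> zvec tau V c = zvec tau V c' -> c = c'.
Proof.
move=> t2 Vu sc sc' cc'.
have E (a : seq (int * int)) : zvec tau V a
    = (\matrix_(i, j) V j i 0) *m \col_(m < d) zval tau (nth (0, 0) a m).
  apply/matrixP => i j; rewrite !mxE ord1 /zvec summxE.
  by apply: eq_bigr => m _; rewrite !mxE mulrC.
apply: (@eq_from_nth _ (0, 0)); rewrite ?sc ?sc' // => m md.
apply: (zval_inj t2).
have /matrixP /(_ (Ordinal md) 0) : \col_(m < d) zval tau (nth (0, 0) c m)
    = \col_(m < d) zval tau (nth (0, 0) c' m).
  by apply: (can_inj (mulKmx Vu)); rewrite -!E.
by rewrite !mxE.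
Qed.

(** Distinct coordinate vectors give distinct vertices, tau being irrational,
    so that the vertices met by a walk can be counted by computation. *)
Lemma walk_count (R : realType) d (tau : R) (V : 'I_d -> 'cV[R]_d) (l : seq 'I_d) N :
  tau ^+ 2 = tau + 1 -> (\matrix_(i, j) V j i 0) \in unitmx ->
  (N <= size (undup (zvisited d (zstart d) (map val l))))%N ->
  exists S, [/\ {subset S <= visited (tau - 1) V l}, uniq S & (N <= size S)%N].
Proof.
move=> t2 Vu hN; have [vE hsz] := zvisitedP l t2 (zcoords_start tau V).
exists [seq zvec tau V c | c <- undup (zvisited d (zstart d) (map val l))].
split; last by rewrite size_map.
  by move=> w /mapP [c]; rewrite mem_undup => hc ->; rewrite vE map_f.
rewrite map_inj_in_uniq ?undup_uniq // => c c'; rewrite !mem_undup.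
move=> /(allP hsz) /eqP sc /(allP hsz) /eqP sc'; exact: zvec_inj.
Qed.

(** The walks were found by a greedy search that always crosses towards the
    nearest vertex not yet met. *)
Definition icosahedron_walk : seq nat := [:: 0; 1; 0; 2; 0; 1; 0; 2; 0]%N.

Definition walk_600cell : seq nat :=
  [:: 0; 1; 0; 2; 0; 1; 0; 2; 0; 3; 0; 1; 0; 2; 0; 1; 0; 2; 0; 3; 0; 1; 0; 2;
  0; 1; 0; 2; 0; 3; 0; 1; 0; 2; 0; 1; 0; 2; 0; 3; 0; 1; 0; 2; 0; 1; 0; 2; 0;
  3; 0; 1; 0; 2; 0; 1; 0; 2; 0; 3; 0; 1; 0; 2; 0; 3; 0; 1; 2; 0; 1; 0; 2; 0;
  3; 0; 1; 0; 2; 0; 3; 0; 1; 0; 2; 3; 0; 1; 2; 0; 3; 0; 1; 0; 2; 0; 1; 2; 2;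
  3; 1; 0; 2; 0; 3; 2; 0; 1; 3; 0; 2; 0; 1; 3; 1; 0; 2; 3; 1; 0; 2; 0; 3; 0;
  1; 2; 3; 1; 0; 1; 2; 0; 1; 3]%N.

Lemma ords_of_nats d (l : seq nat) : all (fun i => (i < d)%N) l ->
  exists l' : seq 'I_d, map val l' = l.
Proof.
elim: l => [|i l IH] /=; first by exists [::].
by move=> /andP[id /IH [l' <-]]; exists (Ordinal id :: l').
Qed.

Lemma walk_icosahedron (R : realType) (tau : R) (V : 'I_3 -> 'cV[R]_3) :
  tau ^+ 2 = tau + 1 -> (\matrix_(i, j) V j i 0) \in unitmx ->
  exists l S, [/\ {subset S <= visited (tau - 1) V l}, uniq S & (12 <= size S)%N].
Proof.
move=> t2 Vu; have [l lE] := ords_of_nats (isT : all (fun i => (i < 3)%N) icosahedron_walk).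
exists l; apply: walk_count => //; rewrite lE.
by vm_compute.
Qed.

Lemma walk_of_600cell (R : realType) (tau : R) (V : 'I_4 -> 'cV[R]_4) :
  tau ^+ 2 = tau + 1 -> (\matrix_(i, j) V j i 0) \in unitmx ->
  exists l S, [/\ {subset S <= visited (tau - 1) V l}, uniq S & (120 <= size S)%N].
Proof.
move=> t2 Vu; have [l lE] := ords_of_nats (isT : all (fun i => (i < 4)%N) walk_600cell).
exists l; apply: walk_count => //; rewrite lE.
by vm_compute.
Qed.

(** * Spherical balls and angles *)

Lemma cos_lipschitz (R : realType) (a b : R) : a <= b -> cos a - cos b <= b - a.
Proof.
move=> ab.
have cc : {within `[a, b], continuous (@cos R)}.
  by apply: continuous_subspaceT; exact: continuous_cos.
have [c _ E] := MVT_segment ab (fun x _ => is_derive_cos x) cc.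
by rewrite -opprB E mulNr opprK -[leRHS]mul1r ler_wpM2r ?subr_ge0 ?sin_le1.
Qed.

Lemma acos_dotK (R : realType) d (u v : 'cV[R]_d) :
  dot u u = 1 -> dot v v = 1 -> cos (sdist u v) = dot u v.
Proof. by move=> u1 v1; rewrite acosK // in_itv /= unit_dot_le1. Qed.

Lemma sdist_bounds (R : realType) d (u v : 'cV[R]_d) :
  dot u u = 1 -> dot v v = 1 -> 0 <= sdist u v <= pi.
Proof.
by move=> u1 v1; rewrite /sdist acos_ge0 ?acos_lepi ?unit_dot_le1.
Qed.

(** An angle th = 2 x has chord 2 sin x.  If th is at most pi / 2, then cos is at
    least 1 / 2 on [0, x], so that sin x >= x / 2; if th is obtuse, the chord is
    at least 1. *)
Lemma sdist_le_enorm (R : realType) d (u v : 'cV[R]_d) :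
  dot u u = 1 -> dot v v = 1 -> sdist u v <= 4 * enorm (u - v).
Proof.
move=> u1 v1; set th := sdist u v.
have /andP[th0 thpi] : 0 <= th <= pi by exact: sdist_bounds.
have chord : enorm (u - v) ^+ 2 = 2 - 2 * cos th.
  by rewrite sqr_enorm /th acos_dotK // dotBl !dotBr u1 v1 (dotC v); ring.
have c0 := enorm_ge0 (u - v).
have [h|h] := ltrP (cos th) 0.
  have : 1 <= enorm (u - v).
    by rewrite -(ler_pXn2r (ltn0Sn 1)) ?nnegrE // expr1n chord; lra.
  by have := pihalf_lt2 R; rewrite ltr_pdivrMr //; lra.
pose x := th / 2.
have x0 : 0 <= x by rewrite divr_ge0.
have xpi : x <= pi / 2 by rewrite /x ler_pM2r.
have thx : th = x *+ 2 by rewrite /x -mulr_natr divfK.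
have cx : 1 / 2 <= cos x.
  have cx0 : 0 <= cos x.
    by apply: cos_ge0_pihalf; rewrite xpi andbT (le_trans _ x0) // oppr_le0 ltW ?divr_gt0 ?pi_gt0.
  have := cos_mulr2n x; rewrite -thx => E.
  by rewrite -(ler_pXn2r (ltn0Sn 1)) ?nnegrE // expr_div_n expr1n; move: E; rewrite mulr2n; lra.
have cs : {within `[0, x], continuous (@sin R)}.
  by apply: continuous_subspaceT; exact: continuous_sin.
have [c cin E] := MVT_segment x0 (fun y _ => is_derive_sin y) cs.
have cc : 1 / 2 <= cos c.
  apply: le_trans cx _; move: cin; rewrite in_itv /= => /andP[c00 cx1].
  have pip := pi_gt0 R.
  have ci : c \in `[0, pi] by rewrite in_itv /=; apply/andP; split; lra.
  have xi : x \in `[0, pi] by rewrite in_itv /=; apply/andP; split; lra.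
  by rewrite leNgt ltr_cos // -leNgt.
rewrite sin0 !subr0 in E.
have sx : x / 2 <= sin x by rewrite E; have := ler_wpM2r x0 cc; lra.
have : x <= enorm (u - v).
  rewrite -(ler_pXn2r (ltn0Sn 1)) ?nnegrE // chord thx cos_mulr2n cos2sin2.
  have x20 : 0 <= x / 2 by rewrite divr_ge0.
  have : (x / 2) ^+ 2 <= sin x ^+ 2 by rewrite ler_pXn2r // nnegrE // (le_trans x20).
  have -> : (x / 2) ^+ 2 = x ^+ 2 / 4 by field.
  by rewrite -mulr_natr; lra.
by rewrite thx mulr2n; lra.
Qed.

Lemma interior_sball (R : realType) d (x y : 'cV[R]_d) r :
  dot x x = 1 -> dot y y = 1 -> 0 < r < pi / 2 -> cos r < dot y x ->
  sball_interior x r y.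
Proof.
move=> x1 y1 /andP[r0 rpi] h.
rewrite /sball_interior /interior /=.
have ys : unit_sphere y by apply/unit_sphereE.
suff : within (@unit_sphere R d) (nbhs y) (sball x r).
  by rewrite (nbhs_subspace_in ys).
apply/nbhs_ballP.
pose gap := (dot y x - cos r) / (d%:R + 1).
have gap0 : 0 < gap by rewrite divr_gt0 ?subr_gt0 // ltr_wpDl.
exists gap => //= z [_ zb] zs; split => //.
have z1 : dot z z = 1 by apply/unit_sphereE.
have near : enorm (y - z) <= d%:R * gap.
  apply: enorm_le_coord => [|i]; first exact: ltW.
  by have := zb i 0; rewrite /ball /= !mxE => /ltW.
have hz : cos r < dot z x.
  have := dot_le_enorm (y - z) x; rewrite /enorm x1 sqrtr1 mulr1 -/(enorm _).
  move=> h1; have := le_trans (ler_norm _) (le_trans h1 near); rewrite dotBl.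
  have : gap * (d%:R + 1) = dot y x - cos r by rewrite /gap divfK // gt_eqF // ltr_wpDl.
  by lra.
have /andP[t0 tpi] := sdist_bounds z1 x1.
rewrite leNgt; apply/negP; rewrite -ltr_cos ?in_itv /= ?t0 //.
  by rewrite acos_dotK // ltNge (ltW hz).
by have := pi_gt0 R; move: r0 rpi; lra.
Qed.

(** Two spherical balls whose centres are closer than the sum of the radii
    overlap: divide the arc between the centres in the ratio of the radii. *)
Lemma sball_overlap (R : realType) d (x x' : 'cV[R]_d) r r' :
  dot x x = 1 -> dot x' x' = 1 -> 0 < r < pi / 2 -> 0 < r' < pi / 2 ->
  cos (r + r') < dot x x' ->
  exists y, sball_interior x r y /\ sball_interior x' r' y.
Proof.
move=> x1 x'1 hr hr' h; have /andP[r0 rpi] := hr; have /andP[r'0 r'pi] := hr'.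
have pip := pi_gt0 R.
set al := sdist x x'.
have /andP[al0 alpi] : 0 <= al <= pi by exact: sdist_bounds.
have calpha : cos al = dot x x' by exact: acos_dotK.
have alr : al < r + r'.
  rewrite -ltr_cos ?in_itv /= ?calpha ?al0 ?alpi //.
  by apply/andP; split; lra.
have cosr (a b : R) : 0 <= a -> a < b -> b < pi / 2 -> cos b < cos a.
  move=> a0 ab bpi; rewrite ltr_cos // in_itv /=; apply/andP; split; lra.
have [al00|aln0] := eqVneq al 0.
  have xx' : dot x x' = 1 by rewrite -calpha al00 cos0.
  exists x; split; apply: interior_sball => //.
    by rewrite x1 -(cos0 R); apply: cosr.
  by rewrite xx' -(cos0 R); apply: cosr.
have alp : 0 < al by rewrite lt_neqAle eq_sym aln0.
pose a := al * r / (r + r'); pose b := al * r' / (r + r').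
have rr : 0 < r + r' by rewrite addr_gt0.
have ab : a + b = al by rewrite /a /b; field; rewrite gt_eqF.
have a0 : 0 < a by rewrite divr_gt0 // mulr_gt0.
have b0 : 0 < b by rewrite divr_gt0 // mulr_gt0.
have ar : a < r by rewrite /a ltr_pdivrMr // mulrC ltr_pM2l.
have br : b < r' by rewrite /b ltr_pdivrMr // mulrC ltr_pM2l.
have S0 : 0 < sin al by apply: sin_gt0_pi; apply/andP; split; lra.
clearbody a b; clear h.
have sE : sin al = sin a * cos b + cos a * sin b by rewrite -ab sinD.
have cE : dot x x' = cos a * cos b - sin a * sin b by rewrite -calpha -ab cosD.
have a2 : cos a ^+ 2 = 1 - sin a ^+ 2 by rewrite cos2sin2.
have b2 : cos b ^+ 2 = 1 - sin b ^+ 2 by rewrite cos2sin2.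
pose y := (sin al)^-1 *: (sin b *: x + sin a *: x').
have Sn0 : sin al != 0 by rewrite gt_eqF.
have y1 : dot y y = 1.
  rewrite dotZl dotZr mulrA -invfM -expr2.
  rewrite (_ : dot _ _ = sin al ^+ 2) ?mulVf ?expf_neq0 //.
  rewrite dotDl !dotDr !dotZl !dotZr x1 x'1 (dotC x') cE sE.
  by ring: a2 b2.
have yx : dot y x = cos a.
  rewrite dotZl dotDl !dotZl x1 (dotC x') cE.
  apply: (mulfI Sn0); rewrite mulrA divff // mul1r sE.
  by ring: a2 b2.
have yx' : dot y x' = cos b.
  rewrite dotZl dotDl !dotZl x'1 cE.
  apply: (mulfI Sn0); rewrite mulrA divff // mul1r sE.
  by ring: a2 b2.
exists y; split; apply: interior_sball => //.
  by rewrite yx; apply: cosr => //; exact: ltW.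
by rewrite yx'; apply: cosr => //; exact: ltW.
Qed.

(** * The stability theorem *)

Lemma stable_of_cert (R : realType) d N A (s : R) :
  (exists m K F g f0 g0 M fc gc, @lp_cert R d N A s m K F g f0 g0 M fc gc) ->
  code_stable d N A s.
Proof.
by move=> [m [K [F [g [f0 [g0 [M [fc [gc lp]]]]]]]]]; exact: lp_stability lp.
Qed.

(** The link of a vertex of the icosahedron is a pentagon, and that of a vertex of
    the 600-cell an icosahedron. *)
Lemma rigid_icosahedron (R : realType) (tau : R) :
  0 < tau -> tau ^+ 2 = tau + 1 -> rigid 3 12 ((2 * tau - 1) / 5).
Proof.
move=> t0 t2; have /andP[lo hi] := golden_bounds t0 t2.
apply: (rigid_link (A := 5)) => //; first by apply/andP; split; lra.
  exact/stable_of_cert/cert_icosahedron.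
have -> : (2 * tau - 1) / 5 / (1 + (2 * tau - 1) / 5) = (tau - 1) / 2.
  by field: t2; rewrite ?pnatr_eq0 ?andbT //=; lra.
exact/rigid_pentagon/stable_of_cert/cert_pentagon.
Qed.

Lemma rigid_600cell (R : realType) (tau : R) :
  0 < tau -> tau ^+ 2 = tau + 1 -> rigid 4 120 (tau / 2).
Proof.
move=> t0 t2; have /andP[lo hi] := golden_bounds t0 t2.
apply: (rigid_link (A := 12)) => //; first by apply/andP; split; lra.
  exact/stable_of_cert/cert_600cell.
have -> : tau / 2 / (1 + tau / 2) = (2 * tau - 1) / 5.
  by field: t2; rewrite ?pnatr_eq0 ?andbT //=; lra.
exact: rigid_icosahedron.
Qed.

(** The possible dihedral angles of a facet system determine the inner product
    s, and with it one of the four families of optimal codes; in each case a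
    walk reaches as many vertices as such a code has points. *)
Lemma facet_system_rigid (R : realType) d (s : R) FF (V : 'I_d -> 'cV[R]_d) :
  (3 <= d)%N -> s < 1 -> facet_system s FF -> FF V ->
  exists N l S, [/\ rigid d N s, {subset S <= visited (flip_coef d s) V l},
    uniq S & (N <= size S)%N].
Proof.
move=> d3 s1 fs FV; have d0 : (0 < d)%N by exact: ltnW (ltnW d3).
have dp : 0 < d%:R :> R by rewrite ltr0n.
have alE := fs_al d3 s1 fs FV; have al2 := fs_al_lt2 d3 s1 fs FV.
have Vu := fs_basis d3 s1 fs FV.
have angle := fs_angle d3 s1 fs FV.
move: alE al2 angle; set al := flip_coef d s => alE al2 [alN1|al00|[al0 al1]].
- have sE : s = - d%:R^-1.
    have h : d%:R * s = - 1.
      have : d%:R = (d - 2)%:R + 2 :> R by rewrite -natrD; congr (_%:R); clear -d3; lia.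
      by move=> ->; move: alE; rewrite alN1; lra.
    by apply: (mulfI (lt0r_neq0 dp)); rewrite h mulrN divff // gt_eqF.
  have [l [S [h1 h2 h3]]] := walk_simplex d3 s1 fs FV.
  exists d.+1, l, S; split => //; rewrite sE.
  exact/rigid_simplex/stable_of_cert/cert_simplex.
- have s0 : s = 0 by move: alE; rewrite al00 mul0r; lra.
  rewrite al00; subst s; have [l [S [h1 h2 h3]]] := walk_crosspolytope fs FV.
  exists d.*2, l, S; split => //.
  exact/rigid_crosspolytope/stable_of_cert/cert_crosspolytope.
pose tau := al + 1.
have t0 : 0 < tau by rewrite addr_gt0.
have t2 : tau ^+ 2 = tau + 1 by rewrite /tau sqrrD1 mulr2n; lra.
have alt : al = tau - 1 by rewrite /tau addrK.
have /andP[lo hi] := golden_bounds t0 t2.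
have d4 : (d <= 4)%N.
  rewrite leqNgt; apply/negP => d5.
  have : 4 <= (d - 1)%:R :> R by rewrite (ler_nat _ 4); clear -d5; lia.
  by move: al2; rewrite alt; nra.
clearbody tau.
have [dE|dE] : d = 3%N \/ d = 4%N by clear -d3 d4; lia.
- subst d; rewrite /= mul1r alt in alE.
  have sE : s = (2 * tau - 1) / 5.
    have n0 : 3 - tau != 0 by rewrite gt_eqF //; lra.
    apply: (mulfI n0); have -> : (3 - tau) * s = tau - 1 by lra.
    by field: t2.
  have [l [S [h1 h2 h3]]] := walk_icosahedron t2 Vu.
  exists 12%N, l, S; split => //; last by rewrite alt.
  by rewrite sE; exact: rigid_icosahedron.
- subst d; rewrite (_ : (4 - 2)%N = 2%N) // alt in alE.
  have sE : s = tau / 2.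
    have n0 : 4 - 2 * tau != 0 by rewrite gt_eqF //; lra.
    apply: (mulfI n0); have -> : (4 - 2 * tau) * s = tau - 1 by lra.
    by field: t2.
  have [l [S [h1 h2 h3]]] := walk_of_600cell t2 Vu.
  exists 120%N, l, S; split => //; last by rewrite alt.
  by rewrite sE; exact: rigid_600cell.
Qed.

Lemma facet_system_of_polytope (R : realType) d n (g : 'I_n -> 'cV[R]_d) (l : R) :
  (conv g)° !=set0 -> simplicial_polytope (conv g) ->
  vertices (conv g) `<=` @unit_sphere R d -> 0 <= l ->
  edge_length (conv g) l ->
  facet_system (1 - l ^+ 2 / 2) (facet_simplex (conv g)).
Proof.
move=> Pint Ps Pv l0 [_ Pe].
have un V i : facet_simplex (conv g) V -> dot (V i) (V i) = 1.
  by move=> FV; apply/unit_sphereE/Pv; exact: facet_simplex_vertex.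
split.
- exact: un.
- move=> V i j FV ij; have := Pe _ _ (facet_simplex_edge FV ij).
  move=> /(congr1 (fun r => r ^+ 2)); rewrite sqr_enorm dotBl !dotBr !un //.
  by rewrite (dotC (V j)); lra.
- by move=> V i FV; exact: facet_simplex_flip.
- by move=> V [].
move=> V FV; have [a [b [hab FE [x Fx] hlt]]] := face_functional FV.2.1.
have xb : dot a x = b by move: Fx; rewrite FE => -[].
exists a, b; split.
- exact: facet_normal_neq0 hlt xb.
- by move=> i; have := conv_gen V i; rewrite FE => -[].
- move=> W i FW; apply: (conv_le hab).
  have := conv_gen W i; have [_ [/face_functional [a' [b' [_ -> _ _]]] _]] := FW.
  by case.
Qed.

Lemma code_of_balls (R : realType) d k (x : 'I_k -> 'cV[R]_d) (r : 'I_k -> R)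
    (phi eps : R) :
  0 < phi < pi / 2 -> 0 <= eps < phi ->
  (forall i, unit_sphere (x i)) -> (forall i, 0 < r i < pi / 2) ->
  (forall i, phi - eps <= r i) ->
  trivIset setT (fun i => sball_interior (x i) (r i)) ->
  spherical_code (1 - 2 * sin phi ^+ 2 + 2 * eps) x.
Proof.
move=> /andP[p0 ppi] /andP[e0 ep] xs hr hre triv.
have x1 i : dot (x i) (x i) = 1 by apply/unit_sphereE.
split => // i j ij; have pip := pi_gt0 R.
have /andP[ri0 ripi] := hr i; have /andP[rj0 rjpi] := hr j.
have hi := hre i; have hj := hre j.
have h1 : dot (x i) (x j) <= cos (r i + r j).
  rewrite leNgt; apply/negP => h.
  have [y [yi yj]] := sball_overlap (x1 i) (x1 j) (hr i) (hr j) h.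
  by move/negP: ij; apply; apply/eqP/(triv i j) => //; exists y.
have h2 : cos (r i + r j) <= cos (phi *+ 2 - eps *+ 2).
  have m1 : phi *+ 2 - eps *+ 2 \in `[0, pi].
    by rewrite in_itv /= !mulr2n; apply/andP; split; lra.
  have m2 : r i + r j \in `[0, pi] by rewrite in_itv /=; apply/andP; split; lra.
  by rewrite leNgt ltr_cos // -leNgt !mulr2n; lra.
have h3 : cos (phi *+ 2 - eps *+ 2) - cos (phi *+ 2) <= eps *+ 2.
  apply: le_trans (cos_lipschitz _) _; first by rewrite gerBl mulrn_wge0.
  by rewrite opprB addrC subrK.
have h4 : cos (phi *+ 2) = 1 - 2 * sin phi ^+ 2.
  by rewrite cos_mulr2n cos2sin2 -mulr_natr; ring.
rewrite -h4 mulr_natl; lra.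
Qed.

Theorem theorem1p1 (R : realType) (d : nat) (P : set 'cV[R]_d) (phiP : R)
    (d_ge3 : (3 <= d)%N)
    (P_polytope : polytope P) (P_simplicial : simplicial_polytope P)
    (P_regular : regular_polytope P)
    (P_vertices : vertices P `<=` @unit_sphere R d)
    (phiP_acute : 0 < phiP < pi / 2)
    (P_edge : edge_length P (2 * sin phiP)) :
  exists epsP cP : R, [/\ 0 < epsP, 0 < cP &
    forall (eps : R) (k : nat) (x : 'I_k -> 'cV[R]_d) (r : 'I_k -> R),
      0 <= eps < epsP ->
      (f0 P <= k)%N ->
      (forall i, unit_sphere (x i)) ->
      (forall i, 0 < r i < pi / 2) ->
      (forall i, phiP - eps <= r i) ->
      trivIset setT (fun i => sball_interior (x i) (r i)) ->
      k = f0 P /\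
      exists Phi : 'M[R]_d, orthogonal_mx Phi /\
        forall i, exists v, vertices P v /\ sdist (x i) (Phi *m v) <= cP * eps].
Proof.
have [[n [g PE]] Pint] := P_polytope; subst P.
have /andP[p0 ppi] := phiP_acute.
have sin0 : 0 < sin phiP by apply: sin_gt0_pihalf; rewrite p0.
have l0 : 0 <= 2 * sin phiP by rewrite mulr_ge0 // ltW.
have := facet_system_of_polytope Pint P_simplicial P_vertices l0 P_edge.
have -> : 1 - (2 * sin phiP) ^+ 2 / 2 = 1 - 2 * sin phiP ^+ 2 by field.
set s := 1 - _ => fs.
have s1 : s < 1 by rewrite /s ltrBlDr ltrDl mulr_gt0 // exprn_gt0.
have d0 : (0 < d)%N by exact: ltnW (ltnW d_ge3).
have [F fF] := facet_exists d0 Pint.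
have [V [_ FV]] := simplex_facetE Pint (P_simplicial _ fF) fF.
have [N [l [S [rig Svis Su NS]]]] := facet_system_rigid d_ge3 s1 fs FV.
have [C [e1 [C0 e10 near]]] := near_vertices d_ge3 s1 fs rig FV Svis Su NS.
have Svert w : w \in S -> vertices (conv g) w.
  move=> /Svis /(visited_vertex d_ge3 s1 fs FV) [W [i [FW <-]]].
  exact: facet_simplex_vertex.
have Nf0 : (N <= f0 (conv g))%N.
  have fin : finite_set (vertices (conv g)).
    apply: (@sub_finite_set _ _ [set` codom g]); last exact: finite_seq.
    move=> w vw; have [|r <-] := vertex_of_conv (U := g) vw (conv_gen g).
      by have [_ _ [a [b [_ wE]]]] := vw; have : [set w] w by []; rewrite wE => -[].
    by rewrite /= codom_f.
  apply: leq_trans NS _; rewrite /f0 -(undup_id Su) -card_fseq.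
  apply: fsubset_leq_card; apply/fsubsetP => w wS.
  have {}wS : w \in S by move: wS; rewrite inE.
  by rewrite in_fset_set // inE; exact: Svert.
exists (Num.min phiP (e1 / 2)), (8 * C + 1); split.
- by rewrite lt_min p0 divr_gt0.
- by rewrite ltr_wpDl // mulr_ge0.
move=> eps k x r; rewrite lt_min => /and3P[e0 ephi ee1] f0k xs hr hre triv.
have ehp : 0 <= eps < phiP by rewrite e0.
have code := code_of_balls phiP_acute ehp xs hr hre triv.
have [||kN [Phi oPhi hPhi]] := near (2 * eps) k x _ _ code.
- by rewrite mulr_ge0 //= mulrC -ltr_pdivlMr.
- exact: leq_trans f0k.
split.
  by apply/eqP; rewrite eqn_leq f0k andbT kN.
exists Phi; split => // i; have [w wS hw] := hPhi i.
exists w; split; first exact: Svert.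
have x1 : dot (x i) (x i) = 1 by apply/unit_sphereE.
have w1 : dot (Phi *m w) (Phi *m w) = 1.
  by rewrite dot_orth //; apply/unit_sphereE/P_vertices/Svert.
apply: le_trans (sdist_le_enorm x1 w1) _.
by move: hw; lra.
Qed.
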